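(* Let $d\in\{2,3,4,\ldots\}$. (i) Suppose $\alpha\in(0,d)$. Then, as $n\to\infty$, $$n^{(\alpha/d)-1}\,\mathcal{L}^{d,\alpha}(\mathcal{P}_n)\to 2^{\alpha/d}\,\Gamma(1+(\alpha/d))\,v_d^{-\alpha/d}\quad\text{in } L^1 .$$ (ii) Suppose $\alpha\ge d$. Then there exists $\mu'(d,\alpha)\in(0,\infty)$ such that, as $n\to\infty$, $\mathbb{E}[\mathcal{L}^{d,\alpha}(\mathcal{P}_n)]\to\mu'(d,\alpha)$. Moreover, $$\mu'(d,\alpha)=\mu(d-1,\alpha)+\mathbf{1}_{\{\alpha=d\}}\,2v_d^{-1},$$ where $\mu(d-1,\alpha)\in(0,\infty)$ is the limiting expected total weight of the on-line nearest-neighbour graph on uniform random points in $(0,1)^{d-1}$, that is $\mu(d-1,\alpha)=\lim_{m\to\infty}\mathbb{E}[\mathcal{O}^{d-1,\alpha}(\mathcal{U}_m)]$. In particular, for $\alpha\ge2$, $$\mu(1,\alpha)=\frac{2}{\alpha(\alpha+1)}\left(1+\frac{2^{-\alpha}}{\alpha-1}\right).$$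
   Context: $\|\cdot\|_d$ is the Euclidean norm on $\mathbb{R}^d$; $v_d=\pi^{d/2}[\Gamma(1+d/2)]^{-1}$ is the volume of the unit $d$-ball, where $\Gamma$ is the Euler Gamma function. Minimal directed spanning tree (MDST). For $\mathbf{x},\mathbf{y}\in\mathbb{R}^d$ write $\mathbf{y}\preccurlyeq_*\mathbf{x}$ iff $y_d\le x_d$. For a finite $\mathcal{X}\subset\mathbb{R}^d$ whose points have distinct $d$-th coordinates, the MDST on $\mathcal{X}$ is the directed graph in which each point $\mathbf{x}\in\mathcal{X}$, other than the unique point with minimal $d$-th coordinate, is joined by a directed edge to a Euclidean-nearest point among $\{\mathbf{y}\in\mathcal{X}\setminus\{\mathbf{x}\}:\mathbf{y}\preccurlyeq_*\mathbf{x}\}$. Let $d_*(\mathbf{x};\mathcal{X})$ be the length of this edge, with $d_*(\mathbf{x};\mathcal{X})=0$ if $\mathbf{x}$ is the point of minimal $d$-th coordinate. For $\alpha>0$, $\mathcal{L}^{d,\alpha}(\mathcal{X})=\sum_{\mathbf{x}\in\mathcal{X}}d_*(\mathbf{x};\mathcal{X})^\alpha$ (empty sum $=0$). $\mathcal{P}_n$ is a homogeneous Poisson point process of intensity $n>0$ on $(0,1)^d$ (almost surely a finite set with distinct $d$-th coordinates). On-line nearest-neighbour graph (ONG). For $k\in\mathbb{N}$ and a finite sequence $(\mathbf{Y}_1,\ldots,\mathbf{Y}_m)$ in $\mathbb{R}^k$, each $\mathbf{Y}_i$ with $i\ge2$ is joined to its nearest neighbour among $\mathbf{Y}_1,\ldots,\mathbf{Y}_{i-1}$;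 its total weight is $\mathcal{O}^{k,\alpha}(\mathbf{Y}_1,\ldots,\mathbf{Y}_m)=\sum_{i=2}^m\min_{1\le j<i}\|\mathbf{Y}_i-\mathbf{Y}_j\|_k^\alpha$. In the claim $\mathcal{U}_m$ is a sequence of $m$ independent uniform random vectors in $(0,1)^{d-1}$. *)

(* Defs.v *)
From HB Require Import structures.
From mathcomp Require Import all_boot all_order all_algebra.
From mathcomp Require Import finmap.
From mathcomp Require Import all_classical all_reals all_analysis.

Set Implicit Arguments.
Unset Strict Implicit.
Unset Printing Implicit Defensive.

Import Order.TTheory GRing.Theory Num.Theory.
Import numFieldNormedType.Exports.

Local Open Scope classical_set_scope.
Local Open Scope ring_scope.

(* Points of R^k are k-tuples of reals: unlike row vectors, tuples carry the
   product sigma-algebra in the library. *)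

Definition edist (R : realType) (k : nat) (x y : k.-tuple R) : R :=
  Num.sqrt (\sum_(i < k) (tnth x i - tnth y i) ^+ 2).

Definition Gamma (R : realType) (s : R) : R :=
  \int[lebesgue_measure]_(t in `]0, +oo[) (t `^ (s - 1) * expR (- t)).

Definition unit_ball_volume (R : realType) (d : nat) : R :=
  pi `^ (d%:R / 2) / Gamma (1 + d%:R / 2).

(* k-dimensional Lebesgue measure, as an iterated product of the
   one-dimensional one. *)
Fixpoint lebesgue_tuple (R : realType) (k : nat) :
    set (k.-tuple R) -> \bar R :=
  match k with
  | 0 => fun A => \d_([tuple] : 0.-tuple R) A
  | k'.+1 => fun A => (\int[lebesgue_measure]_x
      lebesgue_tuple [set t : k'.-tuple R | A [tuple of x :: t]])%E
  end.

Definition cube (R : realType) (k : nat) : set (k.-tuple R) :=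
  [set x | forall i, 0 < tnth x i < 1].

(* As the sets A i may be the full space, the product rule for the whole family
   contains the one for every subfamily. *)
Definition mutually_independent disp (T : measurableType disp) (R : realType)
    (P : probability T R) disp' (T' : measurableType disp') (m : nat)
    (Y : 'I_m -> T -> T') :=
  forall A : 'I_m -> set T', (forall i, measurable (A i)) ->
    P (\bigcap_i (Y i @^-1` A i)) = (\prod_i P (Y i @^-1` A i))%E.

Definition count_in disp (T : measurableType disp) (R : realType) (d : nat)
    (X : T -> {fset d.-tuple R}) (A : set (d.-tuple R)) (w : T) : nat :=
  #|` [fset x in X w | x \in A]%fset |.

(* [poisson_prob r 0] is the Poisson law with parameter r (the point mass at 0
   if r = 0); its second argument is not used by the library. *)
Record is_poisson_process disp (T : measurableType disp) (R : realType)
    (P : probability T R) (d : nat) (n : R)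
    (X : T -> {fset d.-tuple R}) : Prop := IsPoissonProcess {
  pp_cube : forall w x, x \in X w -> cube x ;
  pp_measurable : forall A, measurable A ->
    measurable_fun [set: T] (count_in X A) ;
  pp_law : forall A, measurable A -> forall B : set nat,
    P (count_in X A @^-1` B) =
    poisson_prob (n * fine (lebesgue_tuple (A `&` @cube R d))) 0 B ;
  pp_indep : forall (m : nat) (A : 'I_m -> set (d.-tuple R)),
    (forall i, measurable (A i)) -> trivIset [set: 'I_m] A ->
    mutually_independent P (fun i => count_in X (A i)) }.

Definition preceq_last (R : realType) (d : nat) (y x : d.-tuple R) : bool :=
  nth 0 y d.-1 <= nth 0 x d.-1.

Definition predecessors (R : realType) (d : nat) (X : {fset d.-tuple R})
    (x : d.-tuple R) : {fset d.-tuple R} :=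
  [fset y in X | (y != x) && preceq_last y x]%fset.

Definition is_nearest (R : realType) (d : nat) (S : {fset d.-tuple R})
    (x y : d.-tuple R) : Prop :=
  y \in S /\ forall z, z \in S -> edist x y <= edist x z.

(* The endpoint of the edge of the tree that starts at x; ties are broken
   arbitrarily, and the default value x is taken when there is no edge. *)
Definition mdst_target (R : realType) (d : nat) (X : {fset d.-tuple R})
    (x : d.-tuple R) : d.-tuple R :=
  xget x [set y | is_nearest (predecessors X x) x y].

Definition mdst_dist (R : realType) (d : nat) (X : {fset d.-tuple R})
    (x : d.-tuple R) : R :=
  if predecessors X x == fset0 then 0 else edist x (mdst_target X x).

Definition mdst_weight (R : realType) (d : nat) (alpha : R)
    (X : {fset d.-tuple R}) : R :=
  \sum_(x <- X) mdst_dist X x `^ alpha.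

(* The points of the sequence are Y 0, ..., Y (m - 1). *)
Definition ong_weight (R : realType) (k : nat) (alpha : R) (m : nat)
    (Y : nat -> k.-tuple R) : R :=
  \sum_(1 <= i < m)
    \big[Num.min/edist (Y i) (Y 0%N) `^ alpha]_(0 <= j < i)
      edist (Y i) (Y j) `^ alpha.

Record is_iid_uniform disp (T : measurableType disp) (R : realType)
    (P : probability T R) (k m : nat) (U : nat -> T -> k.-tuple R) : Prop :=
  IsIIDUniform {
  unif_measurable : forall i, (i < m)%N -> measurable_fun [set: T] (U i) ;
  unif_law : forall i, (i < m)%N -> forall A, measurable A ->
    P (U i @^-1` A) = lebesgue_tuple (A `&` @cube R k) ;
  unif_indep : mutually_independent P (fun i : 'I_m => U i) }.

(* E[O^{k, alpha}(U_m)] -> mu; the samples for different m need not be related. *)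
Definition is_ong_limit (R : realType) (k : nat) (alpha mu : R) : Prop :=
  forall disp (T : measurableType disp) (P : probability T R)
    (U : nat -> nat -> T -> k.-tuple R),
    (forall m, is_iid_uniform P m (U m)) ->
    ('E_P[fun w => ong_weight alpha m (U m ^~ w)])%E @[m --> \oo] --> mu%:E.

Definition cvg_L1 disp (T : measurableType disp) (R : realType)
    (P : probability T R) (f : R -> T -> R) (c : R) : Prop :=
  (\forall n \near +oo, f n \in Lfun P 1%E) /\
  ('N[P]_1[EFin \o (fun w => f n w - c)%R])%E @[n --> +oo] --> 0%E.

(* Main.v *)
Require Import Defs.
From HB Require Import structures.
From mathcomp Require Import all_boot all_order all_algebra.
From mathcomp Require Import finmap.
From mathcomp Require Import all_classical all_reals all_analysis.
From mathcomp Require Import measurable_realfun ring lra.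

Set Implicit Arguments.
Unset Strict Implicit.
Unset Printing Implicit Defensive.

Import Order.TTheory GRing.Theory Num.Theory.
Import numFieldNormedType.Exports.

Local Open Scope classical_set_scope.
Local Open Scope ring_scope.

(** Everything is read off the function [r |-> M_r], where [M_r] is the number of points
    of the sample that have no other point below them within distance [r] ([mcount]). A
    point that starts an edge of length [l] counts exactly for [r < l], and the lowest
    point counts for all [r]. As [l ^ a] is the integral of [a * r ^ (a - 1)] over
    [0 < r < l], the weight [L] with exponent [a] of every configuration in the cube
    satisfies
      [L + K ^ a * M_K = \int_(0 < r < K) a * r ^ (a - 1) * M_r]
    for [K >= d], which exceeds the diameter of the cube ([mdst_weight_integral]).

    For a Poisson process of intensity [n] the mean of [M_r] is [n] times the integral
    over the cube of [expR (- n * V x r)], where [V x r] is the volume of the part of the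
    cube below [x] and within distance [r] ([vcap], [mean_mcount]). It is obtained by
    cutting the cube into small cells: the indicators that the cells are hit are
    independent, and the number of occupied cells with no occupied cell below and near
    them is eventually [M_r]. Cells that are not close to one another decouple, which also
    gives [E M_r ^ 2 <= (E M_r) ^ 2 + n + n ^ 2 * (4 * r) ^ d] ([sqr_mcount]).

    When [a < d], the relevant radii are [r = n ^ (- 1 / d) * p]. Away from the boundary
    [V x r] is half the volume of a ball, so the mean of [M_r / n] tends to
    [expR (- v_d / 2 * p ^ d)], and by the second moment bound [M_r / n] does so in [L1].
    The integral of this limit against [a * p ^ (a - 1)] is the announced constant
    ([integral_pkern_exp]). Dominated convergence applies because the mean of [M_r / n] is
    at most a constant times [p ^ (- d)] ([cap_mean_tail]), which is where [a < d] enters.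

    When [a >= d], the points of height at least [r] contribute [n ^ (1 - a / d)] times a
    quantity with the limit just found: nothing if [a > d], and [2 / v_d] if [a = d]. The
    points of height less than [r] live in a layer of height of order [1 / n] at the
    bottom of the cube. Stretching that layer by [n] turns the half balls into cylinders
    over balls of dimension [d - 1], so the number of such points has mean converging to
    the integral over the [d - 1]-dimensional cube of [1 / B u r], with [B u r] the volume
    of the ball of centre [u] and radius [r] inside the cube ([vball], [cvg_low_mean]).

    In the on-line nearest-neighbour graph, the [i]-th edge is longer than [r] with
    probability the integral of [(1 - B u r) ^ i]. Summing over [i >= 1] gives the
    integral of [1 / B u r - 1], the same as for the bottom layer up to the term coming
    from [K ^ a * M_K]; hence both limits are expressed by [ong_mean]. In dimension one
    [B u r] is the length of an interval, and the double integral is elementary once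
    [u + r] is taken as a variable ([ong_mean1E]). *)

(** * Lebesgue measure on tuples *)

Definition mcons (R : realType) (k : nat) (p : measurableTypeR R * k.-tuple R) : k.+1.-tuple R :=
  [tuple of (p.1 : R) :: p.2].

Lemma measurable_mcons (R : realType) k :
  measurable_fun [set: measurableTypeR R * k.-tuple R] (@mcons R k).
Proof. exact: measurable_cons. Qed.

Lemma measurable_box (R : realType) k (A : 'I_k -> set R) :
  (forall i, measurable (A i)) ->
  measurable [set x : k.-tuple R | forall i, A i (tnth x i)].
Proof.
move=> mA; rewrite (_ : [set _ | _] = \bigcap_(i in [set: 'I_k]) ((fun x => tnth x i) @^-1` A i)).
  apply: fin_bigcap_measurable => // i _; rewrite -[X in measurable X]setTI.
  exact: measurable_tnth.
by apply/seteqP; split=> x /= h i; [move=> _; exact: h|exact: h].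
Qed.

Lemma mcons_box (R : realType) k (A : 'I_k.+1 -> set R) :
  @mcons R k @^-1` [set x | forall i, A i (tnth x i)] =
  A ord0 `*` [set x | forall i, A (lift ord0 i) (tnth x i)].
Proof.
apply/seteqP; split => -[x t] /=.
  by move=> h; split; [have := h ord0; rewrite tnth0|move=> i; have := h (lift ord0 i); rewrite tnthS].
by move=> [h0 h] i; case: (unliftP ord0 i) => [j ->|->]; rewrite ?tnth0 ?tnthS.
Qed.

Definition bigbox (R : realType) k (n : nat) : set (k.-tuple R) :=
  [set x | forall i : 'I_k, `[- n%:R, n%:R]%classic (tnth x i)].

Lemma measurable_bigbox (R : realType) k n : measurable (@bigbox R k n).
Proof.
apply: (@measurable_box _ _ (fun=> `[- n%:R, n%:R]%classic)) => i.
exact: measurable_itv.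
Qed.

Lemma bigcup_bigbox (R : realType) k : \bigcup_n @bigbox R k n = setT.
Proof.
apply/seteqP; split => // x _.
pose s := \sum_(i < k) `|tnth x i|.
exists (Num.truncn s).+1 => // i /=.
rewrite in_itv/= -ler_norml; apply: le_trans (ltW (truncnS_gt s)).
by rewrite /s (bigD1 i)//= lerDl sumr_ge0.
Qed.

(** The iterated integral is the image of a product measure, and forming that product
    requires the lower-dimensional factor to be sigma-finite; finiteness on the boxes
    [bigbox] is what makes the induction go through. *)
Lemma lebesgue_tuple_measure (R : realType) k :
  exists m : {sigma_finite_measure set (k.-tuple R) -> \bar R},
    (m : set (k.-tuple R) -> \bar R) = @lebesgue_tuple R k /\
    forall n : nat, (m (@bigbox R k n) < +oo)%E.
Proof.
elim: k => [|k [m [mE mfin]]].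
  exists (@dirac _ (0.-tuple R) ([tuple] : 0.-tuple R) R); split => // n.
  by rewrite /= diracE ltry.
pose p : {measure set (k.+1.-tuple R) -> \bar R} :=
  measure_function_pushforward__canonical__measure_function_Measure
    ((@lebesgue_measure R) \x m)%E (@measurable_mcons R k).
have pfin n : (p (@bigbox R k.+1 n) < +oo)%E.
  rewrite /p/= /pushforward (@mcons_box _ _ (fun=> `[- n%:R, n%:R]%classic)).
  rewrite product_measure1E; last 2 first.
  - exact: measurable_itv.
  - exact: measurable_bigbox.
  have h : (lebesgue_measure (`[(- n%:R)%R, n%:R%R]%classic : set R) < +oo)%E.
    by rewrite lebesgue_measure_itv/=; case: ifP => _; rewrite -?EFinB ltry.
  by rewrite lte_mul_pinfty ?ge0_fin_numE//; exact: (mfin n).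
have sf : sigma_finite setT p.
  exists (@bigbox R k.+1); first by rewrite bigcup_bigbox.
  by move=> n; split => //; exact: measurable_bigbox.
(* the two structures on the same function are packed so that the next product can use them *)
pose pm' : {sigma_finite_measure set (k.+1.-tuple R) -> \bar R} :=
  HB.pack (p : set _ -> \bar R) (Measure.on p) (Measure_isSigmaFinite.Build _ _ _ p sf).
exists pm'; split => //; apply/funext => A /=.
rewrite /p /pushforward /product_measure1 /=.
apply: eq_integral => x _ /=; rewrite mE; congr lebesgue_tuple.
by apply/seteqP; split=> t; rewrite /xsection/= inE.
Qed.

Section lebesgue_tuple_instance.
Variables (R : realType) (k : nat).

Let lt0 : @lebesgue_tuple R k set0 = 0%E.
Proof. by have [m [<- _]] := lebesgue_tuple_measure R k; rewrite measure0. Qed.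

Let lt_ge0 A : (0 <= @lebesgue_tuple R k A)%E.
Proof. by have [m [<- _]] := lebesgue_tuple_measure R k; exact: measure_ge0. Qed.

Let lt_add : semi_sigma_additive (@lebesgue_tuple R k).
Proof.
have [m [<- _]] := lebesgue_tuple_measure R k.
exact: measure_semi_sigma_additive.
Qed.

HB.instance Definition _ :=
  isMeasure.Build _ _ _ (@lebesgue_tuple R k) lt0 lt_ge0 lt_add.

Let lt_sfinite : sigma_finite setT (@lebesgue_tuple R k).
Proof.
have [m [<- _]] := lebesgue_tuple_measure R k; exact: sigma_finiteT.
Qed.

HB.instance Definition _ :=
  Measure_isSigmaFinite.Build _ _ _ (@lebesgue_tuple R k) lt_sfinite.

End lebesgue_tuple_instance.

Notation lam k := (@lebesgue_tuple _ k).

Lemma lebesgue_tupleS (R : realType) k (A : set (k.+1.-tuple R)) :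
  lebesgue_tuple A = pushforward (lebesgue_measure \x @lebesgue_tuple R k)%E (@mcons R k) A.
Proof.
rewrite /pushforward /product_measure1 /=.
apply: eq_integral => x _ /=; congr lebesgue_tuple.
by apply/seteqP; split=> t; rewrite /xsection/= inE.
Qed.

Lemma ge0_integral_mcons (R : realType) k (f : k.+1.-tuple R -> \bar R) :
  measurable_fun [set: k.+1.-tuple R] f -> (forall x, 0 <= f x)%E ->
  (\int[lam k.+1]_x f x =
   \int[lebesgue_measure]_x \int[lam k]_t f (mcons (x, t)))%E.
Proof.
move=> mf f0.
pose p := (measure_function_pushforward__canonical__measure_function_Measure
    ((@lebesgue_measure R) \x lam k)%E (@measurable_mcons R k)).
rewrite (eq_measure_integral p); last by move=> A mA _; exact: lebesgue_tupleS.
rewrite ge0_integral_pushforward//; last exact: measurable_mcons.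
rewrite preimage_setT fubini_tonelli1// => [|x]; last exact: f0.
by apply: measurableT_comp => //; exact: measurable_mcons.
Qed.

Lemma lebesgue_tuple_box (R : realType) k (A : 'I_k -> set R) :
  (forall i, measurable (A i)) ->
  lam k [set x | forall i, A i (tnth x i)] = (\prod_(i < k) lebesgue_measure (A i))%E.
Proof.
elim: k A => [|k ih] A mA.
  by rewrite big_ord0 /= diracE mem_set// => -[].
rewrite lebesgue_tupleS /pushforward mcons_box product_measure1E; last 2 first.
- exact: mA.
- exact: (@measurable_box _ _ (fun i => A (lift ord0 i))).
by rewrite big_ord_recl -(ih (fun i => A (lift ord0 i))).
Qed.

Lemma lebesgue_measure_affine (R : realType) (b s : R) (A : set R) :
  s != 0 -> measurable A ->
  lebesgue_measure ((fun x => b + s * x) @^-1` A) = (`|s|^-1%:E * lebesgue_measure A)%E.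
Proof.
move=> s0 mA.
have mT : measurable_fun [set: measurableTypeR R] (fun x => b + s * x : measurableTypeR R).
  by apply: measurable_funD => //; exact: measurable_funM.
have sp : 0 <= `|s| by [].
pose p : {measure set (measurableTypeR R) -> \bar R} := mscale (NngNum sp)
  (measure_function_pushforward__canonical__measure_function_Measure lebesgue_measure mT).
have h : lebesgue_measure A = p A.
  apply: lebesgue_measure_unique => // _ [[x y]] _ <-.
  rewrite /p/= /mscale/= /pushforward.
  have [s_gt0|s_lt0|/eqP] := ltgtP 0 s; last by rewrite eq_sym (negbTE s0).
    rewrite (_ : _ @^-1` _ = `](x - b) / s, (y - b) / s]%classic); last first.
      apply/seteqP; split => z/=; rewrite !in_itv/= ltr_pdivrMr// ler_pdivlMr// [z * s]mulrC;
      by rewrite ltrBlDl lerBrDl.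
    rewrite !lebesgue_measure_itv/= !lte_fin ltr_pM2r ?invr_gt0// ltrD2r.
    case: ifP => _; last by rewrite mule0.
    rewrite -!EFinB -EFinM gtr0_norm//; congr EFin; field.
    by rewrite gt_eqF.
  rewrite (_ : _ @^-1` _ = `[(y - b) / s, (x - b) / s[%classic); last first.
    apply/seteqP; split => z/=; rewrite !in_itv/= ltr_ndivlMr// ler_ndivrMr// [z * s]mulrC;
    by rewrite ltrBlDl lerBrDl andbC.
  rewrite !lebesgue_measure_itv/= !lte_fin ltr_nM2r ?invr_lt0// ltrD2r.
  case: ifP => _; last by rewrite mule0.
  rewrite -!EFinB -EFinM ltr0_norm//; congr EFin; field.
  by rewrite lt_eqF.
rewrite h /p/= /mscale/= /pushforward muleA -EFinM mulVf ?mul1e//.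
by rewrite normr_eq0.
Qed.

Lemma ge0_integral_affine (R : realType) (b s : R) (f : R -> \bar R) :
  s != 0 -> measurable_fun [set: R] f -> (forall x, 0 <= f x)%E ->
  (\int[lebesgue_measure]_x f (b + s * x)%R =
   `|s|^-1%:E * \int[lebesgue_measure]_x f x)%E.
Proof.
move=> s0 mf f0.
have mT : measurable_fun [set: measurableTypeR R] (fun x => b + s * x : measurableTypeR R).
  by apply: measurable_funD => //; exact: measurable_funM.
have sp : 0 <= `|s|^-1 by rewrite invr_ge0.
rewrite -(ge0_integral_mscale lebesgue_measure measurableT (NngNum sp))//.
rewrite -(ge0_integral_pushforward mT lebesgue_measure measurableT)//.
apply: (@eq_measure_integral _ _ _ _ (mscale (NngNum sp) lebesgue_measure)
  (measure_function_pushforward__canonical__measure_function_Measure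
     lebesgue_measure mT)) => A mA _.
rewrite /= /pushforward /mscale/=; exact: lebesgue_measure_affine.
Qed.

Definition affine_tuple (R : realType) k (b s x : k.-tuple R) : k.-tuple R :=
  [tuple tnth b i + tnth s i * tnth x i | i < k].

Lemma measurable_lebesgue_section (R : realType) k (A : set (k.+1.-tuple R)) :
  measurable A ->
  measurable_fun [set: R] (fun x : R => lam k [set t | A (mcons (x, t))]).
Proof.
move=> mA.
have mA' : measurable (@mcons R k @^-1` A).
  by rewrite -[X in measurable X]setTI; exact: measurable_mcons.
have := measurable_fun_xsection (lam k) mA'.
congr measurable_fun; apply/funext => x /=; congr lebesgue_tuple.
by apply/seteqP; split=> t; rewrite /xsection/= inE.
Qed.

(** By induction on the dimension, changing variables in the first coordinate and using
    the induction hypothesis on each section. *)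
Lemma lebesgue_tuple_affine (R : realType) k (b s : k.-tuple R) A :
  (forall i, tnth s i != 0) -> measurable A ->
  lam k (affine_tuple b s @^-1` A) =
  ((\prod_(i < k) `|tnth s i|^-1)%:E * lam k A)%E.
Proof.
elim: k b s A => [|k ih] b s A s0 mA.
  rewrite big_ord0 mul1e; congr (lam 0); apply/seteqP.
  by split => x /=; rewrite (_ : affine_tuple _ _ _ = x)//; apply: eq_from_tnth => -[].
rewrite /=.
have E x t : affine_tuple b s (mcons (x, t)) =
    mcons (thead b + thead s * x, affine_tuple [tuple of behead b] [tuple of behead s] t).
  apply: eq_from_tnth => i; rewrite tnth_mktuple /mcons.
  case: (unliftP ord0 i) => [j ->|->]; rewrite ?tnth0 ?tnthS//.
  rewrite /= [RHS]tnth_mktuple !tnth_behead (_ : inord j.+1 = lift ord0 j)//.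
  by apply: val_inj; rewrite /= inordK// ltnS ltn_ord.
transitivity (\int[lebesgue_measure]_x
   ((\prod_(i < k) `|tnth [tuple of behead s] i|^-1)%:E *
     lam k [set t | A (mcons (thead b + thead s * x, t)%R)]))%E.
  apply: eq_integral => x _ /=; rewrite -(ih [tuple of behead b]); last 2 first.
  - by move=> i; rewrite tnth_behead.
  - rewrite -[X in measurable X]setTI.
    have := @measurable_mcons R k measurableT _ mA; rewrite setTI => h.
    have := measurable_xsection (thead b + thead s * x) h.
    by rewrite xsectionE setTI.
  by congr lebesgue_tuple; apply/seteqP; split => t /=; rewrite E.
have mg := measurable_lebesgue_section mA.
rewrite ge0_integralZl//=; last first.
- by rewrite lee_fin prodr_ge0// => i _; rewrite invr_ge0.
- by apply: (measurableT_comp mg); apply: measurable_funD => //; exact: measurable_funM.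
rewrite (ge0_integral_affine _ _ mg)//; last exact: s0.
rewrite muleA -EFinM; congr (_%:E * _)%E.
rewrite [RHS]big_ord_recl mulrC; congr (_ * _).
apply: eq_bigr => i _; rewrite tnth_behead (_ : inord i.+1 = lift ord0 i)//.
by apply: val_inj; rewrite /= inordK// ltnS ltn_ord.
Qed.

(** The measure is built by adding first coordinates, whereas the order of the tree
    reads the last one, which therefore has to be split off as well. *)
Definition mrcons (R : realType) k (p : k.-tuple R * R) : k.+1.-tuple R :=
  [tuple of rcons p.1 p.2].

Lemma tnth_mrcons_max (R : realType) k (p : k.-tuple R * R) :
  tnth (mrcons p) ord_max = p.2.
Proof. by rewrite (tnth_nth 0)/= nth_rcons size_tuple ltnn eqxx. Qed.

Lemma tnth_mrcons_widen (R : realType) k (p : k.-tuple R * R) (i : 'I_k) :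
  tnth (mrcons p) (widen_ord (leqnSn k) i) = tnth p.1 i.
Proof. by rewrite !(tnth_nth 0)/= nth_rcons size_tuple ltn_ord. Qed.

Lemma widen_or_max k (i : 'I_k.+1) :
  (exists j, i = widen_ord (leqnSn k) j) \/ i = ord_max.
Proof.
have := ltn_ord i; rewrite ltnS leq_eqVlt => /orP[/eqP ik|ik].
  by right; apply: val_inj.
by left; exists (Ordinal ik); apply: val_inj.
Qed.

Lemma measurable_mrcons (R : realType) k :
  measurable_fun [set: k.-tuple R * R] (@mrcons R k).
Proof.
apply/measurable_fun_tnthP => i.
have [[j ->]|->] := widen_or_max i.
  rewrite (_ : _ \o _ = (fun t => tnth t j) \o fst); last first.
    by apply/funext => x /=; rewrite tnth_mrcons_widen.
  by apply: measurableT_comp => //; exact: measurable_tnth.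
rewrite (_ : _ \o _ = snd)//.
by apply/funext => x /=; rewrite tnth_mrcons_max.
Qed.

Lemma mrcons_mcons (R : realType) k (x h : R) (t : k.-tuple R) :
  mrcons (mcons (x, t), h) = mcons (x, mrcons (t, h)).
Proof. by apply: val_inj. Qed.

Lemma integral_lam0 (R : realType) (f : 0.-tuple R -> \bar R) :
  (\int[lam 0]_x f x = f [tuple])%E.
Proof.
rewrite (_ : f = cst (f [tuple])); last first.
  by apply/funext => x; rewrite tuple0.
by rewrite integral_cst//= diracT mule1.
Qed.

Lemma measurable_integral_mrcons (R : realType) k (f : k.+1.-tuple R -> \bar R) :
  measurable_fun [set: k.+1.-tuple R] f -> (forall x, 0 <= f x)%E ->
  measurable_fun [set: k.-tuple R]
    (fun u => \int[lebesgue_measure]_h f (mrcons (u, h)))%E.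
Proof.
move=> mf f0.
apply: (@measurable_fun_fubini_tonelli_F _ _ _ _ _
  (@lebesgue_measure R) (f \o @mrcons R k)) => //.
  by apply: measurableT_comp => //; exact: measurable_mrcons.
by move=> x /=; exact: f0.
Qed.

(** By induction on the dimension: Tonelli exchanges the first coordinate with the last. *)
Lemma ge0_integral_mrcons (R : realType) k (f : k.+1.-tuple R -> \bar R) :
  measurable_fun [set: k.+1.-tuple R] f -> (forall x, 0 <= f x)%E ->
  (\int[lam k.+1]_x f x =
   \int[lam k]_u \int[lebesgue_measure]_h f (mrcons (u, h)))%E.
Proof.
elim: k f => [|k ih] f mf f0.
  rewrite ge0_integral_mcons// integral_lam0.
  apply: eq_integral => x _; rewrite integral_lam0; congr f.
  exact: val_inj.
rewrite ge0_integral_mcons// ge0_integral_mcons//; last 2 first.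
- exact: measurable_integral_mrcons.
- by move=> x; apply: integral_ge0 => y _; exact: f0.
apply: eq_integral => x _; rewrite ih.
- apply: eq_integral => u _; apply: eq_integral => h _.
  by rewrite mrcons_mcons.
- apply: (measurableT_comp mf).
  apply: (measurableT_comp (@measurable_mcons R k.+1)).
  exact: measurable_fun_pair.
- by move=> t; exact: f0.
Qed.

Definition mbelast (R : realType) k (x : k.+1.-tuple R) : k.-tuple R :=
  [tuple tnth x (widen_ord (leqnSn k) i) | i < k].

Definition mlast (R : realType) k (x : k.+1.-tuple R) : R := tnth x ord_max.

Lemma mbelast_mrcons (R : realType) k (p : k.-tuple R * R) :
  mbelast (mrcons p) = p.1.
Proof.
by apply: eq_from_tnth => i; rewrite tnth_mktuple tnth_mrcons_widen.
Qed.

Lemma mlast_mrcons (R : realType) k (p : k.-tuple R * R) :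
  mlast (mrcons p) = p.2.
Proof. exact: tnth_mrcons_max. Qed.

Lemma mrcons_mbelast (R : realType) k (x : k.+1.-tuple R) :
  mrcons (mbelast x, mlast x) = x.
Proof.
apply: eq_from_tnth => i; have [[j ->]|->] := widen_or_max i.
  by rewrite tnth_mrcons_widen/= tnth_mktuple.
by rewrite tnth_mrcons_max.
Qed.

Lemma measurable_mbelast (R : realType) k :
  measurable_fun [set: k.+1.-tuple R] (@mbelast R k).
Proof.
apply/measurable_fun_tnthP => i.
rewrite (_ : _ \o _ = fun x => tnth x (widen_ord (leqnSn k) i)).
  exact: measurable_tnth.
by apply/funext => x /=; rewrite tnth_mktuple.
Qed.

Lemma measurable_mlast (R : realType) k :
  measurable_fun [set: k.+1.-tuple R] (@mlast R k).
Proof. exact: measurable_tnth. Qed.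

Lemma measure_integral_indic d (T : measurableType d) (R : realType)
    (mu : {measure set T -> \bar R}) (A : set T) : measurable A ->
  mu A = (\int[mu]_x (\1_A x)%:E)%E.
Proof. by move=> mA; rewrite integral_indic// setIT. Qed.

Lemma lebesgue_tuple_cylinder (R : realType) k (A : set (k.-tuple R)) (B : set R) :
  measurable A -> measurable B ->
  lam k.+1 [set x | A (mbelast x) /\ B (mlast x)] =
  (lam k A * lebesgue_measure B)%E.
Proof.
move=> mA mB.
have mAB : measurable [set x : k.+1.-tuple R | A (mbelast x) /\ B (mlast x)].
  apply: measurableI.
    by rewrite -[X in measurable X]setTI; exact: measurable_mbelast.
  by rewrite -[X in measurable X]setTI; exact: measurable_mlast.
rewrite (measure_integral_indic _ mAB) ge0_integral_mrcons; last 2 first.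
- exact/measurable_EFinP.
- by move=> x; rewrite lee_fin.
under eq_integral => u _.
  under eq_integral => h _.
    rewrite (_ : (\1_[set x : k.+1.-tuple R | A (mbelast x) /\ B (mlast x)] (mrcons (u, h)))%:E =
       (\1_A u)%:E * (\1_B h)%:E)%E; last first.
      rewrite -EFinM; congr EFin; rewrite !indicE -natrM mulnb; congr (_%:R); congr nat_of_bool.
      by apply/idP/andP; rewrite !inE/= mbelast_mrcons mlast_mrcons/=.
    over.
  rewrite ge0_integralZl//=; last exact/measurable_EFinP.
  rewrite -measure_integral_indic//.
  over.
rewrite /= ge0_integralZr//=; last exact/measurable_EFinP.
by rewrite -measure_integral_indic.
Qed.

(** * Euclidean balls *)

(* [edist] also names the extended distance of a pseudometric space *)
Notation eucl := Defs.edist.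

(** Unlike distances, their squares are sums over the coordinates. *)
Definition sqdist (R : realType) k (x y : k.-tuple R) : R :=
  \sum_(i < k) (tnth x i - tnth y i) ^+ 2.

Lemma sqdist_ge0 (R : realType) k (x y : k.-tuple R) : 0 <= sqdist x y.
Proof. by apply: sumr_ge0 => i _; exact: sqr_ge0. Qed.

Lemma eucl_le (R : realType) k (x y : k.-tuple R) r :
  (eucl x y <= r) = (0 <= r) && (sqdist x y <= r ^+ 2).
Proof.
have [r0|r0] /= := leP 0 r; last first.
  by apply/negbTE; rewrite -ltNge (lt_le_trans r0)// sqrtr_ge0.
by rewrite /Defs.edist -[X in _ <= X](ger0_norm r0) -sqrtr_sqr ler_sqrt ?sqr_ge0.
Qed.

Lemma eucl_ge0 (R : realType) k (x y : k.-tuple R) : 0 <= eucl x y.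
Proof. exact: sqrtr_ge0. Qed.

Lemma sqdist_mrcons (R : realType) k (u v : k.-tuple R) (h l : R) :
  sqdist (mrcons (u, h)) (mrcons (v, l)) = sqdist u v + (h - l) ^+ 2.
Proof.
rewrite /sqdist big_ord_recr/= !tnth_mrcons_max; congr (_ + _).
by apply: eq_bigr => i _; rewrite !tnth_mrcons_widen.
Qed.

Lemma sqdistE_mrcons (R : realType) k (x y : k.+1.-tuple R) :
  sqdist x y = sqdist (mbelast x) (mbelast y) + (mlast x - mlast y) ^+ 2.
Proof. by rewrite -sqdist_mrcons !mrcons_mbelast. Qed.

Lemma le_coord_sqdist (R : realType) k (x y : k.-tuple R) i :
  (tnth x i - tnth y i) ^+ 2 <= sqdist x y.
Proof.
rewrite /sqdist (bigD1 i)//= lerDl; apply: sumr_ge0 => j _; exact: sqr_ge0.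
Qed.

Lemma sqdist_le_coord (R : realType) k (x y : k.-tuple R) (a : R) :
  (forall i, `|tnth x i - tnth y i| <= a) -> sqdist x y <= k%:R * a ^+ 2.
Proof.
move=> h.
rewrite /sqdist mulr_natl -[k in _ *+ k]card_ord -sumr_const.
apply: ler_sum => i _; rewrite -(real_normK (num_real _)) lerXn2r ?nnegrE//.
exact: le_trans (h i).
Qed.

Lemma measurable_sqdist (R : realType) k d (T : measurableType d)
    (f g : T -> k.-tuple R) :
  measurable_fun setT f -> measurable_fun setT g ->
  measurable_fun setT (fun t => sqdist (f t) (g t)).
Proof.
move=> mf mg; apply: measurable_sum => i; apply: measurable_funX.
apply: measurable_funB; apply: (measurableT_comp (measurable_tnth i)) => //.
Qed.

Lemma measurable_eucl (R : realType) k d (T : measurableType d)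
    (f g : T -> k.-tuple R) :
  measurable_fun setT f -> measurable_fun setT g ->
  measurable_fun setT (fun t => eucl (f t) (g t)).
Proof.
move=> mf mg; apply: (@measurableT_comp _ _ _ _ _ _ (@Num.sqrt R)).
  by apply: continuous_measurable_fun => x; exact: sqrt_continuous.
exact: measurable_sqdist.
Qed.

Lemma measurable_set_le d (T : measurableType d) (R : realType) (f g : T -> R) :
  measurable_fun setT f -> measurable_fun setT g ->
  measurable [set t | f t <= g t].
Proof.
move=> mf mg; rewrite -[X in measurable X]setTI.
exact: (measurable_fun_ler mf mg measurableT (Y := [set true])).
Qed.

Lemma measurable_set_lt d (T : measurableType d) (R : realType) (f g : T -> R) :
  measurable_fun setT f -> measurable_fun setT g ->
  measurable [set t | f t < g t].
Proof.
move=> mf mg; rewrite (_ : [set _ | _] = ~` [set t | g t <= f t]).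
  by apply: measurableC; exact: measurable_set_le.
by apply/seteqP; split => t /=; rewrite ltNge => /negP.
Qed.

Definition dball (R : realType) k (x : k.-tuple R) (r : R) : set (k.-tuple R) :=
  [set y | eucl x y <= r].

Lemma measurable_dball (R : realType) k (x : k.-tuple R) r :
  measurable (dball x r).
Proof.
by apply: measurable_set_le => //; apply: measurable_eucl.
Qed.

Lemma measurable_cube (R : realType) k : measurable (@cube R k).
Proof.
rewrite (_ : @cube R k = [set x | forall i : 'I_k, `]0, 1[%classic (tnth x i)]).
  by apply: (@measurable_box _ _ (fun=> `]0, 1[%classic)) => i; exact: measurable_itv.
by apply/seteqP; split => x /= h i; have := h i; rewrite /= in_itv.
Qed.

Lemma lebesgue_tuple_cube (R : realType) k : lam k (@cube R k) = 1%E.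
Proof.
rewrite (_ : @cube R k = [set x | forall i : 'I_k, `]0, 1[%classic (tnth x i)]).
  rewrite (@lebesgue_tuple_box _ _ (fun=> `]0, 1[%classic)).
    rewrite big1// => i _; rewrite lebesgue_measure_itv/= lte_fin ltr01.
    by rewrite -EFinB subr0.
  by move=> i; exact: measurable_itv.
by apply/seteqP; split => x /= h i; have := h i; rewrite /= in_itv.
Qed.

Lemma lebesgue_tuple_cubeI_le1 (R : realType) k (A : set (k.-tuple R)) :
  measurable A -> (lam k (@cube _ k `&` A) <= 1)%E.
Proof.
move=> mA; rewrite -(@lebesgue_tuple_cube R k); apply: le_measure; rewrite ?inE.
- by apply: measurableI => //; exact: measurable_cube.
- exact: measurable_cube.
- exact: subIsetl.
Qed.

Lemma lebesgue_tuple_cubeI_fin (R : realType) k (A : set (k.-tuple R)) :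
  measurable A -> lam k (@cube _ k `&` A) \is a fin_num.
Proof.
move=> mA; rewrite ge0_fin_numE//.
by rewrite (le_lt_trans (lebesgue_tuple_cubeI_le1 mA))// ltry.
Qed.

Lemma dball_affine (R : realType) k (x : k.-tuple R) (r : R) : 0 < r ->
  dball x r = affine_tuple [tuple - (tnth x i / r) | i < k] [tuple r^-1 | i < k] @^-1`
     dball [tuple 0 | i < k] 1.
Proof.
move=> r0; set T := affine_tuple _ _.
have E y : (eucl x y <= r) = (eucl [tuple 0 | i < k] (T y) <= 1).
  rewrite !eucl_le ler01 (ltW r0) expr1n.
  rewrite (_ : sqdist _ (T y) = sqdist x y / r ^+ 2).
    by rewrite ler_pdivrMr ?exprn_gt0// mul1r.
  rewrite /sqdist mulr_suml; apply: eq_bigr => i _.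
  by rewrite !tnth_mktuple; field; rewrite gt_eqF.
by apply/seteqP; split => y; rewrite /dball/= E.
Qed.

Definition unit_dball (R : realType) k : set (k.-tuple R) :=
  dball [tuple 0 | i < k] 1.

(** A ball of positive radius is an affine preimage of the unit ball. *)
Lemma lebesgue_tuple_dball (R : realType) k (x : k.-tuple R) (r : R) : 0 < r ->
  lam k (dball x r) = ((r ^+ k)%:E * lam k (@unit_dball R k))%E.
Proof.
move=> r0; rewrite (dball_affine x r0) lebesgue_tuple_affine.
- congr (_%:E * _)%E; rewrite (eq_bigr (fun=> r)); last first.
    by move=> i _; rewrite tnth_mktuple normfV invrK gtr0_norm.
  by rewrite prodr_const card_ord.
- by move=> i; rewrite tnth_mktuple invr_neq0// gt_eqF.
- exact: measurable_dball.
Qed.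

(** * Integrals on the half-line *)

Notation leb := (@lebesgue_measure _).

(** The derivative of [r `^ a]: integrating against it turns tail counts into sums of
    [a]-th powers. *)
Definition pkern (R : realType) (a r : R) : R := a * r `^ (a - 1).

Lemma pkern_ge0 (R : realType) (a r : R) : 0 <= a -> 0 <= pkern a r.
Proof. by move=> a0; rewrite mulr_ge0// powR_ge0. Qed.

Lemma measurable_pkern (R : realType) (a : R) : measurable_fun [set: R] (pkern a).
Proof. by apply: measurable_funM => //; exact: measurable_powR. Qed.

Lemma measurable_inv_fun d (T : measurableType d) (R : realType) (f : T -> R) :
  measurable_fun setT f -> measurable_fun setT (fun x => (f x)^-1).
Proof.
move=> mf; rewrite (_ : (fun x => _) = (fun x => f x * ((f x ^+ 2) `^ (-1)))).
  apply: measurable_funM => //; apply: (measurableT_comp (measurable_powR _)).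
  exact: measurable_funX.
apply/funext => x; rewrite powR_inv1 ?sqr_ge0//.
have [->|f0] := eqVneq (f x) 0; first by rewrite invr0 mul0r.
by rewrite expr2 invfM mulrA divff// mul1r.
Qed.

Lemma continuous_at_powR (R : realType) (a x : R) : 0 < x ->
  {for x, continuous (fun r : R => r `^ a)}.
Proof.
move=> x0; apply: differentiable_continuous; apply/derivable1_diffP.
by apply: derivable_powR; rewrite in_itv/= x0.
Qed.

Lemma integral_pkern_itv (R : realType) (a e x : R) : 0 < e -> e < x ->
  (\int[leb]_(r in `[e, x]) (pkern a r)%:E = (x `^ a - e `^ a)%:E)%E.
Proof.
move=> e0 ex; rewrite (@continuous_FTC2 _ _ (fun r => r `^ a)) ?EFinB//.
- apply: continuous_in_subspaceT => r; rewrite inE/= in_itv/= => /andP[er _].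
  apply: cvgM; first exact: cvg_cst.
  by apply: continuous_at_powR; exact: lt_le_trans er.
- have x0 : 0 < x by exact: lt_trans ex.
  split.
  + move=> r; rewrite in_itv/= => /andP[er _]; apply: derivable_powR.
    by rewrite in_itv/= andbT (lt_trans e0).
  + by apply: cvg_at_right_filter; exact: continuous_at_powR.
  + by apply: cvg_at_left_filter; exact: continuous_at_powR.
- move=> r; rewrite in_itv/= => /andP[er _].
  by rewrite powR_derive1// in_itv/= andbT (lt_trans e0).
Qed.

(** The kernel is unbounded near [0] when [a < 1], so that the interval is exhausted by
    compact ones. *)
Lemma integral_pkern (R : realType) (a x : R) : 0 < a -> 0 < x ->
  (\int[leb]_(r in `]0%R, x[) (pkern a r)%:E = (x `^ a)%:E)%E.
Proof.
move=> a0 x0.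
rewrite integral_itv_bndo_bndc; last first.
  by apply/measurable_EFinP/measurable_funTS; exact: measurable_pkern.
pose e n := x / n.+2%:R.
have e0 n : 0 < e n by rewrite divr_gt0.
have ex n : e n < x by rewrite ltr_pdivrMr// ltr_pMr// ltr1n.
have mE (D : set R) : measurable D -> measurable_fun D (EFin \o pkern a).
  by move=> _; apply/measurable_EFinP/measurable_funTS; exact: measurable_pkern.
have -> : `]0, x]%classic = \bigcup_n `[e n, x]%classic.
  apply/seteqP; split => r /=.
    rewrite in_itv/= => /andP[r0 rx]; exists (Num.truncn (x / r)) => //=.
    rewrite in_itv/= rx andbT /e ler_pdivrMr// mulrC -ler_pdivrMr//.
    by rewrite (le_trans (ltW (truncnS_gt _)))// ler_nat.
  by move=> [n _ /=]; rewrite !in_itv/= => /andP[er ->]; rewrite andbT (lt_le_trans (e0 n)).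
have cvg1 : (\int[leb]_(r in `[e n, x]) (pkern a r)%:E)%E @[n --> \oo] -->
   (\int[leb]_(r in \bigcup_n `[e n, x]%classic) (pkern a r)%:E)%E.
  apply: ge0_nondecreasing_set_cvg_integral.
  - apply/nondecreasing_seqP => n; apply/subsetPset => r /=; rewrite !in_itv/= => /andP[h ->].
    rewrite andbT (le_trans _ h)// /e ler_pM2l// lef_pV2 ?posrE// ler_nat//.
  - by move=> n; exact: measurable_itv.
  - by move=> n; apply: mE; exact: measurable_itv.
  - by move=> n r _; rewrite lee_fin pkern_ge0// ltW.
apply/esym; apply: cvg_unique cvg1 => //.
rewrite /=; under eq_fun do rewrite integral_pkern_itv//.
apply: cvg_EFin; first by near=> n.
rewrite (_ : _ \o _ = (fun n => x `^ a - e n `^ a)); last exact/funext.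
rewrite -[X in _ --> X]subr0; apply: cvgB; first exact: cvg_cst.
have /cvg_at_rightP h := powR_cvg0 a0; apply: (h e); split => //.
rewrite -(mulr0 x); apply: cvgM; first exact: cvg_cst.
by have := @cvg_harmonic R; rewrite -cvg_shiftS.
Unshelve. all: by end_near. Qed.

Lemma integral_pkern_lt (R : realType) (a x : R) : 0 < a -> 0 <= x ->
  (\int[leb]_(r in `]0%R, +oo[) (pkern a r * (r < x)%R%:R)%:E = (x `^ a)%:E)%E.
Proof.
move=> a0; rewrite le_eqVlt => /predU1P[<-|x0].
  rewrite powR0 ?gt_eqF// integral0_eq// => r /=; rewrite in_itv/= andbT => r0.
  by rewrite ltNge (ltW r0) mulr0.
rewrite -(integral_pkern a0 x0) (_ : `]0%R, x[%classic = `]0, +oo[%classic `&` `]0, x[); last first.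
  by apply/seteqP; split => r /=; rewrite !in_itv/=; [move=> /andP[-> ->]|case].
rewrite integral_mkcondr; apply: eq_integral => r; rewrite inE/= in_itv/= andbT => r0.
rewrite patchE mem_setE in_itv/= r0/=; case: ifPn => _; first by rewrite mulr1.
by rewrite mulr0.
Qed.

Lemma integral_expRN_itv (R : realType) (b s : R) : 0 < b ->
  (\int[leb]_(t in `[s, +oo[) (b * expR (- (b * t)))%:E = (expR (- (b * s)))%:E)%E.
Proof.
move=> b0.
have df (t : R) : is_derive t 1 (fun t => - expR (- (b * t))) (b * expR (- (b * t))).
  have h1 : is_derive t 1 (fun t : R => - (b * t)) (- b).
    by apply: is_derive_eq; rewrite /GRing.scale/= mulr1.
  have h2 := @is_derive1_comp R expR (fun t => - (b * t)) t _ _ (is_derive_expR (- (b * t))) h1.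
  by apply: (is_derive_eq (is_deriveN h2)); rewrite mulrN opprK mulrC.
rewrite (@ge0_continuous_FTC2y _ _ (fun t => - expR (- (b * t))) _ 0).
- by rewrite EFinN oppeK add0e.
- by move=> t _; rewrite mulr_ge0 ?expR_ge0// ltW.
- apply: continuous_subspaceT => t.
  apply: cvgM; first exact: cvg_cst.
  apply: continuous_comp; last exact: continuous_expR.
  by apply: cvgN; apply: cvgM; [exact: cvg_cst|exact: cvg_id].
- rewrite -oppr0; apply: cvgN.
  apply: (@cvg_comp _ _ _ (fun x => b * x) (fun z => expR (- z)) _ (pinfty_nbhs R)); last exact: cvgr_expR.
  exact: gt0_cvgMry.
- by move=> t _; apply: ex_derive.
- apply: cvgN; apply/cvg_at_right_filter; apply: continuous_comp; last exact: continuous_expR.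
  by apply: cvgN; apply: cvgM; [exact: cvg_cst|exact: cvg_id].
- by move=> t _; rewrite derive1E; apply: derive_val.
Qed.

Lemma integral_expRN_lt (R : realType) (s : R) : 0 <= s ->
  (\int[leb]_(t in `]0%R, +oo[) (expR (- t) * (s < t)%R%:R)%:E = (expR (- s))%:E)%E.
Proof.
move=> s0.
have := @integral_expRN_itv R 1 s ltr01; rewrite mul1r => <-.
rewrite -integral_itv_obnd_cbnd; last first.
  apply/measurable_EFinP/measurable_funTS; apply: measurable_funM => //.
  by apply: measurableT_comp => //; apply: measurable_funN; apply: measurable_funM.
rewrite (_ : `]s, +oo[%classic = `]0, +oo[%classic `&` `]s, +oo[); last first.
  apply/seteqP; split => r /=; rewrite !in_itv/= !andbT; last by case.
  by move=> sr; split => //; exact: le_lt_trans sr.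
rewrite integral_mkcondr; apply: eq_integral => r; rewrite inE/= in_itv/= andbT => r0.
rewrite patchE mem_setE in_itv/= andbT mul1r; case: ifPn => _; last by rewrite mulr0.
by rewrite mulr1 mul1r.
Qed.

Lemma integral_expRN (R : realType) (b : R) : 0 < b ->
  (\int[leb]_(t in `]0%R, +oo[) (expR (- (b * t)))%:E = b^-1%:E)%E.
Proof.
move=> b0.
have m : measurable_fun [set: R] (fun t => expR (- (b * t))).
  by apply: measurableT_comp => //; apply: measurable_funN; apply: measurable_funM.
have := @integral_expRN_itv R b 0 b0; rewrite mulr0 oppr0 expR0.
rewrite -integral_itv_obnd_cbnd; last first.
  by apply/measurable_EFinP/measurable_funTS; apply: measurable_funM.
under eq_integral do rewrite EFinM.
rewrite ge0_integralZl//=.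
- move=> h; rewrite -[LHS]mul1e -(mulVf (lt0r_neq0 b0)).
  by rewrite EFinM -muleA h mule1.
- exact/measurable_EFinP/measurable_funTS.
- by rewrite lee_fin ltW.
Qed.

Lemma integral_expRN_le (R : realType) (s : R) : 0 <= s ->
  (\int[leb]_(t in `]0%R, +oo[) (expR (- t) * (s <= t)%R%:R)%:E = (expR (- s))%:E)%E.
Proof.
move=> s0.
have := @integral_expRN_itv R 1 s ltr01; rewrite mul1r => <-.
rewrite integral_itv_obnd_cbnd; last first.
  apply/measurable_EFinP/measurable_funTS; apply: measurable_funM => //.
    by apply: measurableT_comp => //; apply: measurable_funN.
  apply: (@measurableT_comp _ _ _ _ _ _ (fun b : bool => b%:R : R)) => //.
  exact: measurable_fun_ler.
rewrite (_ : `[s, +oo[%classic = `[0, +oo[%classic `&` `[s, +oo[); last first.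
  apply/seteqP; split => r /=; rewrite !in_itv/= !andbT; last by case.
  by move=> sr; split => //; exact: le_trans sr.
rewrite integral_mkcondr; apply: eq_integral => r; rewrite inE/= in_itv/= andbT => r0.
rewrite patchE mem_setE in_itv/= andbT mul1r; case: ifPn => _; last by rewrite mulr0.
by rewrite mulr1 mul1r.
Qed.

Section tonelli_in.
Context d1 d2 (T1 : measurableType d1) (T2 : measurableType d2) (R : realType).
Variables (m1 : {sigma_finite_measure set T1 -> \bar R})
  (m2 : {sigma_finite_measure set T2 -> \bar R}).
Variables (A : set T1) (B : set T2) (mA : measurable A) (mB : measurable B).
Variable f : T1 * T2 -> \bar R.
Hypotheses (mf : measurable_fun setT f) (f0 : forall x, (0 <= f x)%E).

Let g := f \_ (A `*` B).

Let mg : measurable_fun setT g.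
Proof.
apply/(measurable_restrictT f (measurableX mA mB)).
exact: measurable_funS mf.
Qed.

Let g0 x : (0 <= g x)%E. Proof. exact: erestrict_ge0. Qed.

Let gE x y : g (x, y) = if (x \in A) && (y \in B) then f (x, y) else 0%E.
Proof. by rewrite /g patchE in_setX. Qed.

Lemma tonelli_in :
  (\int[m1]_(x in A) \int[m2]_(y in B) f (x, y) =
   \int[m2]_(y in B) \int[m1]_(x in A) f (x, y))%E.
Proof.
rewrite integral_mkcond [RHS]integral_mkcond.
transitivity (\int[m1]_x \int[m2]_y g (x, y))%E.
  apply: eq_integral => x _; rewrite patchE; case: ifPn => xA.
    rewrite integral_mkcond; apply: eq_integral => y _.
    by rewrite gE patchE xA.
  by rewrite integral0_eq// => y _; rewrite gE (negbTE xA).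
rewrite fubini_tonelli//; apply: eq_integral => y _.
rewrite patchE; case: ifPn => yB.
  rewrite [RHS]integral_mkcond; apply: eq_integral => x _.
  by rewrite gE patchE yB andbT.
by rewrite integral0_eq// => x _; rewrite gE (negbTE yB) andbF.
Qed.
End tonelli_in.

Lemma measurable_integral_in d1 d2 (T1 : measurableType d1)
    (T2 : measurableType d2) (R : realType)
    (m2 : {sigma_finite_measure set T2 -> \bar R}) (B : set T2)
    (f : T1 * T2 -> \bar R) :
  measurable B -> measurable_fun setT f -> (forall x, 0 <= f x)%E ->
  measurable_fun setT (fun x => \int[m2]_(y in B) f (x, y))%E.
Proof.
move=> mB mf f0; pose g := f \_ (setT `*` B).
have mg : measurable_fun setT g.
  apply/(measurable_restrictT f (measurableX measurableT mB)).
  exact: measurable_funS mf.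
have g0 x : (0 <= g x)%E by exact: erestrict_ge0.
have := @measurable_fun_fubini_tonelli_F _ _ _ _ R m2 g mg g0.
congr measurable_fun; apply/funext => x; rewrite /fubini_F [RHS]integral_mkcond.
by apply: eq_integral => y _; rewrite /g !patchE in_setX in_setT.
Qed.

(** * The volume of the unit ball *)

Lemma lebesgue_tuple_itv_box (R : realType) k (a b : 'I_k -> R) :
  (forall i, a i <= b i) ->
  lam k [set x | forall i, `[a i, b i]%classic (tnth x i)] = (\prod_(i < k) (b i - a i))%:E.
Proof.
move=> ab; rewrite (@lebesgue_tuple_box _ _ (fun i => `[a i, b i]%classic)).
  rewrite -prodEFin; apply: eq_bigr => i _.
  rewrite lebesgue_measure_itv/= lte_fin; case: (ltP (a i) (b i)) => [_|abi]; first by rewrite EFinB.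
  by rewrite EFinB (_ : a i = b i) ?subee//; apply/eqP; rewrite eq_le ab.
by move=> i; exact: measurable_itv.
Qed.

(** Identified with [unit_ball_volume] in [unit_ball_volumeE]. *)
Definition ball_vol (R : realType) k : R := fine (lam k (@unit_dball R k)).

Lemma tnth_le_edist (R : realType) k (x y : k.-tuple R) r i :
  eucl x y <= r -> `|tnth x i - tnth y i| <= r.
Proof.
rewrite eucl_le => /andP[r0 h].
rewrite -(ger0_norm r0) -ler_sqr ?nnegrE ?normr_ge0// !real_normK ?num_real//.
exact: le_trans (le_coord_sqdist _ _ _) h.
Qed.

Lemma eucl_le_tnth (R : realType) k (x y : k.-tuple R) a r :
  0 <= r -> k%:R * a ^+ 2 <= r ^+ 2 ->
  (forall i, `|tnth x i - tnth y i| <= a) -> eucl x y <= r.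
Proof.
move=> r0 kr h; rewrite eucl_le r0/=; apply: le_trans kr.
exact: sqdist_le_coord.
Qed.

Lemma unit_dball_fin (R : realType) k : lam k (@unit_dball R k) \is a fin_num.
Proof.
rewrite ge0_fin_numE//.
apply: (@le_lt_trans _ _ (lam k [set x | forall i, `[- 1, 1]%classic (tnth x i)])).
  apply: le_measure; rewrite ?inE.
  - exact: measurable_dball.
  - by apply: (@measurable_box _ _ (fun=> `[-1, 1]%classic)) => i; exact: measurable_itv.
  - move=> x /= xB i; rewrite in_itv/= -ler_norml.
    by have := tnth_le_edist i xB; rewrite tnth_mktuple sub0r normrN.
rewrite (@lebesgue_tuple_itv_box _ _ (fun=> - 1) (fun=> 1)) ?ltry//.
Qed.

Lemma ball_volE (R : realType) k : lam k (@unit_dball R k) = (ball_vol R k)%:E.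
Proof. by rewrite /ball_vol fineK// unit_dball_fin. Qed.

Lemma ball_vol_gt0 (R : realType) k : 0 < ball_vol R k.
Proof.
rewrite -lte_fin -ball_volE.
pose a : R := (k.+1)%:R^-1.
have a0 : 0 < a by rewrite invr_gt0.
apply: (@lt_le_trans _ _ (lam k [set x | forall i, `[0, a]%classic (tnth x i)])).
  rewrite (@lebesgue_tuple_itv_box _ _ (fun=> 0) (fun=> a)) => [|i]; last exact: ltW.
  by rewrite lte_fin; apply: prodr_gt0 => i _; rewrite subr0.
apply: le_measure; rewrite ?inE.
- by apply: (@measurable_box _ _ (fun=> `[0, a]%classic)) => i; exact: measurable_itv.
- exact: measurable_dball.
- move=> x /= xB; rewrite /unit_dball /dball/=.
  apply: (@eucl_le_tnth _ _ _ _ a) => //.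
    have ka : k%:R * a <= 1 by rewrite ler_pdivrMr// mul1r ler_nat.
    have a1 : a <= 1 by rewrite invf_le1// ler1n.
    by rewrite expr1n expr2 mulrA; nra.
  move=> i; rewrite tnth_mktuple sub0r normrN; have := xB i.
  by rewrite in_itv/= => /andP[x0 xa]; rewrite ger0_norm.
Qed.

(** The Gaussian density factorizes over the coordinates. *)
Lemma gauss_tuple (R : realType) k :
  (\int[lam k]_x (expR (- sqdist [tuple 0 | i < k] x))%:E =
   (Num.sqrt (@pi R) ^+ k)%:E)%E.
Proof.
elim: k => [|k ih].
  by rewrite integral_lam0 /sqdist big_ord0 oppr0 expR0 expr0.
have msq (l : nat) : measurable_fun [set: l.-tuple R]
    (fun x => (expR (- sqdist [tuple 0 | i < l] x))%:E).
  apply/measurable_EFinP; apply: measurableT_comp => //.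
  by apply: measurable_funN; exact: measurable_sqdist.
rewrite ge0_integral_mcons//.
transitivity (\int[leb]_x ((expR (- x ^+ 2))%:E * (Num.sqrt (@pi R) ^+ k)%:E))%E.
  apply: eq_integral => x _; rewrite -ih -ge0_integralZl//=; last exact: msq.
  apply: eq_integral => t _; rewrite -EFinM -expRD -opprD; congr (expR (- _))%:E.
  rewrite /sqdist big_ord_recl !tnth_mktuple tnth0 sub0r sqrrN; congr (_ + _).
  by apply: eq_bigr => i _; rewrite !tnth_mktuple tnthS.
rewrite /= ge0_integralZr//=.
- by have := @integralT_gauss R; rewrite /gauss_fun => ->; rewrite -EFinM exprS.
- apply/measurable_EFinP; exact: (@measurable_gauss_fun R).
Qed.

Lemma measurable_gamma_integrand (R : realType) (a : R) :
  measurable_fun [set: R] (fun t : R => t `^ a * expR (- t)).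
Proof.
apply: measurable_funM; first exact: measurable_powR.
by apply: measurableT_comp => //; exact: measurable_funN.
Qed.

Lemma measurable_natr_bool d (T : measurableType d) (R : realType) (b : T -> bool) :
  measurable_fun setT b -> measurable_fun setT (fun t => (b t)%:R : R).
Proof.
move=> mb; exact: (@measurableT_comp _ _ _ _ _ _ (fun b : bool => b%:R : R)).
Qed.

(** The quantity [expR (- sqdist 0 x)] is the integral of [expR (- t)] over [t >= sqdist
    0 x]; exchanging the two integrals leaves, for each [t], the volume of the ball of
    radius [Num.sqrt t]. *)
Lemma ball_vol_gamma (R : realType) k :
  ((Num.sqrt (@pi R) ^+ k)%:E = (ball_vol R k)%:E *
   \int[leb]_(t in `]0%R, +oo[) (t `^ (k%:R / 2) * expR (- t))%:E)%E.
Proof.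
pose S (x : k.-tuple R) := sqdist [tuple 0 | i < k] x.
have mS : measurable_fun [set: k.-tuple R] S by exact: measurable_sqdist.
rewrite -gauss_tuple.
pose f (p : k.-tuple R * measurableTypeR R) := (expR (- p.2) * (S p.1 <= p.2)%R%:R)%:E.
transitivity (\int[lam k]_(x in setT) \int[leb]_(t in `]0%R, +oo[) f (x, t))%E.
  by apply: eq_integral => x _; exact: (esym (@integral_expRN_le R (S x) (sqdist_ge0 _ x))).
rewrite tonelli_in//; last 2 first.
- apply/measurable_EFinP; apply: measurable_funM.
    by apply: measurableT_comp => //; apply: measurable_funN.
  apply: measurable_natr_bool; apply: measurable_fun_ler => //.
  exact: measurableT_comp.
- by move=> x; rewrite lee_fin mulr_ge0// expR_ge0.
rewrite -ge0_integralZl//=; last 3 first.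
- apply/measurable_EFinP/measurable_funTS; exact: measurable_gamma_integrand.
- by move=> t _; rewrite lee_fin mulr_ge0// ?powR_ge0 ?expR_ge0.
- by rewrite lee_fin ltW// ball_vol_gt0.
apply: eq_integral => t; rewrite inE/= in_itv/= andbT => t0.
transitivity (\int[lam k]_x ((expR (- t))%:E * (\1_(dball [tuple 0 | i < k] (Num.sqrt t)) x)%:E))%E.
  apply: eq_integral => x _; rewrite /f/= EFinM; congr (_ * _%:E)%E.
  rewrite indicE; congr (_%:R); congr nat_of_bool; apply/idP/idP; rewrite inE /dball/= eucl_le sqrtr_ge0/= sqr_sqrtr// ltW//.
rewrite ge0_integralZl//=; last first.
  by apply/measurable_EFinP; apply: measurable_indic; exact: measurable_dball.
rewrite -measure_integral_indic; last exact: measurable_dball.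
rewrite /= lebesgue_tuple_dball ?sqrtr_gt0// ball_volE -!EFinM; congr EFin.
have -> : Num.sqrt t ^+ k = t `^ (k%:R / 2).
  by rewrite -powR12_sqrt ?ltW// -powR_mulrn ?powR_ge0// -powRrM mulrC.
by ring.
Qed.

(** By [ball_vol_gamma] the integral is finite for half-integer exponents, and two of
    these dominate any other exponent. *)
Lemma gamma_integral_fin (R : realType) (a : R) : 0 <= a ->
  (\int[leb]_(t in `]0%R, +oo[) (t `^ a * expR (- t))%:E < +oo)%E.
Proof.
move=> a0.
have H k : (\int[leb]_(t in `]0%R, +oo[) (t `^ (k%:R / 2 : R) * expR (- t))%:E < +oo)%E.
  rewrite ltey; apply/eqP => h; have := ball_vol_gamma R k; rewrite h.
  by rewrite gt0_muley// lte_fin ball_vol_gt0.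
pose m := (Num.truncn a).+1.*2.
have am : a <= m%:R / 2.
  rewrite /m -muln2 natrM mulfK ?pnatr_eq0//; exact/ltW/truncnS_gt.
have m0 (b : R) : measurable_fun (`]0%R, +oo[%classic : set R) (fun t : R => (t `^ b * expR (- t))%:E).
  apply/measurable_EFinP/measurable_funTS; exact: measurable_gamma_integrand.
apply: (@le_lt_trans _ _ (\int[leb]_(t in `]0%R, +oo[) ((t `^ (0%:R / 2) * expR (- t))%:E +
   (t `^ (m%:R / 2) * expR (- t))%:E))%E).
  apply: ge0_le_integral => //=.
  - by move=> t _; rewrite lee_fin mulr_ge0// ?powR_ge0 ?expR_ge0.
  - exact: m0.
  - by apply: emeasurable_funD; exact: m0.
  - move=> t; rewrite in_itv/= andbT => t0.
    rewrite -EFinD lee_fin -mulrDl ler_wpM2r ?expR_ge0// mul0r powRr0.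
    have [t1|t1] := leP t 1.
      rewrite (@le_trans _ _ 1)// ?lerDl ?powR_ge0//.
      by rewrite -(powRr0 t); apply: ger_powR => //; rewrite t0.
    by rewrite (@le_trans _ _ (t `^ (m%:R / 2)))// ?lerDr//; apply: ler_powR => //; exact: ltW.
have f0 (b t : R) : (0 <= (t `^ b * expR (- t))%:E)%E.
  by rewrite lee_fin mulr_ge0// ?powR_ge0 ?expR_ge0.
rewrite ge0_integralD//=; [|exact: m0|exact: m0].
by apply: lte_add_pinfty; [exact: (H 0%N)|exact: H].
Qed.

Lemma GammaE (R : realType) (a : R) : 0 <= a ->
  (\int[leb]_(t in `]0%R, +oo[) (t `^ a * expR (- t))%:E = (Gamma (1 + a))%:E)%E.
Proof.
move=> a0; rewrite /Gamma /Rintegral; under [in RHS]eq_integral do rewrite addrAC subrr add0r.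
rewrite fineK// ge0_fin_numE ?gamma_integral_fin//.
by apply: integral_ge0 => t _; rewrite lee_fin mulr_ge0// ?powR_ge0 ?expR_ge0.
Qed.

Lemma unit_ball_volumeE (R : realType) k : unit_ball_volume R k = ball_vol R k.
Proof.
have k0 : 0 <= k%:R / 2 :> R by rewrite divr_ge0.
have := ball_vol_gamma R k; rewrite GammaE// -EFinM => -[e].
have g0 : Gamma (1 + k%:R / 2 : R) != 0.
  apply/eqP => g0; move: e; rewrite g0 mulr0 => /eqP.
  by rewrite expf_eq0 sqrtr_eq0 leNgt pi_gt0 andbF.
apply: (mulIf g0); rewrite -e /unit_ball_volume -mulrA mulVf// mulr1.
by rewrite -powR12_sqrt ?pi_ge0// -powR_mulrn ?powR_ge0// -powRrM mulrC.
Qed.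

(** * Integrals of powers against exponentials *)

(** Writing [expR (- (b * r `^ e))] as the integral of [expR (- t)] over [t > b * r `^
    e] and exchanging the integrals leaves [(t / b) `^ (a / e)] as the inner integral. *)
Lemma integral_pkern_exp (R : realType) (a b e : R) : 0 < a -> 0 < b -> 0 < e ->
  (\int[leb]_(r in `]0%R, +oo[) (pkern a r * expR (- (b * r `^ e)))%:E =
   (b `^ (- (a / e)) * Gamma (1 + a / e))%:E)%E.
Proof.
move=> a0 b0 e0.
have ae0 : 0 <= a / e by rewrite divr_ge0 ?ltW.
pose f (p : measurableTypeR R * measurableTypeR R) :=
  (pkern a p.1 * (expR (- p.2) * (b * p.1 `^ e < p.2)%R%:R))%:E.
have mf : measurable_fun setT f.
  apply/measurable_EFinP; apply: measurable_funM.
    by apply: measurableT_comp => //; exact: measurable_pkern.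
  apply: measurable_funM.
    by apply: measurableT_comp => //; apply: measurable_funN.
  apply: measurable_natr_bool; apply: measurable_fun_ltr => //.
  apply: measurable_funM => //.
  exact: (measurableT_comp (measurable_powR _)).
have f0 x : (0 <= f x)%E.
  by rewrite lee_fin mulr_ge0 ?pkern_ge0 ?mulr_ge0 ?expR_ge0// ltW.
have mex : measurable_fun [set: R] (fun t : R => (expR (- t))%:E).
  by apply/measurable_EFinP; apply: measurableT_comp => //; exact: measurable_funN.
transitivity (\int[leb]_(r in `]0%R, +oo[) \int[leb]_(t in `]0%R, +oo[) f (r, t))%E.
  apply: eq_integral => r; rewrite inE/= in_itv/= andbT => r0.
  rewrite EFinM -integral_expRN_lt; last by rewrite mulr_ge0 ?powR_ge0// ltW.
  rewrite -ge0_integralZl//=.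
  - apply/measurable_EFinP/measurable_funTS; apply: measurable_funM.
      by apply: measurableT_comp => //; exact: measurable_funN.
    by apply: measurable_natr_bool; apply: measurable_fun_ltr.
  - by rewrite lee_fin pkern_ge0// ltW.
rewrite tonelli_in//.
transitivity (\int[leb]_(t in `]0%R, +oo[) ((b `^ (- (a / e)))%:E * (t `^ (a / e) * expR (- t))%:E))%E.
  apply: eq_integral => t; rewrite inE/= in_itv/= andbT => t0.
  transitivity (\int[leb]_(r in `]0%R, +oo[)
    ((expR (- t))%:E * (pkern a r * (r < (t / b) `^ e^-1)%R%:R)%:E))%E.
    apply: eq_integral => r; rewrite inE/= in_itv/= andbT => r0.
    rewrite /f/= -EFinM; congr EFin.
    rewrite (_ : (b * r `^ e < t) = (r < (t / b) `^ e^-1)); first by ring.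
    have tb0 : 0 < t / b by rewrite divr_gt0.
    have {2}<- : (r `^ e) `^ e^-1 = r by rewrite -powRrM mulfV ?gt_eqF// powRr1// ltW.
    rewrite mulrC -ltr_pdivlMr//; apply/idP/idP => h.
      by apply: gt0_ltr_powR; rewrite ?invr_gt0 ?nnegrE ?powR_ge0// ltW.
    rewrite ltNge; apply/negP => h'; move: h; rewrite ltNge => /negP; apply.
    by apply: ge0_ler_powR; rewrite ?invr_ge0 ?nnegrE ?powR_ge0// ltW.
  rewrite ge0_integralZl//=; last 2 first.
  - apply/measurable_EFinP/measurable_funTS; apply: measurable_funM.
      exact: measurable_pkern.
    by apply: measurable_natr_bool; apply: measurable_fun_ltr.
  - by move=> r _; rewrite lee_fin mulr_ge0 ?pkern_ge0// ltW.
  rewrite integral_pkern_lt ?powR_ge0// -!EFinM; congr EFin.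
  have -> : (((t / b) `^ e^-1) `^ a) = t `^ (a / e) * b `^ (- (a / e)).
    rewrite -powRrM [_ * a]mulrC powRM ?invr_ge0 ?ltW//.
    by rewrite -[b^-1]powR_inv1 ?ltW// -powRrM mulN1r.
  by ring.
rewrite ge0_integralZl//=.
- by rewrite GammaE.
- by apply/measurable_EFinP/measurable_funTS; exact: measurable_gamma_integrand.
- by move=> t _; rewrite lee_fin mulr_ge0 ?powR_ge0 ?expR_ge0.
- by rewrite lee_fin powR_ge0.
Qed.

Lemma integral_powR_tail (R : realType) (b : R) : 0 < b ->
  (\int[leb]_(r in `[1%R, +oo[) (b * r `^ (- b - 1))%:E <= 1)%E.
Proof.
move=> b0.
have mE (D : set R) : measurable D -> measurable_fun D (fun r => (b * r `^ (- b - 1))%:E).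
  by move=> _; apply/measurable_EFinP/measurable_funTS; apply: measurable_funM.
have -> : `[1%R, +oo[%classic = \bigcup_n `[1, n.+2%:R]%classic :> set R.
  apply/seteqP; split => r /=; last by move=> [n _ /=]; rewrite !in_itv/= andbT => /andP[].
  rewrite in_itv/= andbT => r1; exists (Num.truncn r) => //=.
  by rewrite in_itv/= r1 (le_trans (ltW (truncnS_gt _)))// ler_nat.
have cvg1 : (\int[leb]_(r in `[1%R, n.+2%:R]) (b * r `^ (- b - 1))%:E)%E @[n --> \oo] -->
   (\int[leb]_(r in \bigcup_n `[1%R, n.+2%:R]%classic) (b * r `^ (- b - 1))%:E)%E.
  apply: ge0_nondecreasing_set_cvg_integral.
  - apply/nondecreasing_seqP => n; apply/subsetPset => r /=; rewrite !in_itv/= => /andP[-> h].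
    by rewrite (le_trans h)// ler_nat.
  - by move=> n; exact: measurable_itv.
  - by move=> n; apply: mE; exact: measurable_itv.
  - by move=> n r _; rewrite lee_fin mulr_ge0 ?powR_ge0// ltW.
rewrite -(cvg_lim _ cvg1)//; apply: lime_le; first by apply/cvg_ex; eexists; exact: cvg1.
apply: nearW => n.
have := @integral_pkern_itv R (- b) 1 n.+2%:R ltr01; rewrite ltr1n => /(_ isT).
have h1 : (1 : R) `^ (- b) = 1 by rewrite powR1.
rewrite /pkern h1 => h.
suff -> : (\int[leb]_(r in `[1%R, n.+2%:R]) (b * r `^ (- b - 1))%:E)%E =
   (1 - n.+2%:R `^ (- b))%:E.
  by rewrite lee_fin lerBlDr lerDl powR_ge0.
apply: oppe_inj; rewrite -integral_ge0N; last first.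
  by move=> r _; rewrite lee_fin mulr_ge0 ?powR_ge0// ltW.
rewrite -EFinN opprB -h; apply: eq_integral => r _.
by rewrite -EFinN mulNr.
Qed.

(** * Volumes of balls and lower half balls inside the cube *)

Definition vball (R : realType) k (u : k.-tuple R) (r : R) : R :=
  fine (lam k (@cube R k `&` dball u r)).

Definition lowcap (R : realType) k (x : k.+1.-tuple R) (r : R) : set (k.+1.-tuple R) :=
  [set y | mlast y <= mlast x] `&` dball x r.

Definition vcap (R : realType) k (x : k.+1.-tuple R) (r : R) : R :=
  fine (lam k.+1 (@cube R k.+1 `&` lowcap x r)).

Lemma measurable_lowcap (R : realType) k (x : k.+1.-tuple R) r :
  measurable (lowcap x r).
Proof.
apply: measurableI; last exact: measurable_dball.
by apply: measurable_set_le => //; exact: measurable_mlast.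
Qed.

Lemma vballE (R : realType) k (u : k.-tuple R) (r : R) :
  lam k (@cube R k `&` dball u r) = (vball u r)%:E.
Proof. by rewrite fineK// lebesgue_tuple_cubeI_fin//; exact: measurable_dball. Qed.

Lemma vcapE (R : realType) k (x : k.+1.-tuple R) (r : R) :
  lam k.+1 (@cube R k.+1 `&` lowcap x r) = (vcap x r)%:E.
Proof. by rewrite fineK// lebesgue_tuple_cubeI_fin//; exact: measurable_lowcap. Qed.

Lemma vball_ge0 (R : realType) k (u : k.-tuple R) (r : R) : 0 <= vball u r.
Proof. by rewrite fine_ge0. Qed.

Lemma vcap_ge0 (R : realType) k (x : k.+1.-tuple R) (r : R) : 0 <= vcap x r.
Proof. by rewrite fine_ge0. Qed.

Lemma vball_le1 (R : realType) k (u : k.-tuple R) (r : R) : vball u r <= 1.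
Proof.
rewrite -lee_fin -vballE lebesgue_tuple_cubeI_le1//; exact: measurable_dball.
Qed.

Lemma measurable_section_volume (R : realType) k d (T : measurableType d)
    (S : set (T * k.-tuple R)) : measurable S ->
  measurable_fun setT (fun t => fine (lam k [set y | S (t, y)])).
Proof.
move=> mS; apply: measurableT_comp => //.
have := measurable_fun_xsection (lam k) mS.
by congr measurable_fun; apply/funext => x /=; rewrite xsectionE.
Qed.

Lemma measurable_preimage d d' (T : measurableType d) (T' : measurableType d')
    (f : T -> T') A : measurable_fun setT f -> measurable A -> measurable (f @^-1` A).
Proof. by move=> mf mA; rewrite -[X in measurable X]setTI; exact: mf. Qed.

Lemma measurable_vball (R : realType) k :
  measurable_fun [set: k.-tuple R * R] (fun p => vball p.1 p.2).
Proof.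
apply: (@measurable_section_volume R k _ _
  [set q : (k.-tuple R * R) * k.-tuple R | @cube R k q.2 /\ eucl q.1.1 q.2 <= q.1.2]).
apply: measurableI.
  by apply: measurable_preimage => //; exact: measurable_cube.
apply: measurable_set_le; last exact: measurableT_comp.
by apply: measurable_eucl => //; exact: measurableT_comp.
Qed.

Lemma measurable_vcap (R : realType) k :
  measurable_fun [set: k.+1.-tuple R * R] (fun p => vcap p.1 p.2).
Proof.
apply: (@measurable_section_volume R k.+1 _ _
  [set q : (k.+1.-tuple R * R) * k.+1.-tuple R | @cube R k.+1 q.2 /\
     (mlast q.2 <= mlast q.1.1 /\ eucl q.1.1 q.2 <= q.1.2)]).
apply: measurableI.
  by apply: measurable_preimage => //; exact: measurable_cube.
apply: measurableI.
  apply: measurable_set_le; apply: measurableT_comp => //; try exact: measurable_mlast.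
  exact: measurableT_comp.
apply: measurable_set_le; last exact: measurableT_comp.
by apply: measurable_eucl => //; exact: measurableT_comp.
Qed.

Lemma cube_mrcons (R : realType) k (x : k.+1.-tuple R) :
  @cube R k.+1 x <-> @cube R k (mbelast x) /\ 0 < mlast x < 1.
Proof.
split=> [cx|[cu h] i].
  by split=> [i|]; [rewrite tnth_mktuple; exact: cx|exact: cx].
have [[j ->]|->//] := widen_or_max i.
by have := cu j; rewrite tnth_mktuple.
Qed.

(** The side is turned towards the farther end of the unit interval, so that it stays
    inside. *)
Definition corner_itv (R : realType) (t a : R) : set R :=
  if t <= 1 / 2 then `]t, t + a[%classic else `]t - a, t[%classic.

Definition corner_box (R : realType) k (u : k.-tuple R) (a : R) : set (k.-tuple R) :=
  [set y | forall i, corner_itv (tnth u i) a (tnth y i)].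

Lemma measurable_corner_itv (R : realType) (t a : R) : measurable (corner_itv t a).
Proof. by rewrite /corner_itv; case: ifP => _; exact: measurable_itv. Qed.

Lemma measurable_corner_box (R : realType) k (u : k.-tuple R) a :
  measurable (corner_box u a).
Proof.
apply: (@measurable_box _ _ (fun i => corner_itv (tnth u i) a)) => i.
exact: measurable_corner_itv.
Qed.

Lemma lebesgue_corner_box (R : realType) k (u : k.-tuple R) a : 0 < a ->
  lam k (corner_box u a) = (a ^+ k)%:E.
Proof.
move=> a0; rewrite (@lebesgue_tuple_box _ _ (fun i => corner_itv (tnth u i) a)); last first.
  by move=> i; exact: measurable_corner_itv.
rewrite (eq_bigr (fun=> a%:E)).
  by rewrite prodEFin prodr_const card_ord.
move=> i _; rewrite /corner_itv; case: ifP => _; rewrite lebesgue_measure_itv/= lte_fin.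
  by rewrite ltrDl a0 -EFinB addrAC subrr add0r.
by rewrite gtrBl a0 -EFinB opprB addrC subrK.
Qed.

Lemma corner_itvP (R : realType) (t a y : R) : 0 < t < 1 -> 0 < a <= 1 / 2 ->
  corner_itv t a y -> 0 < y < 1 /\ `|t - y| <= a.
Proof.
move=> /andP[t0 t1] /andP[a0 a1]; rewrite /corner_itv.
have [th|th] := leP t (1 / 2); rewrite /= in_itv/= => /andP[h1 h2].
  by split; [apply/andP; split; lra|rewrite ler_norml; apply/andP; split; lra].
by split; [apply/andP; split; lra|rewrite ler_norml; apply/andP; split; lra].
Qed.

Lemma corner_boxP (R : realType) k (u y : k.-tuple R) a : @cube R k u -> 0 < a <= 1 / 2 ->
  corner_box u a y -> @cube R k y /\ forall i, `|tnth u i - tnth y i| <= a.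
Proof.
by move=> cu ha hy; split=> i; have [] := corner_itvP (cu i) ha (hy i).
Qed.

(** The box of side [r / (2 * K)] with a corner at [u] lies in the cube and in the ball. *)
Lemma vball_lower (R : realType) k (u : k.-tuple R) (r K : R) :
  @cube R k u -> k%:R <= K -> 1 <= K -> 0 < r -> r <= K ->
  (r / (2 * K)) ^+ k <= vball u r.
Proof.
move=> cu kK K1 r0 rK.
have K0 : 0 < K by exact: lt_le_trans K1.
have a0 : 0 < r / (2 * K) by rewrite divr_gt0// mulr_gt0.
have a1 : r / (2 * K) <= 1 / 2 by rewrite ler_pdivrMr ?mulr_gt0//; lra.
rewrite -lee_fin -vballE -(lebesgue_corner_box u a0); apply: le_measure; rewrite ?inE.
- exact: measurable_corner_box.
- by apply: measurableI; [exact: measurable_cube|exact: measurable_dball].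
move=> y hy; have ha : 0 < r / (2 * K) <= 1 / 2 by rewrite a0.
have [cy dy] := corner_boxP cu ha hy.
split => //; apply: (eucl_le_tnth (ltW r0) _ dy).
rewrite -[X in _ <= X ^+ 2](@divfK _ (2 * K)); last by rewrite mulf_neq0// gt_eqF.
rewrite [X in _ <= X]exprMn mulrC ler_wpM2l ?sqr_ge0//.
by rewrite (le_trans kK)//; nra.
Qed.

(** As for [vball_lower], with the last side of the box going down from [x] and cut at
    height [0]. *)
Lemma vcap_lower (R : realType) k (x : k.+1.-tuple R) (r K : R) :
  @cube R k.+1 x -> k.+1%:R <= K -> 0 < r -> r <= K ->
  (r / (2 * K)) ^+ k * Num.min (mlast x) (r / (2 * K)) <= vcap x r.
Proof.
move=> /cube_mrcons[cu /andP[h0 h1]] kK r0 rK.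
have K1 : 1 <= K by rewrite (le_trans _ kK)// ler1n.
have K0 : 0 < K by exact: lt_le_trans K1.
have a0 : 0 < r / (2 * K) by rewrite divr_gt0// mulr_gt0.
have a1 : r / (2 * K) <= 1 / 2 by rewrite ler_pdivrMr ?mulr_gt0//; lra.
set a := r / (2 * K) in a0 a1 *.
set m := Num.min (mlast x) a.
have m0 : 0 < m by rewrite lt_min h0.
have mh : m <= mlast x by rewrite ge_min lexx.
have ma : m <= a by rewrite ge_min lexx orbT.
have -> : a ^+ k * m = fine (lam k.+1 [set y | corner_box (mbelast x) a (mbelast y) /\ `]mlast x - m, mlast x[%classic (mlast y)]).
  rewrite lebesgue_tuple_cylinder; [|exact: measurable_corner_box|exact: measurable_itv].
  rewrite lebesgue_corner_box// lebesgue_measure_itv/= lte_fin gtrBl m0 -EFinB opprB addrC subrK.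
  by [].
have mC : measurable [set y : k.+1.-tuple R | corner_box (mbelast x) a (mbelast y) /\ `]mlast x - m, mlast x[%classic (mlast y)].
  apply: measurableI.
    by apply: (measurable_preimage (@measurable_mbelast R k)); exact: measurable_corner_box.
  by apply: (measurable_preimage (@measurable_mlast R k)); exact: measurable_itv.
have sub : [set y : k.+1.-tuple R | corner_box (mbelast x) a (mbelast y) /\ `]mlast x - m, mlast x[%classic (mlast y)]
   `<=` @cube R k.+1 `&` lowcap x r.
  move=> y [hy]; rewrite /= in_itv/= => /andP[y1 y2].
  have ha : 0 < a <= 1 / 2 by rewrite a0.
  have [cy dy] := corner_boxP cu ha hy.
  split; [|split].
  - by apply/cube_mrcons; split => //; apply/andP; split; lra.
  - exact: ltW.
  - apply: (@eucl_le_tnth _ _ _ _ a) => //; first exact: ltW.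
      rewrite -[X in _ <= X ^+ 2](@divfK _ (2 * K)); last by rewrite mulf_neq0// gt_eqF.
      rewrite [X in _ <= X]exprMn mulrC ler_wpM2l ?sqr_ge0//.
      by rewrite (le_trans kK)//; nra.
    move=> i; have [[j ->]|->] := widen_or_max i.
      by have := dy j; rewrite !tnth_mktuple.
    rewrite -/(mlast x) -/(mlast y) ler_norml; apply/andP; split; lra.
rewrite -lee_fin -vcapE fineK.
  apply: le_measure => //; rewrite inE//.
  by apply: measurableI; [exact: measurable_cube|exact: measurable_lowcap].
rewrite (_ : [set _ | _] = @cube R k.+1 `&` [set y : k.+1.-tuple R | corner_box (mbelast x) a (mbelast y) /\ `]mlast x - m, mlast x[%classic (mlast y)]).
  exact: lebesgue_tuple_cubeI_fin.
by apply/esym/setIidr => y /sub[].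
Qed.

Lemma le_fine_cube (R : realType) k (A : set (k.-tuple R)) (B : set (k.-tuple R)) :
  measurable A -> measurable B -> @cube R k `&` A `<=` B ->
  (lam k B < +oo)%E -> fine (lam k (@cube R k `&` A)) <= fine (lam k B).
Proof.
move=> mA mB AB Bfin; apply: fine_le.
- exact: lebesgue_tuple_cubeI_fin.
- by rewrite ge0_fin_numE.
- apply: le_measure; rewrite ?inE//.
  by apply: measurableI => //; exact: measurable_cube.
Qed.

(** The part of the cube below [x] and within distance [r] lies in the cylinder over the
    ball of the same radius around the projection of [x]. *)
Lemma vcap_upper (R : realType) k (x : k.+1.-tuple R) (r : R) :
  0 < mlast x -> vcap x r <= mlast x * vball (mbelast x) r.
Proof.
move=> h0.
pose B := [set y : k.+1.-tuple R | (@cube R k `&` dball (mbelast x) r) (mbelast y) /\ `]0, mlast x]%classic (mlast y)].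
have mU : measurable (@cube R k `&` dball (mbelast x) r).
  by apply: measurableI; [exact: measurable_cube|exact: measurable_dball].
have mB : measurable B.
  apply: measurableI.
    exact: (measurable_preimage (@measurable_mbelast R k)).
  by apply: (measurable_preimage (@measurable_mlast R k)); exact: measurable_itv.
have lB : lam k.+1 B = (mlast x * vball (mbelast x) r)%:E.
  rewrite lebesgue_tuple_cylinder; [|exact: mU|exact: measurable_itv].
  by rewrite vballE lebesgue_measure_itv/= lte_fin h0 -EFinB subr0 -EFinM mulrC.
have -> : mlast x * vball (mbelast x) r = fine (lam k.+1 B) by rewrite lB.
apply: le_fine_cube => //; first exact: measurable_lowcap.
  move=> y [/cube_mrcons[cu /andP[y0 y1]] [yx]]; rewrite /dball/= !eucl_le => /andP[r0 h].
  split; last by rewrite /= in_itv/= y0.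
  split => //; rewrite /dball/= eucl_le r0/= (le_trans _ h)//.
  by rewrite [leRHS]sqdistE_mrcons lerDl sqr_ge0.
by rewrite lB ltry.
Qed.

(** Pythagoras: at a height difference of at most [dl], the horizontal distance may be
    as large as [Num.sqrt (r ^+ 2 - dl ^+ 2)]. *)
Lemma vcap_slab (R : realType) k (x : k.+1.-tuple R) (r dl : R) :
  0 < mlast x < 1 -> mlast x <= dl -> dl <= r ->
  mlast x * vball (mbelast x) (Num.sqrt (r ^+ 2 - dl ^+ 2)) <= vcap x r.
Proof.
move=> /andP[h0 h1] hd dr; set s := Num.sqrt _.
have r0 : 0 <= r by rewrite (le_trans _ dr)// (le_trans _ hd)// ltW.
have d0 : 0 <= dl by rewrite (le_trans _ hd)// ltW.
have s2 : s ^+ 2 = r ^+ 2 - dl ^+ 2.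
  by rewrite sqr_sqrtr// subr_ge0 lerXn2r.
pose B := [set y : k.+1.-tuple R | (@cube R k `&` dball (mbelast x) s) (mbelast y) /\ `]0, mlast x]%classic (mlast y)].
have mU : measurable (@cube R k `&` dball (mbelast x) s).
  by apply: measurableI; [exact: measurable_cube|exact: measurable_dball].
have mB : measurable B.
  apply: measurableI.
    exact: (measurable_preimage (@measurable_mbelast R k)).
  by apply: (measurable_preimage (@measurable_mlast R k)); exact: measurable_itv.
have lB : lam k.+1 B = (mlast x * vball (mbelast x) s)%:E.
  rewrite lebesgue_tuple_cylinder; [|exact: mU|exact: measurable_itv].
  by rewrite vballE lebesgue_measure_itv/= lte_fin h0 -EFinB subr0 -EFinM mulrC.
rewrite -lee_fin -lB -vcapE; apply: le_measure; rewrite ?inE//.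
  by apply: measurableI; [exact: measurable_cube|exact: measurable_lowcap].
move=> y [[cu]]; rewrite /dball/= eucl_le in_itv/= => /andP[s0 h] /andP[y0 yx].
split; first by apply/cube_mrcons; split => //; rewrite y0 (le_lt_trans yx).
split => //; rewrite /dball/= eucl_le r0/= sqdistE_mrcons.
rewrite -(subrK (dl ^+ 2) (r ^+ 2)) -s2 lerD// lerXn2r ?nnegrE ?subr_ge0//.
by rewrite lerBlDr (le_trans hd)// lerDl ltW.
Qed.

Lemma dball_sub (R : realType) k (u : k.-tuple R) (r s : R) :
  r <= s -> dball u r `<=` dball u s.
Proof. by move=> rs y h; exact: le_trans rs. Qed.

Lemma lebesgue_dballE (R : realType) k (u : k.-tuple R) (r : R) : 0 < r ->
  lam k (dball u r) = (r ^+ k * ball_vol R k)%:E.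
Proof. by move=> r0; rewrite lebesgue_tuple_dball// ball_volE. Qed.

Lemma vball_mono (R : realType) k (u : k.-tuple R) (r s : R) :
  r <= s -> vball u r <= vball u s.
Proof.
move=> rs; rewrite -lee_fin -!vballE; apply: le_measure; rewrite ?inE.
- by apply: measurableI; [exact: measurable_cube|exact: measurable_dball].
- by apply: measurableI; [exact: measurable_cube|exact: measurable_dball].
- by apply: setIS; exact: dball_sub.
Qed.

(** The growth is at most that of the ball without intersecting with the cube. *)
Lemma vball_lipschitz (R : realType) k (u : k.-tuple R) (r s : R) :
  0 < r -> r <= s -> vball u s <= vball u r + ball_vol R k * (s ^+ k - r ^+ k).
Proof.
move=> r0 rs; have s0 := lt_le_trans r0 rs.
have m1 t : measurable (dball u t) by exact: measurable_dball.
have mc := @measurable_cube R k.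
have mD : measurable (dball u s `\` dball u r) by exact: measurableD.
have lD : lam k (dball u s `\` dball u r) = (ball_vol R k * (s ^+ k - r ^+ k))%:E.
  rewrite measureD//=; last by rewrite /= lebesgue_dballE// ltry.
  rewrite (setIidr (dball_sub rs)) /= !lebesgue_dballE// -EFinB; congr EFin; ring.
rewrite -lee_fin EFinD -lD -!vballE -measureU//.
- apply: le_measure; rewrite ?inE.
  + exact: measurableI.
  + by apply: measurableU => //; exact: measurableI.
  + move=> y [cy sy]; have [ry|ry] := pselect (dball u r y); first by left.
    by right.
- exact: measurableI.
- by apply/seteqP; split => // y [[_ ry] [_]].
Qed.

Lemma vball_full (R : realType) k (u : k.-tuple R) (r : R) :
  @cube R k u -> k%:R <= r -> 0 < r -> 1 <= r -> vball u r = 1.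
Proof.
move=> cu kr r0 r1; rewrite /vball (_ : _ `&` _ = @cube R k) ?lebesgue_tuple_cube//.
apply/setIidl => y cy; apply: (@eucl_le_tnth _ _ _ _ 1) => //; first exact: ltW.
  by rewrite expr1n mulr1; nra.
move=> i; have := cu i; have := cy i => /andP[? ?] /andP[? ?].
by rewrite ler_norml; apply/andP; split; lra.
Qed.

Lemma vball_upper (R : realType) k (u : k.-tuple R) (r : R) :
  0 <= r -> vball u r <= (2 * r) ^+ k.
Proof.
move=> r0.
pose B := [set y : k.-tuple R | forall i, `[tnth u i - r, tnth u i + r]%classic (tnth y i)].
have lB : lam k B = ((2 * r) ^+ k)%:E.
  rewrite (lebesgue_tuple_itv_box (a := fun i => tnth u i - r) (b := fun i => tnth u i + r)).
    rewrite (eq_bigr (fun=> 2 * r)); last by move=> i _; ring.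
    by rewrite prodr_const card_ord.
  by move=> i; lra.
have -> : (2 * r) ^+ k = fine (lam k B) by rewrite lB.
apply: le_fine_cube; last by rewrite lB ltry.
- exact: measurable_dball.
- by apply: (@measurable_box _ _ (fun i => `[tnth u i - r, tnth u i + r]%classic)) => i; exact: measurable_itv.
move=> y [_ uy] i; rewrite /= in_itv/=.
have := tnth_le_edist i uy; rewrite ler_norml => /andP[? ?].
by apply/andP; split; lra.
Qed.

Arguments lebesgue_tuple : simpl never.

Lemma inner_radius (R : realType) k (x : k.-tuple R) : @cube R k x ->
  exists2 e : R, 0 < e & forall r, r < e -> dball x r `<=` @cube R k.
Proof.
move=> cx; exists (\big[Num.min/1]_(i < k) Num.min (tnth x i) (1 - tnth x i)).
  by apply: lt_bigmin => // i _; have /andP[? ?] := cx i; rewrite lt_min subr_gt0; apply/andP.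
move=> r re y xy i.
have : r < Num.min (tnth x i) (1 - tnth x i).
  by apply: lt_le_trans re _; apply: bigmin_le_cond.
rewrite lt_min => /andP[? ?].
have := tnth_le_edist i xy; rewrite ler_norml => /andP[? ?].
by apply/andP; split; lra.
Qed.

(** The reflection in the hyperplane through the centre exchanges the two halves, and
    the hyperplane is negligible. *)
Lemma lebesgue_half_ball (R : realType) k (x : k.+1.-tuple R) (r : R) : 0 < r ->
  lam k.+1 (lowcap x r) = (ball_vol R k.+1 / 2 * r ^+ k.+1)%:E.
Proof.
move=> r0.
have ml := @measurable_mlast R k.
have mB := measurable_dball x r.
pose low := [set y : k.+1.-tuple R | mlast y < mlast x] `&` dball x r.
pose up := [set y : k.+1.-tuple R | mlast x < mlast y] `&` dball x r.
pose hyp := [set y : k.+1.-tuple R | mlast y = mlast x] `&` dball x r.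
have mlow : measurable low by apply: measurableI => //; exact: measurable_set_lt.
have mup : measurable up by apply: measurableI => //; exact: measurable_set_lt.
have mhyp : measurable hyp.
  apply: measurableI => //.
  by apply: (measurable_preimage ml (A := [set mlast x])); exact: measurable_set1.
have hyp0 : lam k.+1 hyp = 0%E.
  have := @lebesgue_tuple_cylinder R k setT [set mlast x] measurableT (measurable_set1 _).
  rewrite lebesgue_measure_set1 mule0 => h0.
  apply: (subset_measure0 (B := [set y | setT (mbelast y) /\ [set mlast x] (mlast y)])) => //.
    apply: measurableI; first exact: (measurable_preimage (@measurable_mbelast R k)).
    by apply: (measurable_preimage ml (A := [set mlast x])); exact: measurable_set1.
  by move=> y [].
have refl : lam k.+1 low = lam k.+1 up.
  pose b := mrcons ([tuple (0 : R) | i < k], 2 * mlast x).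
  pose s := mrcons ([tuple (1 : R) | i < k], -1).
  have -> : low = affine_tuple b s @^-1` up.
    have Tl y : mlast (affine_tuple b s y) = 2 * mlast x - mlast y.
      by rewrite /mlast tnth_mktuple !tnth_mrcons_max mulN1r.
    have Tw y j : tnth (affine_tuple b s y) (widen_ord (leqnSn k) j) = tnth y (widen_ord (leqnSn k) j).
      by rewrite tnth_mktuple !tnth_mrcons_widen !tnth_mktuple add0r mul1r.
    have Te y : eucl x (affine_tuple b s y) = eucl x y.
      congr Num.sqrt; rewrite !big_ord_recr/=; congr (_ + _).
        by apply: eq_bigr => i _; rewrite Tw.
      by rewrite -/(mlast x) -/(mlast y) -/(mlast (affine_tuple _ _ _)) Tl; ring.
    by apply/seteqP; split => y; rewrite /low /up /dball /= Tl Te => -[? ?]; split => //; lra.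
  rewrite lebesgue_tuple_affine//.
    rewrite big1 ?mul1e// => i _; have [[j ->]|->] := widen_or_max i.
      by rewrite tnth_mrcons_widen tnth_mktuple normr1 invr1.
    by rewrite tnth_mrcons_max normrN normr1 invr1.
  move=> i; have [[j ->]|->] := widen_or_max i.
    by rewrite tnth_mrcons_widen tnth_mktuple oner_neq0.
  by rewrite tnth_mrcons_max oppr_eq0 oner_neq0.
have low_hyp : lam k.+1 (lowcap x r) = lam k.+1 low.
  have -> : lowcap x r = low `|` hyp.
    apply/seteqP; split => y; rewrite /lowcap /low /hyp /=.
      by move=> [+ ?]; rewrite le_eqVlt => /orP[/eqP|]; [right|left].
    by move=> [[/ltW]|[-> ?]]; split.
  rewrite measureU//= ?hyp0 ?adde0//.
  by apply/seteqP; split => // y [[/= + _] [e _]]; rewrite e ltxx.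
have total : lam k.+1 (dball x r) = (lam k.+1 low + lam k.+1 low)%E.
  rewrite {2}refl.
  have -> : dball x r = (low `|` hyp) `|` up.
    apply/seteqP; split => y; last by move=> [[[]|[]]|[]].
    move=> ry; have [h|h|h] := ltgtP (mlast y) (mlast x); by [left; left|right|left; right].
  rewrite measureU//=; [|exact: measurableU|].
    rewrite measureU//= ?hyp0 ?adde0//.
    by apply/seteqP; split => // y [[/= + _] [e _]]; rewrite e ltxx.
  apply/seteqP; split => // y [[[/= h _]|[/= h _]] [/= h' _]]; last by rewrite h ltxx in h'.
  by have := lt_trans h h'; rewrite ltxx.
have lowfin : lam k.+1 low \is a fin_num.
  rewrite ge0_fin_numE//; apply: (@le_lt_trans _ _ (lam k.+1 (dball x r))).
    by rewrite total leeDl.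
  by rewrite lebesgue_dballE// ltry.
rewrite low_hyp -(fineK lowfin); congr EFin.
move: total; rewrite -(fineK lowfin) lebesgue_dballE// -EFinD => -[e].
by lra.
Qed.

Lemma vcap_inner (R : realType) k (x : k.+1.-tuple R) : @cube R k.+1 x ->
  exists2 e : R, 0 < e &
    forall r, 0 < r < e -> vcap x r = ball_vol R k.+1 / 2 * r ^+ k.+1.
Proof.
move=> cx; have [e e0 he] := inner_radius cx; exists e => // r /andP[r0 re].
rewrite /vcap (_ : _ `&` _ = lowcap x r) ?lebesgue_half_ball//.
by apply: setIidr => y [_ /(he _ re)].
Qed.

(** * Discretization of the cube *)

Lemma cvg_EFinP (R : realType) (u : nat -> R) (l : R) :
  ((u n)%:E @[n --> \oo] --> l%:E) <-> (u n @[n --> \oo] --> l).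
Proof.
split=> [|ul]; first exact: fine_cvg.
by apply: cvg_EFin => //; exact: nearW.
Qed.

Lemma real_dominated_cvg d (T : measurableType d) (R : realType)
    (mu : {measure set T -> \bar R}) (D : set T)
    (f_ : nat -> T -> R) (f g : T -> R) :
  measurable D -> (forall n, measurable_fun D (f_ n)) -> measurable_fun D g ->
  (forall x, D x -> f_ n x @[n --> \oo] --> f x) ->
  (forall n x, D x -> `|f_ n x| <= g x) ->
  (\int[mu]_(x in D) (g x)%:E < +oo)%E ->
  (\int[mu]_(x in D) (f_ n x)%:E @[n --> \oo] --> \int[mu]_(x in D) (f x)%:E)%E.
Proof.
move=> mD mf mg fcvg fg gfin.
have g0 x : D x -> 0 <= g x by move=> Dx; exact: le_trans (fg 0%N x Dx).
apply: (@dominated_cvg _ _ _ _ _ mD (fun n x => (f_ n x)%:E) (fun x => (f x)%:E) (fun x => (g x)%:E)) => //.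
- by move=> n; exact/measurable_EFinP.
- by move=> x Dx; apply/cvg_EFinP; exact: fcvg.
- apply/integrableP; split; first exact/measurable_EFinP.
  rewrite (eq_integral (fun x => (g x)%:E))// => x; rewrite inE => Dx /=.
  by rewrite ger0_norm// g0.
Qed.

Notation grid k N := (k.-tuple 'I_N.+1).

Definition gindex (R : realType) (N : nat) (t : R) : 'I_N.+1 :=
  inord (Num.truncn (N.+1%:R * t)).

(** Points with a coordinate outside the unit interval get an unspecified cell. *)
Definition gcell (R : realType) k N (x : k.-tuple R) : grid k N :=
  [tuple gindex N (tnth x i) | i < k].

Lemma gindexP (R : realType) N (t : R) (j : 'I_N.+1) : 0 < t < 1 ->
  (gindex N t == j) = (j%:R <= N.+1%:R * t < j.+1%:R).
Proof.
move=> /andP[t0 t1]; have h0 : 0 <= N.+1%:R * t by rewrite mulr_ge0// ltW.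
have h : (Num.truncn (N.+1%:R * t) < N.+1)%N.
  by rewrite truncn_lt_nat// gtr_pMr.
rewrite -(inj_eq val_inj) /gindex /= inordK//.
by rewrite -truncn_eq//.
Qed.

Definition ginterval (R : realType) N (j : 'I_N.+1) : set R :=
  `]0, 1[%classic `&` `[j%:R / N.+1%:R, j.+1%:R / N.+1%:R[%classic.

Lemma gcell_box (R : realType) k N (c : grid k N) :
  @cube R k `&` [set x | gcell N x = c] =
  [set x | forall i, ginterval (tnth c i) (tnth x i)].
Proof.
apply/seteqP; split => x.
  move=> [cx xc] i; have := cx i => xi.
  have : gindex N (tnth x i) == tnth c i by rewrite -xc tnth_mktuple.
  rewrite gindexP// => /andP[h1 h2]; split; first by rewrite /= in_itv.
  by rewrite /= in_itv/= ler_pdivrMr// ltr_pdivlMr// mulrC h1.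
move=> h; have cx : @cube R k x.
  by move=> i; have [] := h i; rewrite /= in_itv.
split => //; apply: eq_from_tnth => i; rewrite tnth_mktuple; apply/eqP.
rewrite gindexP; last exact: cx.
by have [_] := h i; rewrite /= in_itv/= ler_pdivrMr// ltr_pdivlMr// [_ * N.+1%:R]mulrC.
Qed.

Lemma lebesgue_ginterval (R : realType) N (j : 'I_N.+1) :
  lebesgue_measure (@ginterval R N j) = (N.+1%:R^-1)%:E.
Proof.
have N0 : (0 : R) < N.+1%:R by [].
have jN : j.+1%:R / N.+1%:R <= 1 :> R by rewrite ler_pdivrMr// mul1r ler_nat.
rewrite /ginterval; have [->|j0] := eqVneq (j : nat) 0%N.
  rewrite (_ : _ `&` _ = `]0, 1%:R / N.+1%:R[%classic).
    by rewrite lebesgue_measure_itv/= lte_fin divr_gt0// -EFinB subr0 mul1r.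
  apply/seteqP; split => t /=; rewrite !in_itv/= mul0r.
    by move=> [/andP[-> _] /andP[_ ->]].
  move=> /andP[t0 t1]; rewrite t0 t1 (ltW t0) (lt_le_trans t1)//.
  by rewrite ler_pdivrMr// mul1r ler_nat.
rewrite (_ : _ `&` _ = `[j%:R / N.+1%:R, j.+1%:R / N.+1%:R[%classic).
  rewrite lebesgue_measure_itv/= lte_fin ltr_pM2r ?invr_gt0// ltr_nat ltnSn.
  by rewrite -EFinB -mulrBl -natrB// subSn// subnn mul1r.
apply/seteqP; split => t /=; rewrite !in_itv/=; first by case.
move=> /andP[h1 h2]; split; last by rewrite h1.
by rewrite (lt_le_trans h2 jN) andbT (lt_le_trans _ h1)// divr_gt0// ltr0n lt0n.
Qed.

Lemma measurable_ginterval (R : realType) N (j : 'I_N.+1) : measurable (@ginterval R N j).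
Proof. by apply: measurableI; exact: measurable_itv. Qed.

Definition gmesh (R : realType) k N : R := N.+1%:R^-1 ^+ k.

Lemma lebesgue_gcell (R : realType) k N (c : grid k N) :
  lam k (@cube R k `&` [set x | gcell N x = c]) = (gmesh R k N)%:E.
Proof.
rewrite gcell_box (@lebesgue_tuple_box _ _ (fun i => ginterval (tnth c i))).
  rewrite (eq_bigr (fun=> (N.+1%:R^-1)%:E)); last by move=> i _; exact: lebesgue_ginterval.
  by rewrite prodEFin prodr_const card_ord.
by move=> i; exact: measurable_ginterval.
Qed.

Lemma measurable_gcell (R : realType) k N (c : grid k N) :
  measurable (@cube R k `&` [set x | gcell N x = c]).
Proof.
rewrite gcell_box; apply: (@measurable_box _ _ (fun i => ginterval (tnth c i))) => i.
exact: measurable_ginterval.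
Qed.

Lemma measurable_gcellP (R : realType) k N (P : pred (grid k N)) :
  measurable (@cube R k `&` [set x | P (gcell N x)]).
Proof.
rewrite (_ : _ `&` _ = \bigcup_(c in [set c | P c]) (@cube R k `&` [set x | gcell N x = c])).
  apply: fin_bigcup_measurable; first exact: finite_finset.
  by move=> c _; exact: measurable_gcell.
apply/seteqP; split => x /=; first by move=> [cx Px]; exists (gcell N x).
by move=> [c Pc [cx xc]]; split => //=; rewrite xc.
Qed.

Lemma measurable_gcell_fun (R : realType) k N (F : grid k N -> R) :
  measurable_fun (@cube R k) (fun x => F (gcell N x)).
Proof.
move=> mc B mB; rewrite (_ : _ `&` _ = @cube R k `&` [set x | (fun c => `[< B (F c) >]) (gcell N x)]).
  exact: (@measurable_gcellP R k N (fun c => `[< B (F c) >])).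
by apply/seteqP; split => x [cx h]; split => //; apply/asboolP.
Qed.

Lemma integral_gcell (R : realType) k N (F : grid k N -> R) : (forall c, 0 <= F c) ->
  (\int[lam k]_(x in @cube R k) (F (gcell N x))%:E = (\sum_c F c * gmesh R k N)%:E)%E.
Proof.
move=> F0; have mc := @measurable_cube R k.
pose f (c : grid k N) (x : k.-tuple R) : \bar R :=
  ((F c)%:E * (\1_(@cube R k `&` [set x | gcell N x = c]) x)%:E)%E.
transitivity (\int[lam k]_(x in @cube R k) \sum_c f c x)%E.
  apply: eq_integral => x; rewrite inE => cx.
  rewrite (bigD1 (gcell N x))//= big1 ?adde0.
    by rewrite /f indicE mem_set// mule1.
  move=> c cn; rewrite /f indicE memNset ?mule0//.
  by move=> [_ /= e]; rewrite e eqxx in cn.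
have mf c : measurable_fun (@cube R k) (f c).
  apply/measurable_EFinP; apply: measurable_funM => //.
  by apply: measurable_indic; exact: measurable_gcell.
rewrite ge0_integral_sum//; last first.
  by move=> c x _; rewrite mule_ge0// lee_fin.
rewrite -sumEFin; apply: eq_bigr => c _.
rewrite /f ge0_integralZl//; [|
  by apply/measurable_EFinP; apply: measurable_indic; exact: measurable_gcell|
  by rewrite lee_fin].
rewrite integral_indic//; last exact: measurable_gcell.
by rewrite setIAC setIid /= lebesgue_gcell -EFinM.
Qed.

Lemma lebesgue_gcellP (R : realType) k N (P : pred (grid k N)) :
  lam k (@cube R k `&` [set x | P (gcell N x)]) = (\sum_(c | P c) gmesh R k N)%:E.
Proof.
have mc := @measurable_cube R k.
transitivity (\int[lam k]_(x in @cube R k) ((P (gcell N x))%:R)%:E)%E.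
  rewrite -[in LHS](setIid (@cube R k)) -setIA setIC.
  rewrite -integral_indic//; last exact: measurable_gcellP.
  apply: eq_integral => x; rewrite inE => cx; rewrite indicE; congr (_%:R%:E).
  congr nat_of_bool; apply/idP/idP; rewrite inE; first by case.
  by move=> h; split.
rewrite (@integral_gcell _ _ _ (fun c => (P c)%:R)); last by move=> c.
congr EFin; rewrite [RHS]big_mkcond; apply: eq_bigr => c _.
by case: (P c); rewrite ?mul1r ?mul0r.
Qed.

Lemma gcell_close (R : realType) k N (x y : k.-tuple R) i : @cube R k x -> @cube R k y ->
  gcell N x = gcell N y -> `|tnth x i - tnth y i| <= N.+1%:R^-1.
Proof.
move=> cx cy e.
have : gindex N (tnth x i) == gindex N (tnth y i).
  by have := congr1 (fun c => tnth c i) e; rewrite !tnth_mktuple => ->.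
rewrite gindexP; last exact: cx.
have : gindex N (tnth y i) == gindex N (tnth y i) by [].
rewrite gindexP; last exact: cy.
move=> /andP[h1 h2] /andP[h3 h4].
have N0 : (0 : R) < N.+1%:R by [].
rewrite -(ler_pM2l N0) mulfV ?gt_eqF// -{1}(gtr0_norm N0) -normrM ler_norml.
move: h2 h4; rewrite -natr1 => h2 h4.
by apply/andP; split; lra.
Qed.

Lemma gmesh_gt0 (R : realType) k N : 0 < gmesh R k N.
Proof. by rewrite exprn_gt0// invr_gt0. Qed.

Lemma gmesh_total (R : realType) k N : \sum_(c : grid k N) gmesh R k N = 1.
Proof.
have := @lebesgue_gcellP R k N predT.
rewrite (_ : _ `&` _ = @cube R k); last by apply/seteqP; split => x; [case|].
by rewrite lebesgue_tuple_cube => -[->].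
Qed.

Lemma cvg_gmesh (R : realType) k : (0 < k)%N -> gmesh R k N @[N --> \oo] --> 0.
Proof.
move=> k0.
apply: (@squeeze_cvgr _ _ _ _ (fun=> 0) (@harmonic R)).
- near=> N; rewrite ltW ?gmesh_gt0//= /gmesh -(prednK k0) exprS ler_piMr ?invr_ge0//.
  by rewrite exprn_ile1 ?invr_ge0// invf_le1// ler1n.
- exact: cvg_cst.
- exact: cvg_harmonic.
Unshelve. all: by end_near. Qed.

Section grid_approximation.
Context (R : realType) (k : nat).
Variable eN : forall N, rel (grid k N).
Variable e : k.-tuple R -> k.-tuple R -> bool.

(** Relations between cells that describe a relation between points once the mesh is
    fine enough for the two points considered. *)
Definition grid_approx := forall x y, @cube R k x -> @cube R k y ->
  \forall N \near \oo, eN (gcell N x) (gcell N y) = e x y.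

Definition vstep N (c : grid k N) : R := \sum_(c' | eN c c') gmesh R k N.

Definition vlim (x : k.-tuple R) : R := fine (lam k (@cube R k `&` [set y | e x y])).

Lemma vstep_ge0 N (c : grid k N) : 0 <= vstep c.
Proof. by apply: sumr_ge0 => c' _; rewrite ltW ?gmesh_gt0. Qed.

Lemma vstep_le1 N (c : grid k N) : vstep c <= 1.
Proof.
rewrite -(gmesh_total R k N) /vstep big_mkcond; apply: ler_sum => c' _.
by case: ifP => // _; rewrite ltW ?gmesh_gt0.
Qed.

Hypothesis approx : grid_approx.
Hypothesis me : forall x, measurable (@cube R k `&` [set y | e x y]).

Lemma vlimE x : lam k (@cube R k `&` [set y | e x y]) = (vlim x)%:E.
Proof.
rewrite /vlim fineK// ge0_fin_numE//.
by rewrite -(setIid (@cube R k)) -setIA (le_lt_trans (lebesgue_tuple_cubeI_le1 _))// ltry.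
Qed.

Lemma vlim_ge0 x : 0 <= vlim x. Proof. by rewrite fine_ge0. Qed.

Lemma vlim_le1 x : vlim x <= 1.
Proof.
by rewrite -lee_fin -vlimE -(setIid (@cube R k)) -setIA lebesgue_tuple_cubeI_le1.
Qed.

Lemma cube_bounded_cvg (f_ : nat -> k.-tuple R -> R) (f : k.-tuple R -> R) :
  (forall n, measurable_fun (@cube R k) (f_ n)) ->
  (forall x, @cube R k x -> f_ n x @[n --> \oo] --> f x) ->
  (forall n x, @cube R k x -> `|f_ n x| <= 1) ->
  (\int[lam k]_(x in @cube R k) (f_ n x)%:E @[n --> \oo] -->
   \int[lam k]_(x in @cube R k) (f x)%:E)%E.
Proof.
move=> mf fcvg f1; have mc := @measurable_cube R k.
apply: (@real_dominated_cvg _ _ _ _ _ f_ f (fun=> 1)) => //.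
by rewrite integral_cst//= lebesgue_tuple_cube mule1 ltry.
Qed.

Lemma integral_cube_pred (p : pred (k.-tuple R)) : measurable (@cube R k `&` [set y | p y]) ->
  (\int[lam k]_(y in @cube R k) ((p y)%:R)%:E)%E = lam k (@cube R k `&` [set y | p y]).
Proof.
have mc := @measurable_cube R k.
move=> mA; rewrite -[in RHS](setIid (@cube R k)) -setIA setIC.
rewrite -integral_indic//; apply: eq_integral => y; rewrite inE => cy.
rewrite !indicE; congr (_%:R%:E); congr nat_of_bool; apply/idP/idP; rewrite !inE; last by case.
by move=> h; split.
Qed.

Lemma cvg_vstep x : @cube R k x -> vstep (gcell N x) @[N --> \oo] --> vlim x.
Proof.
move=> cx; have mc := @measurable_cube R k.
apply/cvg_EFinP; rewrite -vlimE -integral_cube_pred//.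
have mN N : measurable (@cube R k `&` [set y | eN (gcell N x) (gcell N y)]).
  exact: (@measurable_gcellP R k N (eN (gcell N x))).
under eq_fun do rewrite /vstep -lebesgue_gcellP -(integral_cube_pred (mN _)).
apply: cube_bounded_cvg => [N|y cy|N y cy].
- exact: (@measurable_gcell_fun R k N (fun c => (eN (gcell N x) c)%:R)).
- apply: cvg_near_cst; near=> N; congr (_%:R); congr nat_of_bool.
  near: N; exact: approx.
- by rewrite normr_nat lern1 leq_b1.
Unshelve. all: by end_near. Qed.

(** A Riemann sum: by dominated convergence the volumes of the neighbourhoods of the
    cells converge to those of the neighbourhoods of the points. *)
Lemma cvg_step_integral (Phi : R -> R) :
  continuous Phi -> (forall v, 0 <= v <= 1 -> 0 <= Phi v <= 1) ->
  ((\sum_(c : grid k N) Phi (vstep c) * gmesh R k N)%:E @[N --> \oo] -->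
   \int[lam k]_(x in @cube R k) (Phi (vlim x))%:E)%E.
Proof.
move=> cPhi Phi01.
under eq_fun => N.
  rewrite -integral_gcell; last first.
    by move=> c; have /andP[] := Phi01 _ (introT andP (conj (vstep_ge0 c) (vstep_le1 c))).
  over.
apply: cube_bounded_cvg => [N|x cx|N x cx].
- exact: (@measurable_gcell_fun R k N (fun c => Phi (vstep c))).
- apply: continuous_cvg; [exact: cPhi|exact: cvg_vstep].
- have /andP[h0 h1] := Phi01 _ (introT andP (conj (vstep_ge0 (gcell N x)) (vstep_le1 (gcell N x)))).
  by rewrite ger0_norm.
Qed.
End grid_approximation.

(** Outer approximations suit closed relations: two points that are not related remain
    at a positive distance from being so, hence in unrelated cells when the mesh is
    small. *)
Definition outer (R : realType) k (e : k.-tuple R -> k.-tuple R -> Prop) N : rel (grid k N) :=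
  fun c c' => `[< exists x y, [/\ @cube R k x, @cube R k y, gcell N x = c, gcell N y = c' & e x y] >].

Lemma sqr_close (R : realType) (p q p' q' a : R) :
  0 < p < 1 -> 0 < q < 1 -> 0 < p' < 1 -> 0 < q' < 1 ->
  `|p - p'| <= a -> `|q - q'| <= a ->
  (p - q) ^+ 2 <= (p' - q') ^+ 2 + 4 * a.
Proof.
move=> /andP[? ?] /andP[? ?] /andP[? ?] /andP[? ?].
rewrite !ler_norml => /andP[? ?] /andP[? ?].
rewrite -lerBlDl subr_sqr.
set D := p - q - _; set S := p - q + _.
have ? : - (2 * a) <= D by rewrite /D; lra.
have ? : D <= 2 * a by rewrite /D; lra.
have ? : - 2 <= S by rewrite /S; lra.
have ? : S <= 2 by rewrite /S; lra.
by have [?|?] := leP 0 D; nra.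
Qed.

Lemma sqdist_close (R : realType) k (x y x' y' : k.-tuple R) (a : R) :
  @cube R k x -> @cube R k y -> @cube R k x' -> @cube R k y' ->
  (forall i, `|tnth x i - tnth x' i| <= a) -> (forall i, `|tnth y i - tnth y' i| <= a) ->
  sqdist x y <= sqdist x' y' + k%:R * (4 * a).
Proof.
move=> cx cy cx' cy' hx hy.
rewrite /sqdist mulr_natl -[X in _ *+ X]card_ord -sumr_const -big_split/=.
apply: ler_sum => i _.
exact: sqr_close.
Qed.

Lemma near_inv (R : realType) (K e : R) : 0 < e ->
  \forall N \near \oo, K * N.+1%:R^-1 < e.
Proof.
move=> e0; have h : K * @harmonic R N @[N --> \oo] --> K * 0.
  by apply: cvgM; [exact: cvg_cst|exact: cvg_harmonic].
rewrite mulr0 in h; move/cvgrPdist_lt : h => /(_ e e0); apply: filterS => N.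
by rewrite sub0r normrN; apply: le_lt_trans; exact: ler_norm.
Qed.

Lemma outer_dball_approx (R : realType) k (r : R) :
  grid_approx (@outer R k (fun x y => eucl x y <= r)) (fun x y => eucl x y <= r).
Proof.
move=> x y cx cy; have [h|h] := boolP (eucl x y <= r).
  by near=> N; apply/asboolP; exists x, y.
have [r0|r0] := leP 0 r; last first.
  near=> N; apply/asboolPn => -[x' [y' [_ _ _ _ h']]].
  by move: r0; rewrite ltNge (le_trans (eucl_ge0 x' y')).
move: h; rewrite eucl_le r0/= -ltNge => h.
near=> N; apply/asboolPn => -[x' [y' [cx' cy' ex ey]]].
rewrite eucl_le r0/= => h'.
have := sqdist_close cx cy cx' cy' (fun i => gcell_close i cx cx' (esym ex)) (fun i => gcell_close i cy cy' (esym ey)).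
have : k%:R * 4 * N.+1%:R^-1 < sqdist x y - r ^+ 2.
  by near: N; apply: near_inv; rewrite subr_gt0.
by rewrite mulrA; move: (k%:R * 4 * _) => K; lra.
Unshelve. all: by end_near. Qed.

Lemma near_gcell_neq (R : realType) k (x y : k.-tuple R) : @cube R k x -> @cube R k y ->
  x != y -> \forall N \near \oo, gcell N x != gcell N y.
Proof.
move=> cx cy xy.
have [i xyi] : exists i, tnth x i != tnth y i.
  apply/existsP; apply: contraNT xy; rewrite negb_exists => /forallP h.
  by apply/eqP/eq_from_tnth => i; apply/eqP; have := h i; rewrite negbK.
near=> N; apply/eqP => e; have := gcell_close i cx cy e.
apply/negP; rewrite -ltNge -[X in X < _]mul1r.
near: N; apply: near_inv; by rewrite normr_gt0 subr_eq0.
Unshelve. all: by end_near. Qed.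

Definition lower_within (R : realType) k (r : R) (x y : k.+1.-tuple R) : bool :=
  (mlast y <= mlast x) && (eucl x y <= r).

(** A cell is not related to itself, as a cell containing a single point must not be
    discarded because of that very point. *)
Definition lower_step (R : realType) k (r : R) N : rel (grid k.+1 N) :=
  fun c c' => (c != c') && @outer R k.+1 (@lower_within R k r) N c c'.

Lemma lower_step_approx (R : realType) k (r : R) :
  grid_approx (@lower_step R k r) (fun x y => (x != y) && lower_within r x y).
Proof.
move=> x y cx cy; have [<-|xy] := eqVneq x y; first by near=> N; rewrite /lower_step eqxx.
rewrite /=; have xyN := near_gcell_neq cx cy xy.
have [h|] := boolP (lower_within r x y).
  near=> N; rewrite /lower_step; apply/andP; split; first by near: N.
  by apply/asboolP; exists x, y.
rewrite negb_and => /orP[h|h].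
  rewrite -ltNge in h; near=> N; apply/negbTE/nandP; right.
  apply/asboolPn => -[x' [y' [cx' cy' ex ey /andP[h1 h2]]]].
  have := gcell_close ord_max cx cx' (esym ex).
  have := gcell_close ord_max cy cy' (esym ey).
  have : 2 * N.+1%:R^-1 < mlast y - mlast x.
    by near: N; apply: near_inv; rewrite subr_gt0.
  move: h1; rewrite /mlast !ler_norml; set a := N.+1%:R^-1 => h1 h3 /andP[? ?] /andP[? ?].
  lra.
have := outer_dball_approx r cx cy; rewrite (negbTE h); apply: filterS => N hN.
apply/negbTE/nandP; right; apply/asboolPn => -[x' [y' [cx' cy' ex ey /andP[h1 h2]]]].
by move/asboolPn : hN; apply; exists x', y'.
Unshelve. all: by end_near. Qed.

(** * Counting isolated points of a Poisson process *)

Lemma fatou_bound d (T : measurableType d) (R : realType)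
    (mu : {measure set T -> \bar R}) (f_ : nat -> T -> R) (f : T -> R)
    (b : nat -> R) (B : R) :
  (forall N, measurable_fun setT (f_ N)) -> (forall N w, 0 <= f_ N w) ->
  (forall w, f_ N w @[N --> \oo] --> f w) ->
  (forall N, (\int[mu]_w (f_ N w)%:E <= (b N)%:E)%E) ->
  b N @[N --> \oo] --> B ->
  (\int[mu]_w (f w)%:E <= B%:E)%E.
Proof.
move=> mf f0 fcvg fb bB.
have -> : (fun w => (f w)%:E) = (fun w => limn_einf (fun N => (f_ N w)%:E)).
  apply/funext => w; have /cvg_EFinP/cvg_limn_einf_sup[-> _] // := fcvg w.
apply: (le_trans (fatou mu measurableT _ _)) => [N|N w _|].
- exact/measurable_EFinP.
- by rewrite lee_fin.
have /cvg_EFinP bB' := bB; rewrite -(cvg_lim _ bB')//.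
rewrite limn_einf_lim; apply: lee_lim; [exact: is_cvg_einfs|by apply/cvg_ex; eexists; exact: bB'|].
apply: nearW => N; apply: le_trans (fb N).
by apply: ereal_inf_lbound; exists N => //=.
Qed.

Lemma near_seq (A : eqType) (s : seq A) (Q : nat -> A -> Prop) :
  (forall x, x \in s -> \forall N \near \oo, Q N x) ->
  \forall N \near \oo, forall x, x \in s -> Q N x.
Proof.
elim: s => [_|a s ih h]; first by apply: nearW.
have h1 := h a (mem_head _ _).
have h2 : \forall N \near \oo, forall x, x \in s -> Q N x.
  by apply: ih => x xs; apply: h; rewrite in_cons xs orbT.
near=> N => x; rewrite in_cons => /predU1P[->|xs]; first by near: N.
by move: x xs; near: N.
Unshelve. all: by end_near. Qed.

Section poisson_hit.
Context disp (T : measurableType disp) (R : realType) (P : probability T R).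
Context (k : nat) (n : R) (X : T -> {fset k.-tuple R}).
Hypotheses (hX : is_poisson_process P n X) (n0 : 0 < n).

Definition gset N (p : pred (grid k N)) : set (k.-tuple R) :=
  @cube R k `&` [set x | p (gcell N x)].

(** That a cell is hit is an event about the counts of the process, and it is all that
    the discretization sees of them. *)
Definition hit N (p : pred (grid k N)) (w : T) : bool :=
  has (fun x => p (gcell N x)) (X w).

Lemma hit_count N (p : pred (grid k N)) w :
  hit p w = (0 < count_in X (gset p) w)%N.
Proof.
rewrite /hit /count_in cardfs_gt0; apply/hasP/fset0Pn.
  move=> [x xX px]; exists x; rewrite !inE xX/= inE.
  by split => //; exact: pp_cube hX w x xX.
by move=> [x /imfsetP[y /=]]; rewrite !inE/= => /andP[yX]; rewrite inE => -[_ py] _; exists y.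
Qed.

Lemma hit_preimage N (p : pred (grid k N)) (b : bool) :
  [set w | hit p w = b] = count_in X (gset p) @^-1` [set j | (0 < j)%N = b].
Proof. by apply/seteqP; split => w /=; rewrite hit_count. Qed.

Lemma measurable_gset N (p : pred (grid k N)) : measurable (gset p).
Proof. exact: measurable_gcellP. Qed.

Lemma measurable_hit N (p : pred (grid k N)) : measurable_fun setT (hit p).
Proof.
rewrite (_ : hit p = (fun j => (0 < j)%N) \o count_in X (gset p)); last first.
  by apply/funext => w /=; rewrite hit_count.
by apply: measurableT_comp => //; apply: pp_measurable hX _ _; exact: measurable_gset.
Qed.

Definition gvol N (p : pred (grid k N)) : R := \sum_(c | p c) gmesh R k N.

Lemma prob_nohit N (p : pred (grid k N)) :
  P [set w | hit p w = false] = (expR (- (n * gvol p)))%:E.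
Proof.
rewrite hit_preimage (pp_law hX); last exact: measurable_gset.
rewrite setIAC setIid lebesgue_gcellP /= -/(gvol p).
rewrite (_ : [set j | _] = [set 0%N]); last first.
  by apply/seteqP; split => j /=; case: j.
rewrite /poisson_prob; case: ltP => h.
  rewrite esum_set1; last by rewrite lee_fin poisson_pmf_ge0.
  by rewrite /poisson_pmf h expr0 fact0 invr1 !mul1r.
have -> : n * gvol p = 0.
  apply/eqP; rewrite eq_le h mulr_ge0//; first exact: ltW.
  by apply: sumr_ge0 => c _; rewrite ltW ?gmesh_gt0.
by rewrite oppr0 expR0 diracE mem_set.
Qed.

Lemma prob_hit N (p : pred (grid k N)) :
  P [set w | hit p w = true] = (1 - expR (- (n * gvol p)))%:E.
Proof.
rewrite (_ : [set w | _] = ~` [set w | hit p w = false]); last first.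
  by apply/seteqP; split => w /=; case: (hit p w).
rewrite probability_setC ?prob_nohit ?EFinB//.
by have := measurable_hit p measurableT (Y := [set false]); rewrite setTI; exact.
Qed.

Definition hitlaw N (p : pred (grid k N)) (b : bool) : R :=
  if b then 1 - expR (- (n * gvol p)) else expR (- (n * gvol p)).

Lemma prob_hitE N (p : pred (grid k N)) b : P [set w | hit p w = b] = (hitlaw p b)%:E.
Proof. by case: b; [exact: prob_hit|exact: prob_nohit]. Qed.

Lemma prob_hit_indep N m (p : 'I_m -> pred (grid k N)) (b : 'I_m -> bool) :
  (forall i j c, p i c -> p j c -> i = j) ->
  P [set w | forall i, hit (p i) w = b i] = (\prod_(i < m) hitlaw (p i) (b i))%:E.
Proof.
move=> disj.
have mA i : measurable (gset (p i)) by exact: measurable_gset.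
have tr : trivIset [set: 'I_m] (fun i => gset (p i)).
  by move=> i j _ _ [x [[_ pi] [_ pj]]]; exact: disj pi pj.
have ind : mutually_independent P (fun i => count_in X (gset (p i))) := pp_indep hX mA tr.
have := ind (fun i => [set j : nat | (0 < j)%N = b i]) (fun=> I).
rewrite (_ : \bigcap_i _ = [set w | forall i, hit (p i) w = b i]); last first.
  apply/seteqP; split => w /= h i; have := h i; rewrite /= hit_count; last by [].
  exact.
move=> ->; rewrite -prodEFin; apply: eq_bigr => i _.
by rewrite -hit_preimage prob_hitE.
Qed.

Lemma integral_bool (b : T -> bool) : measurable_fun setT b ->
  (\int[P]_w ((b w)%:R)%:E = P [set w | b w = true])%E.
Proof.
move=> mb; have mB : measurable [set w | b w = true].
  by have := mb measurableT [set true] I; rewrite setTI; exact.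
rewrite [RHS](measure_integral_indic P mB); apply: eq_integral => w _.
rewrite indicE; congr (_%:R%:E); congr nat_of_bool.
by apply/idP/idP; rewrite inE.
Qed.

Section thinned_count.
Variable eN : forall N, rel (grid k N).
Variable e : k.-tuple R -> k.-tuple R -> bool.
Hypothesis approx : grid_approx eN e.
Hypothesis irr : forall N (c : grid k N), eN c c = false.
Hypothesis me : forall x, measurable (@cube R k `&` [set y | e x y]).

Definition gisolated N (c : grid k N) (w : T) : bool :=
  hit (pred1 c) w && ~~ hit (@eN N c) w.

Definition gcount N (w : T) : R := \sum_(c : grid k N) (gisolated c w)%:R.

Definition isolated (x : k.-tuple R) (w : T) : bool :=
  all (fun y => ~~ e x y) (X w).

Definition icount (w : T) : R := \sum_(x <- X w) (isolated x w)%:R.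

Lemma measurable_gisolated N (c : grid k N) : measurable_fun setT (gisolated c).
Proof.
apply: measurable_and; first exact: measurable_hit.
by apply: measurable_neg; exact: measurable_hit.
Qed.

Lemma measurable_gcount N : measurable_fun setT (@gcount N).
Proof.
by apply: measurable_sum => c; apply: measurable_natr_bool; exact: measurable_gisolated.
Qed.

Lemma gvol1 N (c : grid k N) : gvol (pred1 c) = gmesh R k N.
Proof. by rewrite /gvol big_pred1_eq. Qed.

Lemma prob_gisolated N (c : grid k N) :
  P [set w | gisolated c w = true] =
  ((1 - expR (- (n * gmesh R k N))) * expR (- (n * vstep R eN c)))%:E.
Proof.
pose p (i : 'I_2) : pred (grid k N) := nth (xpred0 : pred (grid k N)) [:: (pred1 c : pred (grid k N)); @eN N c] i.
pose b (i : 'I_2) : bool := nth true [:: true; false] i.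
have disj i j c' : p i c' -> p j c' -> i = j.
  rewrite /p; case: i => -[|[|//]] hi; case: j => -[|[|//]] hj /=; try by move=> *; apply: val_inj.
    by move=> /eqP ->; rewrite irr.
  by move=> + /eqP e'; rewrite e' irr.
transitivity ((hitlaw (pred1 c) true * hitlaw (@eN N c) false)%:E); last first.
  by rewrite /hitlaw gvol1.
have := prob_hit_indep b disj; rewrite big_ord_recl big_ord1 /= => <-.
congr (P _); apply/seteqP; split => w /=.
  by move=> /andP[h1 h2]; case=> -[|[|//]] hi; rewrite /b /p /= ?h1// (negbTE h2).
by move=> h; rewrite /gisolated; have := h ord0; have := h ord_max; rewrite /b /p /= => -> ->.
Qed.

Lemma integral_gcount N :
  (\int[P]_w (gcount N w)%:E = (\sum_(c : grid k N)
     (1 - expR (- (n * gmesh R k N))) * expR (- (n * vstep R eN c)))%:E)%E.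
Proof.
under eq_integral do rewrite -sumEFin.
rewrite ge0_integral_sum//.
- rewrite -sumEFin; apply: eq_bigr => c _.
  by rewrite integral_bool ?prob_gisolated//; exact: measurable_gisolated.
- by move=> c; apply/measurable_EFinP/measurable_natr_bool; exact: measurable_gisolated.
Qed.

Definition npts (w : T) : R := (#|` X w|)%:R.

Lemma nptsE w : npts w = \sum_(x <- X w) 1.
Proof. by rewrite big_const_seq count_predT iter_addr_0. Qed.

Lemma gcount_le N w : gcount N w <= npts w.
Proof.
rewrite nptsE (partition_big (fun x => gcell N x) predT)//=.
apply: ler_sum => c _; case: (boolP (gisolated c w)) => [|_]; last first.
  by apply: sumr_ge0.
move=> /andP[/hasP[x xX /eqP xc] _].
rewrite (big_rem x xX)/= xc eqxx lerDl.
by apply: sumr_ge0.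
Qed.

Lemma gcount_ge0 N w : 0 <= gcount N w.
Proof. by apply: sumr_ge0. Qed.

(** A configuration is finite: for a fine mesh its points lie in distinct cells and the
    relation between these cells is the relation between the points. *)
Lemma cvg_gcount w : gcount N w @[N --> \oo] --> icount w.
Proof.
have Xc x : x \in X w -> @cube R k x by exact: pp_cube hX w x.
have inj : \forall N \near \oo, forall x, x \in X w -> forall y, y \in X w ->
    gcell N x = gcell N y -> x = y.
  apply: near_seq => x xX; apply: near_seq => y yX.
  have [->|xy] := eqVneq x y; first by apply: nearW.
  have := near_gcell_neq (Xc _ xX) (Xc _ yX) xy; apply: filterS => N /eqP; tauto.
have ag : \forall N \near \oo, forall x, x \in X w -> forall y, y \in X w ->
    eN (gcell N x) (gcell N y) = e x y.
  apply: near_seq => x xX; apply: near_seq => y yX.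
  exact: approx (Xc _ xX) (Xc _ yX).
apply: cvg_near_cst; near=> N.
have injN : forall x, x \in X w -> forall y, y \in X w -> gcell N x = gcell N y -> x = y.
  by near: N.
have agN : forall x, x \in X w -> forall y, y \in X w -> eN (gcell N x) (gcell N y) = e x y.
  by near: N.
rewrite /icount (partition_big (fun x => gcell N x) predT)//=.
apply: eq_bigr => c _.
have [/hasP[x xX /eqP xc]|nh] := boolP (hit (pred1 c) w); last first.
  rewrite /gisolated (negbTE nh)/= big_seq_cond big_pred0// => x.
  apply/negP => /andP[xX xc]; move/negP : nh; apply.
  by apply/hasP; exists x.
rewrite (big_rem x xX)/= xc eqxx big_seq_cond big_pred0 ?addr0.
  congr (_%:R); congr nat_of_bool; rewrite /gisolated.
  have -> : hit (pred1 c) w by apply/hasP; exists x => //=; rewrite xc.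
  rewrite /= /isolated -all_predC; apply: eq_in_all => y yX /=.
  by rewrite -xc agN.
move=> y; apply/negP => /andP[yr /eqP yc].
have yX := mem_rem yr; have xy : x = y by apply: injN => //; rewrite xc yc.
by move: yr; rewrite -xy mem_rem_uniqF// fset_uniq.
Unshelve. all: by end_near. Qed.

Lemma measurable_icount : measurable_fun setT icount.
Proof.
apply: (measurable_fun_cvg measurable_gcount) => w _; exact: cvg_gcount.
Qed.

Lemma gmesh_rate_le N : 1 - expR (- (n * gmesh R k N)) <= n * gmesh R k N.
Proof. by have := expR_ge1Dx (- (n * gmesh R k N)); lra. Qed.

Lemma integral_gcount_le N : (\int[P]_w (gcount N w)%:E <= n%:E)%E.
Proof.
rewrite integral_gcount lee_fin.
apply: (@le_trans _ _ (\sum_(c : grid k N) n * gmesh R k N)); last first.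
  by rewrite -mulr_sumr gmesh_total mulr1.
apply: ler_sum => c _; rewrite -[leRHS]mulr1; apply: ler_pM => //.
- by rewrite subr_ge0 -expR0 ler_expR oppr_le0 mulr_ge0 ?ltW ?gmesh_gt0.
- exact: gmesh_rate_le.
- by rewrite -[leRHS]expR0 ler_expR oppr_le0 mulr_ge0 ?vstep_ge0// ltW.
Qed.

Lemma integral_icount_le : (\int[P]_w (icount w)%:E <= n%:E)%E.
Proof.
apply: (fatou_bound measurable_gcount gcount_ge0 cvg_gcount integral_gcount_le).
exact: cvg_cst.
Qed.

End thinned_count.

Lemma measurable_npts : measurable_fun setT npts.
Proof.
rewrite (_ : npts = (fun j : nat => j%:R) \o count_in X setT).
  apply: measurableT_comp => //.
  by apply: pp_measurable hX _ _; exact: measurableT.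
apply/funext => w; rewrite /npts /count_in /=; congr (_%:R); congr #|` _|.
by apply/fsetP => x; apply/idP/imfsetP => [xX|[y /= + ->]];
  [exists x => //; rewrite !inE/= xX/= inE|rewrite !inE => /andP[]].
Qed.

Lemma integral_npts_le : (\int[P]_w (npts w)%:E <= n%:E)%E.
Proof.
pose eN N : rel (grid k N) := fun _ _ => false.
pose e (x y : k.-tuple R) := false.
have approx : grid_approx eN e by move=> x y _ _; apply: nearW.
have := @integral_icount_le eN e approx (fun _ _ => erefl).
rewrite (_ : icount e = npts)//; apply/funext => w.
by rewrite nptsE; apply: eq_bigr => x _; rewrite /isolated all_predT.
Qed.

Section thinned_count_limit.
Variable eN : forall N, rel (grid k N).
Variable e : k.-tuple R -> k.-tuple R -> bool.
Hypothesis approx : grid_approx eN e.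
Hypothesis irr : forall N (c : grid k N), eN c c = false.
Hypothesis me : forall x, measurable (@cube R k `&` [set y | e x y]).
Hypothesis k0 : (0 < k)%N.

Let rate N := (1 - expR (- (n * gmesh R k N))) / gmesh R k N.

Let cvg_rate : rate N @[N --> \oo] --> n.
Proof.
have g0 N : 0 < gmesh R k N := gmesh_gt0 R k N.
apply: (@squeeze_cvgr _ _ _ _ (fun N => n / (1 + n * gmesh R k N)) (fun=> n)).
- near=> N; have ng : 0 < n * gmesh R k N by rewrite mulr_gt0.
  apply/andP; split; last first.
    by rewrite /rate ler_pdivrMr// gmesh_rate_le.
  rewrite /rate ler_pdivlMr// mulrAC.
  have h := expR_ge1Dx (n * gmesh R k N).
  rewrite expRN; move: h; set E := expR _ => h.
  have E0 : 0 < E by exact: expR_gt0.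
  have p0 : 0 < 1 + n * gmesh R k N by rewrite addr_gt0.
  rewrite ler_pdivrMr// mulrBl mul1r lerBrDr -lerBrDl addrK.
  by rewrite mulrC ler_pdivrMr// mul1r.
- rewrite -[X in _ --> X](mulr1 n) -[X in _ --> n * X]invr1; apply: cvgM; first exact: cvg_cst.
  apply: cvgV; first exact: oner_neq0.
  rewrite -[X in _ --> X]addr0; apply: cvgD; first exact: cvg_cst.
  by rewrite -(mulr0 n); apply: cvgM; [exact: cvg_cst|exact: cvg_gmesh].
- exact: cvg_cst.
Unshelve. all: by end_near. Qed.

Let Phi (v : R) := expR (- (n * v)).

Let Phi01 v : 0 <= v <= 1 -> 0 <= Phi v <= 1.
Proof.
move=> /andP[v0 _]; rewrite expR_ge0 -[leRHS]expR0 ler_expR oppr_le0.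
by rewrite mulr_ge0// ltW.
Qed.

Let cPhi : continuous Phi.
Proof.
move=> v; apply: continuous_comp; last exact: continuous_expR.
by apply: cvgN; apply: cvgM; [exact: cvg_cst|exact: cvg_id].
Qed.

Let step_sum N := \sum_(c : grid k N) Phi (vstep R eN c) * gmesh R k N.

Definition thinned_mean : R := fine (\int[lam k]_(x in @cube R k) (expR (- (n * vlim e x)))%:E)%E.

Lemma thinned_meanE :
  (\int[lam k]_(x in @cube R k) (expR (- (n * vlim e x)))%:E)%E = thinned_mean%:E.
Proof.
have mc := @measurable_cube R k.
rewrite fineK// ge0_fin_numE; last first.
  by apply: integral_ge0 => x _; rewrite lee_fin expR_ge0.
apply: (@le_lt_trans _ _ (\int[lam k]_(x in @cube R k) (cst 1 x))%E); last first.
  by rewrite integral_cst//= lebesgue_tuple_cube mule1 ltry.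
apply: ge0_le_integral => //.
- apply/measurable_EFinP.
  apply: (measurable_fun_cvg (h := fun N x => Phi (vstep R eN (gcell N x)))).
    by move=> N; exact: (@measurable_gcell_fun R k N (fun c => Phi (vstep R eN c))).
  move=> x cx; apply: continuous_cvg; [exact: cPhi|exact: cvg_vstep].
- move=> x _; rewrite lee_fin.
  by have /andP[] := Phi01 (introT andP (conj (vlim_ge0 e x) (vlim_le1 me x))).
Qed.

Let gmean N := rate N * step_sum N.

Let gmeanE N : (\int[P]_w (gcount eN N w)%:E)%E = (gmean N)%:E.
Proof.
rewrite integral_gcount//; congr EFin; rewrite /gmean /step_sum mulr_sumr.
apply: eq_bigr => c _; rewrite /rate /Phi mulrCA mulrA mulrC.
by rewrite -mulrA divfK ?gt_eqF ?gmesh_gt0.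
Qed.

Let cvg_gmean : gmean N @[N --> \oo] --> n * thinned_mean.
Proof.
apply: cvgM; first exact: cvg_rate.
have := cvg_step_integral approx me cPhi Phi01.
rewrite thinned_meanE => /cvg_EFinP; exact.
Qed.

(** The cells contribute independently of the rest of their neighbourhoods, which gives
    a Riemann sum with rate [(1 - expR (- (n * gmesh))) / gmesh], of limit [n]; the
    discrete counts are dominated by the total number of points. *)
Lemma integral_icount : (\int[P]_w (icount e w)%:E)%E = (n * thinned_mean)%:E.
Proof.
have : (\int[P]_w (gcount eN N w)%:E)%E @[N --> \oo] --> (\int[P]_w (icount e w)%:E)%E.
  apply: (@real_dominated_cvg _ _ _ P setT (fun N => gcount eN N) (icount e) npts) => //.
  - by move=> N; exact: measurable_gcount.
  - exact: measurable_npts.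
  - by move=> w _; exact: cvg_gcount.
  - by move=> N w _; rewrite ger0_norm ?gcount_ge0 ?gcount_le.
  - by rewrite (le_lt_trans integral_npts_le)// ltry.
under eq_fun do rewrite gmeanE.
move=> h; have /cvg_EFinP h' := cvg_gmean.
exact: cvg_unique h h'.
Qed.

(** Cells that do not interact are isolated independently of each other: the two cells
    and their neighbourhoods are then disjoint. *)
Definition interacting N (c c' : grid k N) : bool :=
  [|| c == c', eN c c', eN c' c | [exists c'', eN c c'' && eN c' c'']].

Let pc N (c : grid k N) : R :=
  (1 - expR (- (n * gmesh R k N))) * expR (- (n * vstep R eN c)).

Let expRN01 (v : R) : 0 <= v -> 0 <= expR (- (n * v)) <= 1.
Proof.
move=> v0; rewrite expR_ge0/= -[leRHS]expR0 ler_expR oppr_le0.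
by rewrite mulr_ge0// ltW.
Qed.

Let pc_ge0 N (c : grid k N) : 0 <= pc c.
Proof.
rewrite mulr_ge0 ?expR_ge0// subr_ge0.
by have /andP[] := expRN01 (ltW (gmesh_gt0 R k N)).
Qed.

Let prob_pair N (c c' : grid k N) :
  (P [set w | (gisolated eN c w && gisolated eN c' w) = true] <=
  (pc c * pc c' + (c == c')%:R * (n * gmesh R k N) +
   (interacting c c')%:R * (n * gmesh R k N) ^+ 2)%:E)%E.
Proof.
have g0 := gmesh_gt0 R k N.
have ng0 : 0 <= n * gmesh R k N by rewrite mulr_ge0 ?ltW.
have mZ (d : grid k N) : measurable [set w | gisolated eN d w = true].
  by have := measurable_gisolated eN d measurableT (Y := [set true]) I; rewrite setTI; exact.
have mZZ : measurable [set w | (gisolated eN c w && gisolated eN c' w) = true].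
  rewrite (_ : [set w | _] = [set w | gisolated eN c w = true] `&` [set w | gisolated eN c' w = true]).
    exact: measurableI.
  by apply/seteqP; split => w /=; [move=> /andP[]|move=> [-> ->]].
have mH (p : pred (grid k N)) : measurable [set w | hit p w = true].
  by have := measurable_hit p measurableT (Y := [set true]) I; rewrite setTI; exact.
have q1 : (1 - expR (- (n * gmesh R k N))) <= n * gmesh R k N by exact: gmesh_rate_le.
have q0 : 0 <= (1 - expR (- (n * gmesh R k N))).
  by rewrite subr_ge0; have /andP[] := expRN01 (ltW g0).
have [<-|cc'] := eqVneq c c'.
  rewrite /interacting eqxx /= !mul1r.
  apply: (@le_trans _ _ (P [set w | hit (pred1 c) w = true])).
    apply: le_measure; rewrite ?inE//.
      rewrite (_ : [set w | _] = [set w | gisolated eN c w = true])//.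
      by apply/seteqP; split => w /=; rewrite andbb.
    by move=> w /= /andP[/andP[]].
  rewrite prob_hit gvol1 lee_fin -addrA -[leLHS]add0r lerD ?mulr_ge0//.
  by rewrite -[leLHS]addr0 lerD// sqr_ge0.
rewrite mul0r addr0; have [near|far] := boolP (interacting c c').
  pose p (i : 'I_2) : pred (grid k N) := nth (xpred0 : pred (grid k N))
    [:: (pred1 c : pred (grid k N)); (pred1 c' : pred (grid k N))] i.
  have disj i j d : p i d -> p j d -> i = j.
    rewrite /p; case: i => -[|[|//]] hi; case: j => -[|[|//]] hj /=; try by move=> *; apply: val_inj.
      by move=> /eqP ->; rewrite (negbTE cc').
    by move=> /eqP -> /eqP e'; rewrite e' eqxx in cc'.
  apply: (@le_trans _ _ (P [set w | forall i, hit (p i) w = true])).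
    apply: le_measure; rewrite ?inE//.
      rewrite (_ : [set w | _] = [set w | hit (pred1 c) w = true] `&` [set w | hit (pred1 c') w = true]).
        exact: measurableI.
      apply/seteqP; split => w /= h; first by split; [exact: (h ord0)|exact: (h ord_max)].
      by case=> -[|[|//]] hi; case: h.
    by move=> w /= /andP[/andP[h1 _] /andP[h2 _]]; case=> -[|[|//]] hi.
  rewrite (prob_hit_indep (fun=> true) disj) big_ord_recl big_ord1 /= /hitlaw !gvol1 mul1r.
  rewrite lee_fin -[leLHS]add0r lerD ?mulr_ge0//.
  by rewrite expr2 ler_pM.
rewrite mul0r addr0.
move: far; rewrite /interacting (negbTE cc') /= !negb_or => /and3P[h1 h2].
rewrite negb_exists => /forallP h3.
pose p (i : 'I_4) : pred (grid k N) := nth (xpred0 : pred (grid k N))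
  [:: (pred1 c : pred (grid k N)); @eN N c; (pred1 c' : pred (grid k N)); @eN N c'] i.
pose b (i : 'I_4) : bool := nth true [:: true; false; true; false] i.
have F1 d : pred1 c d -> ~ eN c d by move=> /eqP ->; rewrite irr.
have F2 d : pred1 c d -> ~ pred1 c' d.
  by move=> /eqP -> /eqP e'; rewrite e' eqxx in cc'.
have F3 d : pred1 c d -> ~ eN c' d by move=> /eqP ->; exact/negP.
have F4 d : eN c d -> ~ pred1 c' d by move=> + /eqP e'; rewrite e'; exact/negP.
have F5 d : eN c d -> ~ eN c' d.
  by move=> e1 e2; have := h3 d; rewrite e1 e2.
have F6 d : pred1 c' d -> ~ eN c' d by move=> /eqP ->; rewrite irr.
have disj i j d : p i d -> p j d -> i = j.
  rewrite /p; case: i => -[|[|[|[|//]]]] hi; case: j => -[|[|[|[|//]]]] hj;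
    rewrite [nth _ _ _]/= [X in _ -> X _ -> _]/= => a1 a2; try (by apply: val_inj); exfalso;
  first [exact: F1 a1 a2|exact: F1 a2 a1|exact: F2 a1 a2|exact: F2 a2 a1
        |exact: F3 a1 a2|exact: F3 a2 a1|exact: F4 a1 a2|exact: F4 a2 a1
        |exact: F5 a1 a2|exact: F5 a2 a1|exact: F6 a1 a2|exact: F6 a2 a1].
have := prob_hit_indep b disj.
rewrite !big_ord_recl big_ord0 mulr1 /= /hitlaw !gvol1 => e'.
rewrite (_ : pc c * pc c' = (1 - expR (- (n * gmesh R k N))) *
  (expR (- (n * gvol (@eN N c))) * ((1 - expR (- (n * gmesh R k N))) * expR (- (n * gvol (@eN N c')))))); last first.
  by rewrite /pc /vstep -/(gvol _) -/(gvol _); ring.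
rewrite -e'; apply: le_measure; rewrite ?inE//.
  rewrite (_ : [set w | _] = [set w | (gisolated eN c w && gisolated eN c' w) = true])//.
  apply/seteqP; split => w /= h.
    rewrite /gisolated.
    have a0 := h (@Ordinal 4 0 isT); have a1 := h (@Ordinal 4 1 isT).
    have a2 := h (@Ordinal 4 2 isT); have a3 := h (@Ordinal 4 3 isT).
    by rewrite /b /p /= in a0 a1 a2 a3; rewrite a0 a1 a2 a3.
  move: h => /andP[/andP[a0 a1] /andP[a2 a3]].
  by case=> -[|[|[|[|//]]]] hi; rewrite /b /p /= ?a0 ?a2// ?(negbTE a1)// (negbTE a3).
move=> w /= /andP[/andP[a0 a1] /andP[a2 a3]].
by case=> -[|[|[|[|//]]]] hi; rewrite /b /p /= ?a0 ?a2// ?(negbTE a1)// (negbTE a3).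
Qed.

(** The pairs of non-interacting cells contribute at most the square of the mean, the
    diagonal at most [n], and the pairs of interacting cells are bounded by the
    probability that both are hit. The bound passes to the limit by the lemma of Fatou. *)
Lemma integral_icount_sqr (bN : nat -> R) (B : R) :
  (forall N (c : grid k N), \sum_(c' | interacting c c') gmesh R k N <= bN N) ->
  bN N @[N --> \oo] --> B ->
  (\int[P]_w ((icount e w) ^+ 2)%:E <= ((n * thinned_mean) ^+ 2 + n + n ^+ 2 * B)%:E)%E.
Proof.
move=> hb bB.
apply: (@fatou_bound _ _ _ P (fun N w => gcount eN N w ^+ 2) _ (fun N => gmean N ^+ 2 + n + n ^+ 2 * bN N)).
- by move=> N; apply: measurable_funX; exact: measurable_gcount.
- by move=> N w; exact: sqr_ge0.
- by move=> w; rewrite expr2; under eq_fun do rewrite expr2; apply: cvgM; exact: cvg_gcount.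
- move=> N.
  have gE : gmean N = \sum_(c : grid k N) pc c.
    by have := gmeanE N; rewrite integral_gcount// => -[].
  have -> : (\int[P]_w (gcount eN N w ^+ 2)%:E)%E =
      (\sum_(c : grid k N) \sum_(c' : grid k N)
        P [set w | (gisolated eN c w && gisolated eN c' w) = true])%E.
    transitivity (\int[P]_w (\sum_(c : grid k N) \sum_(c' : grid k N)
        ((gisolated eN c w && gisolated eN c' w)%:R)%:E))%E.
      apply: eq_integral => w _; rewrite expr2 /gcount big_distrl/= -sumEFin.
      apply: eq_bigr => c _; rewrite big_distrr/= -sumEFin.
      by apply: eq_bigr => c' _; rewrite -natrM mulnb.
    have mb (c c' : grid k N) : measurable_fun setT (fun w => gisolated eN c w && gisolated eN c' w).
      by apply: measurable_and; exact: measurable_gisolated.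
    rewrite ge0_integral_sum//.
    - apply: eq_bigr => c _; rewrite ge0_integral_sum//.
      + by apply: eq_bigr => c' _; rewrite integral_bool.
      + by move=> c'; apply/measurable_EFinP/measurable_natr_bool.
    - by move=> c; apply: emeasurable_sum => c'; apply/measurable_EFinP/measurable_natr_bool.
    - by move=> c w _; apply: sume_ge0.
  have step1 : (\sum_(c : grid k N) \sum_(c' : grid k N)
        P [set w | (gisolated eN c w && gisolated eN c' w) = true] <=
     (\sum_(c : grid k N) \sum_(c' : grid k N) (pc c * pc c' + (c == c')%:R * (n * gmesh R k N) +
   (interacting c c')%:R * (n * gmesh R k N) ^+ 2))%:E)%E.
    rewrite -sumEFin; apply: lee_sum => c _; rewrite -sumEFin; apply: lee_sum => c' _.
    exact: prob_pair.
  apply: (le_trans step1); rewrite lee_fin.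
  under eq_bigr do rewrite !big_split/=.
  rewrite !big_split/= lerD// ?lerD//.
  + by rewrite gE expr2 big_distrl/=; apply: ler_sum => c _; rewrite big_distrr.
  + rewrite (eq_bigr (fun=> n * gmesh R k N)).
      by rewrite -mulr_sumr gmesh_total mulr1.
    move=> c _; rewrite (bigD1 c)//= eqxx mul1r big1 ?addr0// => c' /negbTE.
    by rewrite eq_sym => ->; rewrite mul0r.
  + apply: (@le_trans _ _ (\sum_(c : grid k N) n ^+ 2 * gmesh R k N * bN N)).
      apply: ler_sum => c _.
      rewrite (eq_bigr (fun c' => n ^+ 2 * gmesh R k N * ((interacting c c')%:R * gmesh R k N))); last first.
        by move=> c' _; ring.
      have h0 : 0 <= n ^+ 2 * gmesh R k N by rewrite mulr_ge0 ?sqr_ge0// ltW// gmesh_gt0.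
      rewrite -mulr_sumr ler_wpM2l//.
      apply: le_trans (hb N c); rewrite [leRHS]big_mkcond; apply: ler_sum => c' _.
      by case: ifP; rewrite ?mul1r ?mul0r.
    by rewrite -mulr_suml -mulr_sumr gmesh_total mulr1.
- apply: cvgD; last by apply: cvgM; [exact: cvg_cst|].
  apply: cvgD; last exact: cvg_cst.
  by rewrite expr2; under eq_fun do rewrite expr2; apply: cvgM; exact: cvg_gmean.
Qed.
End thinned_count_limit.
End poisson_hit.

(** * Long edges of the minimal directed spanning tree *)

Lemma cvg_exprn (R : realType) (u : nat -> R) (l : R) m :
  u N @[N --> \oo] --> l -> u N ^+ m @[N --> \oo] --> l ^+ m.
Proof.
move=> ul; elim: m => [|m ih].
  by under eq_fun do rewrite expr0; rewrite expr0; exact: cvg_cst.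
by under eq_fun do rewrite exprS; rewrite exprS; exact: cvgM.
Qed.

Lemma exists_argmin (A : eqType) (R : realType) (f : A -> R) (s : seq A) : s != [::] ->
  exists2 y, y \in s & forall z, z \in s -> f y <= f z.
Proof.
elim: s => // a s ih _; have [->|s0] := eqVneq s [::].
  by exists a; rewrite ?mem_head// => z; rewrite inE => /eqP ->.
have [y ys hy] := ih s0; have [h|h] := leP (f a) (f y).
  exists a; first exact: mem_head.
  by move=> z; rewrite in_cons => /predU1P[->//|zs]; rewrite (le_trans h)// hy.
exists y; first by rewrite in_cons ys orbT.
by move=> z; rewrite in_cons => /predU1P[->|zs]; [exact: ltW|exact: hy].
Qed.

Section mdst_path.
Context (R : realType) (k : nat).
Implicit Types (S : {fset k.+1.-tuple R}) (x y : k.+1.-tuple R).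

Definition no_pred_within (r : R) S x : bool :=
  all (fun y => ~~ ((x != y) && lower_within r x y)) S.

Definition mcount (r : R) S : R := \sum_(x <- S) (no_pred_within r S x)%:R.

Lemma in_predecessors S x y :
  (y \in predecessors S x) = [&& y \in S, x != y & mlast y <= mlast x].
Proof.
rewrite /predecessors; apply/imfsetP/and3P => /=.
  move=> [z]; rewrite !inE => /and3P[zS zx h] ->; split => //; first by rewrite eq_sym.
  by move: h; rewrite /preceq_last /mlast !(tnth_nth 0).
move=> [yS xy h]; exists y => //; rewrite !inE yS/= eq_sym xy/=.
by move: h; rewrite /preceq_last /mlast !(tnth_nth 0).
Qed.

(** A point with predecessors is joined to a nearest one, whose distance decides whether
    the half ball is empty. *)
Lemma no_pred_withinE r S x : no_pred_within r S x =
  (predecessors S x == fset0) || (r < mdst_dist S x).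
Proof.
rewrite /mdst_dist; case: eqP => [p0|/eqP p0] /=.
  apply/allP => y yS; apply/negP => /andP[xy /andP[h _]].
  have : y \in predecessors S x by rewrite in_predecessors yS xy.
  by rewrite p0 inE.
have [y0 y0P hy0] : exists2 y, y \in predecessors S x & forall z, z \in predecessors S x -> eucl x y <= eucl x z.
  apply: exists_argmin; apply: contra p0 => /eqP p0.
  by apply/eqP/fsetP => z; rewrite -[LHS]/(z \in (predecessors S x : seq _)) p0 inE.
have [tP ht] : is_nearest (predecessors S x) x (mdst_target S x).
  by apply: (@xgetPex _ x [set y | is_nearest (predecessors S x) x y]); exists y0.
apply/allP/idP => [h|h y yS].
  move: tP; rewrite in_predecessors => /and3P[tS xt tx].
  by have := h _ tS; rewrite xt /lower_within tx /= -ltNge.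
apply/negP => /andP[xy /andP[yx yr]].
have /ht : y \in predecessors S x by rewrite in_predecessors yS xy.
by apply/negP; rewrite -ltNge (le_lt_trans yr).
Qed.

Lemma mdst_dist_ge0 S x : 0 <= mdst_dist S x.
Proof. by rewrite /mdst_dist; case: ifP => // _; exact: eucl_ge0. Qed.

(** The dimension [k.+1] is a convenient upper bound of the diameter [Num.sqrt k.+1] of
    the cube. *)
Lemma mdst_dist_le (K : R) S x : (forall y, y \in S -> @cube R k.+1 y) -> x \in S ->
  k.+1%:R <= K -> mdst_dist S x <= K.
Proof.
move=> cS xS kK; have K1 : 1 <= K by rewrite (le_trans _ kK)// ler1n.
have K0 : 0 <= K by exact: le_trans K1.
rewrite leNgt; apply/negP => h.
have := no_pred_withinE K S x; rewrite h orbT => /allP np.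
have [p0|p0] := eqVneq (predecessors S x) fset0.
  by move: h; rewrite /mdst_dist p0 eqxx ltNge K0.
have /fset0Pn[y] := p0; rewrite in_predecessors => /and3P[yS xy yx].
have := np y yS; rewrite xy /lower_within yx /= => /negP; apply.
apply: (@eucl_le_tnth _ _ _ _ 1) => //; first by rewrite expr1n mulr1; nra.
move=> i; have := cS _ xS i; have := cS _ yS i => /andP[? ?] /andP[? ?].
by rewrite ler_norml; apply/andP; split; lra.
Qed.

Lemma mcount_ge0 r S : 0 <= mcount r S.
Proof. exact: sumr_ge0. Qed.

Lemma no_pred_within_mono r s S x : r <= s -> no_pred_within s S x -> no_pred_within r S x.
Proof. by move=> rs; rewrite !no_pred_withinE => /orP[->//|h]; rewrite (le_lt_trans rs h) orbT. Qed.

Lemma mcount_mono r s S : r <= s -> mcount s S <= mcount r S.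
Proof.
move=> rs; apply: ler_sum => x _; rewrite ler_nat.
by have := @no_pred_within_mono r s S x rs; do 2 case: no_pred_within => //; move=> /(_ isT).
Qed.

(** This identity holds for every configuration. The term in [K] accounts for the points
    without an edge, which are counted at all radii. *)
Lemma mdst_weight_integral (a K : R) S : 0 < a -> (forall y, y \in S -> @cube R k.+1 y) ->
  k.+1%:R <= K ->
  ((mdst_weight a S + K `^ a * mcount K S)%:E =
   \int[leb]_(r in `]0%R, K[) (pkern a r * mcount r S)%:E)%E.
Proof.
move=> a0 cS kK; have K0 : 0 < K by rewrite (lt_le_trans _ kK).
have mI : measurable (`]0%R, K[%classic : set R) by exact: measurable_itv.
pose f x r := (pkern a r * (no_pred_within r S x)%:R)%:E.
have mf x : measurable_fun (`]0, K[%classic : set R) (f x).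
  apply/measurable_EFinP/measurable_funTS; apply: measurable_funM.
    exact: measurable_pkern.
  apply: measurable_natr_bool.
  rewrite (_ : (fun r => _) = (fun r => (predecessors S x == fset0) || (r < mdst_dist S x))).
    by apply: measurable_or => //; exact: measurable_fun_ltr.
  by apply/funext => r; exact: no_pred_withinE.
transitivity (\int[leb]_(r in `]0%R, K[) (\sum_(x <- S) f x r))%E; last first.
  by apply: eq_integral => r _; rewrite sumEFin /mcount mulr_sumr.
rewrite ge0_integral_sum//; last first.
  by move=> x r _; rewrite lee_fin mulr_ge0// pkern_ge0// ltW.
rewrite /mdst_weight /mcount mulr_sumr -big_split/= -sumEFin.
rewrite big_seq [RHS]big_seq; apply: eq_bigr => x xS.
have dK := mdst_dist_le cS xS kK.
have [p0|p0] := boolP (predecessors S x == fset0).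
  transitivity (\int[leb]_(r in `]0%R, K[) (pkern a r)%:E)%E; last first.
    by apply: eq_integral => r _; rewrite /f no_pred_withinE p0 mulr1.
  rewrite integral_pkern// no_pred_withinE p0 /mdst_dist p0 mulr1 powR0 ?gt_eqF//.
  by rewrite add0r.
rewrite no_pred_withinE (negbTE p0)/= ltNge dK mulr0 addr0.
rewrite -integral_pkern_lt ?mdst_dist_ge0//.
rewrite (_ : `]0%R, K[%classic = `]0, +oo[%classic `&` `]0, K[); last first.
  by apply/seteqP; split => r /=; rewrite !in_itv/=; [move=> /andP[-> ->]|case].
rewrite [RHS]integral_mkcondr; apply: eq_integral => r; rewrite inE/= in_itv/= andbT => r0.
rewrite patchE mem_setE in_itv/= r0/= /f no_pred_withinE (negbTE p0)/=.
case: ifPn => //; rewrite -leNgt => Kr.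
by rewrite ltNge (le_trans dK Kr) mulr0.
Qed.
End mdst_path.

Lemma tuple_set1_box (R : realType) k (x : k.-tuple R) :
  [set x] = [set y : k.-tuple R | forall i, [set tnth x i] (tnth y i)].
Proof.
apply/seteqP; split => y /=; first by move=> -> i.
by move=> h; apply: eq_from_tnth => i; rewrite h.
Qed.

Lemma measurable_tuple_set1 (R : realType) k (x : k.-tuple R) : measurable [set x].
Proof.
rewrite tuple_set1_box; apply: (@measurable_box _ _ (fun i => [set tnth x i])) => i.
exact: measurable_set1.
Qed.

Lemma lebesgue_tuple_set1 (R : realType) k (x : k.+1.-tuple R) : lam k.+1 [set x] = 0%E.
Proof.
rewrite tuple_set1_box (@lebesgue_tuple_box _ _ (fun i => [set tnth x i])) => [|i]; last exact: measurable_set1.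
by rewrite big_ord_recl lebesgue_measure_set1 mul0e.
Qed.

Section mdst_relation.
Context (R : realType) (k : nat) (r : R).

Definition lower_rel (x y : k.+1.-tuple R) : bool := (x != y) && lower_within r x y.

Lemma lower_rel_set x : @cube R k.+1 `&` [set y | lower_rel x y] =
  (@cube R k.+1 `&` lowcap x r) `\` [set x].
Proof.
apply/seteqP; split => y /=.
  by move=> [cy /andP[xy /andP[h1 h2]]]; split => //= e; rewrite e eqxx in xy.
move=> [[cy [h1 h2]] xy]; split => //; apply/andP; split; last exact/andP.
by apply/eqP => e; apply: xy.
Qed.

Lemma measurable_lower_rel x : measurable (@cube R k.+1 `&` [set y | lower_rel x y]).
Proof.
rewrite lower_rel_set; apply: measurableD; last exact: measurable_tuple_set1.
by apply: measurableI; [exact: measurable_cube|exact: measurable_lowcap].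
Qed.

Lemma vlim_lower_rel x : vlim lower_rel x = vcap x r.
Proof.
rewrite /vlim /vcap lower_rel_set; congr fine.
have m1 : measurable (@cube R k.+1 `&` lowcap x r).
  by apply: measurableI; [exact: measurable_cube|exact: measurable_lowcap].
have m2 := measurable_tuple_set1 x.
have h : (lam k.+1 (@cube R k.+1 `&` lowcap x r) < +oo)%E by rewrite vcapE ltry.
rewrite measureD//= (_ : lam k.+1 (_ `&` [set x]) = 0%E) ?sube0//.
apply: (subset_measure0 (B := [set x])) => //; last exact: lebesgue_tuple_set1.
exact: measurableI.
Qed.

Lemma lower_step_irr N (c : grid k.+1 N) : @lower_step R k r N c c = false.
Proof. by rewrite /lower_step eqxx. Qed.

Lemma gcell_nonempty N (c : grid k.+1 N) : exists2 x : k.+1.-tuple R, @cube R k.+1 x & gcell N x = c.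
Proof.
apply: contrapT => h; have := lebesgue_gcell R c.
rewrite (_ : _ `&` _ = set0); last first.
  by apply/seteqP; split => // x [cx xc]; apply: h; exists x.
rewrite measure0 => -[] e; have := gmesh_gt0 R k.+1 N; by rewrite -e ltxx.
Qed.

Lemma lower_step_coord N (x y : k.+1.-tuple R) i : @cube R k.+1 x -> @cube R k.+1 y ->
  @lower_step R k r N (gcell N x) (gcell N y) ->
  `|tnth x i - tnth y i| <= r + 2 * N.+1%:R^-1.
Proof.
move=> cx cy /andP[_ /asboolP[x' [y' [cx' cy' ex ey /andP[_ h]]]]].
have := tnth_le_edist i h.
have := gcell_close i cx cx' (esym ex).
have := gcell_close i cy cy' (esym ey).
move: (N.+1%:R^-1) => a; rewrite !ler_norml => /andP[? ?] /andP[? ?] /andP[? ?].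
by apply/andP; split; lra.
Qed.

(** A cell interacting with [c] is at distance at most [2 * r] from it, up to the mesh. *)
Lemma lower_step_interacting N (c : grid k.+1 N) : 0 <= r ->
  \sum_(c' | interacting (@lower_step R k r) c c') gmesh R k.+1 N <=
  (4 * r + 10 * N.+1%:R^-1) ^+ k.+1.
Proof.
move=> r0; set a := N.+1%:R^-1; have a0 : 0 <= a by rewrite invr_ge0.
have [x cx xc] := gcell_nonempty c.
rewrite -lee_fin -lebesgue_gcellP.
(* two cells related to a common one are at distance at most [2 * (r + 2 * a)], and the
   points considered are only known up to [a] *)
set t := 2 * r + 5 * a; have t0 : 0 <= t by rewrite /t; lra.
pose B := [set y : k.+1.-tuple R | forall i, `[tnth x i - t, tnth x i + t]%classic (tnth y i)].
have -> : (4 * r + 10 * a) ^+ k.+1 = (2 * t) ^+ k.+1 by congr (_ ^+ _); rewrite /t; ring.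
have lB : lam k.+1 B = ((2 * t) ^+ k.+1)%:E.
  rewrite (lebesgue_tuple_itv_box (a := fun i => tnth x i - t) (b := fun i => tnth x i + t)).
    rewrite (eq_bigr (fun=> 2 * t)); last by move=> i _; ring.
    by rewrite prodr_const card_ord.
  by move=> i; lra.
rewrite -lB; apply: le_measure; rewrite ?inE.
- exact: measurable_gcellP.
- by apply: (@measurable_box _ _ (fun i => `[tnth x i - t, tnth x i + t]%classic)) => i; exact: measurable_itv.
move=> y [cy hy] i; rewrite /= in_itv/=.
suff : `|tnth x i - tnth y i| <= t.
  by rewrite ler_norml => /andP[? ?]; apply/andP; split; lra.
move: hy; rewrite /= -xc => /or4P[/eqP e|h|h|/existsP[c'' /andP[h1 h2]]].
- by apply: le_trans (gcell_close i cx cy e) _; rewrite -/a /t; lra.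
- by apply: le_trans (lower_step_coord i cx cy h) _; rewrite -/a /t; lra.
- by rewrite distrC; apply: le_trans (lower_step_coord i cy cx h) _; rewrite -/a /t; lra.
have [z cz zc] := gcell_nonempty c''; rewrite -zc in h1 h2.
have := lower_step_coord i cx cz h1; have := lower_step_coord i cy cz h2.
rewrite -/a !ler_norml /t => /andP[? ?] /andP[? ?].
by apply/andP; split; lra.
Qed.

End mdst_relation.

Section mdst_poisson.
Context disp (T : measurableType disp) (R : realType) (P : probability T R).
Context (k : nat) (n : R) (X : T -> {fset k.+1.-tuple R}).
Hypotheses (hX : is_poisson_process P n X) (n0 : 0 < n).

(** The mean of [mcount] divided by the intensity, see [mean_mcount]. *)
Definition cap_mean (r : R) : R :=
  fine (\int[lam k.+1]_(x in @cube R k.+1) (expR (- (n * vcap x r)))%:E)%E.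

Let vlimE r : vlim (@lower_rel R k r) = (vcap (k:=k))^~ r.
Proof. by apply/funext => x; exact: vlim_lower_rel. Qed.

Lemma cap_mean_thinned r : cap_mean r = thinned_mean n (@lower_rel R k r).
Proof. by rewrite /thinned_mean vlimE. Qed.

Lemma mean_mcount r : (\int[P]_w (mcount r (X w))%:E)%E = (n * cap_mean r)%:E.
Proof.
rewrite cap_mean_thinned.
exact: (integral_icount hX n0 (@lower_step_approx R k r) (@lower_step_irr R k r) (@measurable_lower_rel R k r)).
Qed.

(** Interactions take place in a cube of side [4 * r]. *)
Lemma sqr_mcount r : 0 <= r -> (\int[P]_w ((mcount r (X w)) ^+ 2)%:E <=
  ((n * cap_mean r) ^+ 2 + n + n ^+ 2 * (4 * r) ^+ k.+1)%:E)%E.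
Proof.
move=> r0; rewrite cap_mean_thinned.
apply: (integral_icount_sqr hX n0 (@lower_step_approx R k r) (@lower_step_irr R k r)
  (@measurable_lower_rel R k r) isT (bN := fun N => (4 * r + 10 * N.+1%:R^-1) ^+ k.+1)).
  by move=> N c; exact: lower_step_interacting.
apply: cvg_exprn.
rewrite -[X in _ --> X]addr0; apply: cvgD; first exact: cvg_cst.
by rewrite -(mulr0 10); apply: cvgM; [exact: cvg_cst|exact: cvg_harmonic].
Qed.

(** For fixed cells, [lower_step] is monotone in the radius, which makes the discrete
    counts jointly measurable; the count is their limit. *)
Lemma measurable_mcount_joint :
  measurable_fun [set: T * R] (fun p => mcount p.2 (X p.1)).
Proof.
pose h N (p : T * R) := gcount X (@lower_step R k p.2) N p.1.
apply: (measurable_fun_cvg (h := h)) => [N|[w r] _]; last first.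
  exact: (cvg_gcount hX (@lower_step_approx R k r)).
apply: measurable_sum => c; apply: measurable_natr_bool.
rewrite /gisolated; apply: measurable_and.
  by apply: (measurableT_comp (measurable_hit hX _)).
apply: measurable_neg.
rewrite (_ : (fun p : T * R => hit X (lower_step p.2 c) p.1) =
  (fun p : T * R => \big[orb/false]_(c' : grid k.+1 N) (lower_step p.2 c c' && hit X (pred1 c') p.1))); last first.
  apply/funext => -[w r] /=; rewrite big_has; apply/hasP/hasP => -[x].
    move=> xX h1; exists (gcell N x); first by rewrite mem_index_enum.
    by rewrite h1; apply/hasP; exists x => /=.
  by move=> _ /andP[h1 /hasP[y yX /eqP yc]]; exists y => //; rewrite yc.
elim: (index_enum _) => [|c' s ih].
  by rewrite (_ : (fun _ => _) = cst false)//; apply/funext => p; rewrite big_nil.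
rewrite (_ : (fun p : T * R => _) = (fun p : T * R => (lower_step p.2 c c' && hit X (pred1 c') p.1) ||
   \big[orb/false]_(c' <- s) (lower_step p.2 c c' && hit X (pred1 c') p.1))); last first.
  by apply/funext => p; rewrite big_cons.
apply: measurable_or => //; apply: measurable_and; last first.
  by apply: (measurableT_comp (measurable_hit hX _)).
apply: (@measurableT_comp _ _ _ _ _ _ (fun r : R => lower_step r c c')) => //.
apply: (measurable_fun_bool true); rewrite setTI.
apply: is_interval_measurable => r s' h1 h2 t /andP[rt ts]; move: h1.
move=> /andP[cc' /asboolP[x [y [cx cy ex ey /andP[h3 h4]]]]].
apply/andP; split => //; apply/asboolP; exists x, y; split => //.
by apply/andP; split => //; exact: le_trans rt.
Qed.

Lemma measurable_mcount r : measurable_fun setT (fun w => mcount r (X w)).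
Proof. exact: (measurable_icount hX (@lower_step_approx R k r)). Qed.

End mdst_poisson.

(** * Stretching the last coordinate *)

Lemma ge0_integral_cylinder (R : realType) k (U : set (k.-tuple R)) (B : set R)
    (f : k.+1.-tuple R -> \bar R) :
  measurable U -> measurable B ->
  measurable_fun [set: k.+1.-tuple R] f -> (forall x, 0 <= f x)%E ->
  (\int[lam k.+1]_(x in [set x | U (mbelast x) /\ B (mlast x)]) f x =
   \int[lam k]_(u in U) \int[leb]_(h in B) f (mrcons (u, h)))%E.
Proof.
move=> mU mB mf f0.
have mC : measurable [set x : k.+1.-tuple R | U (mbelast x) /\ B (mlast x)].
  apply: measurableI.
    exact: (measurable_preimage (@measurable_mbelast R k)).
  exact: (measurable_preimage (@measurable_mlast R k)).
rewrite integral_mkcond ge0_integral_mrcons; last 2 first.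
- apply/(measurable_restrictT f mC); exact: measurable_funS mf.
- exact: erestrict_ge0.
rewrite [RHS]integral_mkcond; apply: eq_integral => u _; rewrite patchE.
have memE h : (mrcons (u, h) \in [set x | U (mbelast x) /\ B (mlast x)]) = (u \in U) && (h \in B).
  by apply/idP/andP; rewrite !inE/= mbelast_mrcons mlast_mrcons.
case: ifPn => uU.
  rewrite [RHS]integral_mkcond; apply: eq_integral => h _.
  by rewrite !patchE memE uU.
by rewrite integral0_eq// => h _; rewrite patchE memE (negbTE uU).
Qed.

Lemma cube_cylinder (R : realType) k :
  @cube R k.+1 = [set x | @cube R k (mbelast x) /\ `]0, 1[%classic (mlast x)].
Proof.
apply/seteqP; split => x; first by move=> /cube_mrcons[? h]; split => //=; rewrite in_itv.
by move=> [? h]; apply/cube_mrcons; split => //; move: h; rewrite /= in_itv.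
Qed.

Lemma integral_cube_mlast (R : realType) k (g : R -> R) :
  measurable_fun [set: R] g -> (forall h, 0 <= g h) ->
  (\int[lam k.+1]_(x in @cube R k.+1) (g (mlast x))%:E =
   \int[leb]_(h in `]0%R, 1%R[) (g h)%:E)%E.
Proof.
move=> mg g0; rewrite cube_cylinder ge0_integral_cylinder//.
- transitivity (\int[lam k]_(u in @cube R k)
      (cst (\int[leb]_(h in `]0%R, 1%R[) (g h)%:E)%E u))%E.
    by apply: eq_integral => u _; apply: eq_integral => h _; rewrite mlast_mrcons.
  by rewrite integral_cst//= ?lebesgue_tuple_cube ?mule1//; exact: measurable_cube.
- exact: measurable_cube.
- apply/measurable_EFinP; apply: (measurableT_comp mg); exact: measurable_mlast.
- by move=> x; rewrite lee_fin.
Qed.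

(** The image of the cube when its last coordinate is stretched without bound. *)
Definition halfcyl (R : realType) k : set (k.+1.-tuple R) :=
  [set x | @cube R k (mbelast x) /\ `]0, +oo[%classic (mlast x)].

Lemma measurable_halfcyl (R : realType) k : measurable (@halfcyl R k).
Proof.
apply: measurableI.
  by apply: (measurable_preimage (@measurable_mbelast R k)); exact: measurable_cube.
by apply: (measurable_preimage (@measurable_mlast R k)); exact: measurable_itv.
Qed.

Lemma integral_halfcyl_mlast (R : realType) k (g : R -> R) :
  measurable_fun [set: R] g -> (forall h, 0 <= g h) ->
  (\int[lam k.+1]_(x in @halfcyl R k) (g (mlast x))%:E =
   \int[leb]_(h in `]0%R, +oo[) (g h)%:E)%E.
Proof.
move=> mg g0; rewrite /halfcyl ge0_integral_cylinder//.
- transitivity (\int[lam k]_(u in @cube R k)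
      (cst (\int[leb]_(h in `]0%R, +oo[) (g h)%:E)%E u))%E.
    by apply: eq_integral => u _; apply: eq_integral => h _; rewrite mlast_mrcons.
  by rewrite integral_cst//= ?lebesgue_tuple_cube ?mule1//; exact: measurable_cube.
- exact: measurable_cube.
- apply/measurable_EFinP; apply: (measurableT_comp mg); exact: measurable_mlast.
- by move=> x; rewrite lee_fin.
Qed.

Definition squash (R : realType) k (n : R) (y : k.+1.-tuple R) : k.+1.-tuple R :=
  mrcons (mbelast y, mlast y / n).

Lemma measurable_squash (R : realType) k (n : R) :
  measurable_fun [set: k.+1.-tuple R] (@squash R k n).
Proof.
apply: (measurableT_comp (@measurable_mrcons R k)).
apply: measurable_fun_pair; first exact: measurable_mbelast.
by apply: measurable_funM => //; exact: measurable_mlast.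
Qed.

Lemma integral_squash (R : realType) k (n : R) (f : k.+1.-tuple R -> R) : 0 < n ->
  measurable_fun [set: k.+1.-tuple R] f -> (forall x, 0 <= f x) ->
  (n%:E * \int[lam k.+1]_(x in @cube R k.+1) (f x)%:E =
   \int[lam k.+1]_(y in @halfcyl R k) ((mlast y < n)%R%:R * f (squash n y))%:E)%E.
Proof.
move=> n0 mf f0.
have mh := @measurable_halfcyl R k.
have mcu := @measurable_cube R k.
rewrite cube_cylinder ge0_integral_cylinder//; [|exact/measurable_EFinP].
rewrite -ge0_integralZl//=; last 3 first.
- apply: measurable_funTS.
  apply: (@measurable_integral_in _ _ _ _ R leb _ (fun p : k.-tuple R * measurableTypeR R => (f (mrcons p))%:E)) => //.
    by apply/measurable_EFinP; apply: (measurableT_comp mf); exact: measurable_mrcons.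
  by move=> p; rewrite lee_fin.
- by move=> u _; apply: integral_ge0 => h _; rewrite lee_fin.
- by rewrite lee_fin ltW//.
rewrite /halfcyl ge0_integral_cylinder//; last 2 first.
- apply/measurable_EFinP; apply: measurable_funM.
    by apply: measurable_natr_bool; apply: measurable_fun_ltr => //; exact: measurable_mlast.
  by apply: (measurableT_comp mf); exact: measurable_squash.
- by move=> x; rewrite lee_fin mulr_ge0.
apply: eq_integral => u _.
have mu : measurable_fun [set: R] (fun h => f (mrcons (u, h))).
  apply: (measurableT_comp mf).
  apply: (measurableT_comp (@measurable_mrcons R k)); exact: measurable_fun_pair.
pose g (h : R) := ((0 < h < 1)%R%:R * f (mrcons (u, h)))%:E.
have mg : measurable_fun [set: R] g.
  apply/measurable_EFinP; apply: measurable_funM => //.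
  by apply: measurable_natr_bool; apply: measurable_and; exact: measurable_fun_ltr.
have -> : (\int[leb]_(h in `]0%R, 1%R[) (f (mrcons (u, h)))%:E = \int[leb]_h g h)%E.
  rewrite integral_mkcond; apply: eq_integral => h _; rewrite patchE mem_setE /g in_itv/=.
  by case: (0 < h < 1); rewrite ?mul1r ?mul0r.
have n1 : n^-1 != 0 by rewrite invr_neq0// gt_eqF.
have g0 h : (0 <= g h)%E by rewrite lee_fin mulr_ge0.
have := @ge0_integral_affine R 0 n^-1 g n1 mg g0.
rewrite normfV invrK gtr0_norm// => <-.
rewrite [RHS]integral_mkcond; apply: eq_integral => h _.
rewrite patchE mem_setE in_itv/= andbT /g add0r (mulrC n^-1).
have -> : 0 < h / n < 1 = (0 < h) && (h < n).
  by rewrite pmulr_lgt0 ?invr_gt0// ltr_pdivrMr// mul1r.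
case: (ltP 0 h) => h0 /=; last by rewrite mul0r.
by rewrite /squash mbelast_mrcons mlast_mrcons.
Qed.

(** * Points close to the bottom of the cube *)

Lemma fine_integral_bound d (T : measurableType d) (R : realType)
    (mu : {measure set T -> \bar R}) (D : set T) (f g : T -> R) (c : R) :
  measurable D -> measurable_fun D f -> measurable_fun D g ->
  (forall x, D x -> 0 <= f x <= g x) -> (\int[mu]_(x in D) (g x)%:E <= c%:E)%E ->
  (\int[mu]_(x in D) (f x)%:E = (fine (\int[mu]_(x in D) (f x)%:E))%:E)%E /\
  0 <= fine (\int[mu]_(x in D) (f x)%:E)%E <= c.
Proof.
move=> mD mf mg fg gc.
have f0 : (0 <= \int[mu]_(x in D) (f x)%:E)%E.
  by apply: integral_ge0 => x Dx; rewrite lee_fin; case/andP: (fg x Dx).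
have fc : (\int[mu]_(x in D) (f x)%:E <= c%:E)%E.
  apply: le_trans gc; apply: ge0_le_integral => //.
  - by move=> x Dx; rewrite lee_fin; case/andP: (fg x Dx).
  - exact/measurable_EFinP.
  - exact/measurable_EFinP.
  - by move=> x Dx; rewrite lee_fin; case/andP: (fg x Dx).
have fE : (\int[mu]_(x in D) (f x)%:E = (fine (\int[mu]_(x in D) (f x)%:E))%:E)%E.
  by rewrite fineK// ge0_fin_numE// (le_lt_trans fc)// ltry.
by split => //; rewrite -!lee_fin -fE f0.
Qed.

Section means.
Context (R : realType) (k : nat).
Implicit Types (n r K : R).

(** The contribution to the mean count of the points whose height is less than the
    radius; [high_mean] is the one of the other points, up to the factor [n]. *)
Definition low_mean n r : R :=
  n * fine (\int[lam k.+1]_(x in @cube R k.+1)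
    ((mlast x < r)%R%:R * expR (- (n * vcap x r)))%:E)%E.

Definition high_mean n r : R :=
  fine (\int[lam k.+1]_(x in @cube R k.+1)
    ((r <= mlast x)%R%:R * expR (- (n * vcap x r)))%:E)%E.

Lemma measurable_exp_vcap_joint n :
  measurable_fun [set: k.+1.-tuple R * R] (fun p => expR (- (n * vcap p.1 p.2))).
Proof.
apply: measurableT_comp => //; apply: measurable_funN; apply: measurable_funM => //.
exact: measurable_vcap.
Qed.

Lemma measurable_exp_vcap n r :
  measurable_fun [set: k.+1.-tuple R] (fun x => expR (- (n * vcap x r))).
Proof.
apply: (@measurableT_comp _ _ _ _ _ _ (fun p : k.+1.-tuple R * R => expR (- (n * vcap p.1 p.2))) _
  (fun x => (x, r))); first exact: measurable_exp_vcap_joint.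
exact: measurable_fun_pair.
Qed.

Lemma exp_vcap01 n (x : k.+1.-tuple R) r : 0 <= n -> 0 <= expR (- (n * vcap x r)) <= 1.
Proof. by move=> n0; rewrite expR_ge0 -expR0 ler_expR oppr_le0 mulr_ge0// vcap_ge0. Qed.

Lemma measurable_mlast_lt r : measurable_fun [set: k.+1.-tuple R] (fun x => (mlast x < r)%R%:R : R).
Proof. by apply: measurable_natr_bool; apply: measurable_fun_ltr => //; exact: measurable_mlast. Qed.

Lemma measurable_mlast_ge r : measurable_fun [set: k.+1.-tuple R] (fun x => (r <= mlast x)%R%:R : R).
Proof. by apply: measurable_natr_bool; apply: measurable_fun_ler => //; exact: measurable_mlast. Qed.

Lemma cube_fin (f : k.+1.-tuple R -> R) :
  measurable_fun [set: k.+1.-tuple R] f -> (forall x, 0 <= f x <= 1) ->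
  (\int[lam k.+1]_(x in @cube R k.+1) (f x)%:E =
     (fine (\int[lam k.+1]_(x in @cube R k.+1) (f x)%:E))%:E)%E /\
  0 <= fine (\int[lam k.+1]_(x in @cube R k.+1) (f x)%:E)%E <= 1.
Proof.
move=> mf f01; have mc := @measurable_cube R k.+1.
apply: (@fine_integral_bound _ _ _ _ _ f (fun=> 1)) => //.
- exact: measurable_funTS.
- by rewrite integral_cst//= lebesgue_tuple_cube mule1.
Qed.

Lemma low_integrand01 n r x : 0 <= n ->
  0 <= (mlast x < r)%R%:R * expR (- (n * vcap (x : k.+1.-tuple R) r)) <= 1.
Proof.
move=> n0; have /andP[h1 h2] := exp_vcap01 x r n0.
by case: (mlast x < r); rewrite ?mul1r ?mul0r ?lexx ?ler01 ?h1.
Qed.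

Lemma high_integrand01 n r x : 0 <= n ->
  0 <= (r <= mlast x)%R%:R * expR (- (n * vcap (x : k.+1.-tuple R) r)) <= 1.
Proof.
move=> n0; have /andP[h1 h2] := exp_vcap01 x r n0.
by case: (r <= mlast x); rewrite ?mul1r ?mul0r ?lexx ?ler01 ?h1.
Qed.

Lemma measurable_low n r : measurable_fun [set: k.+1.-tuple R]
  (fun x => (mlast x < r)%R%:R * expR (- (n * vcap x r))).
Proof. by apply: measurable_funM; [exact: measurable_mlast_lt|exact: measurable_exp_vcap]. Qed.

Lemma measurable_high n r : measurable_fun [set: k.+1.-tuple R]
  (fun x => (r <= mlast x)%R%:R * expR (- (n * vcap x r))).
Proof. by apply: measurable_funM; [exact: measurable_mlast_ge|exact: measurable_exp_vcap]. Qed.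

Lemma cap_mean_fin n r : 0 <= n ->
  (\int[lam k.+1]_(x in @cube R k.+1) (expR (- (n * vcap x r)))%:E =
  (@cap_mean R k n r)%:E)%E /\ 0 <= @cap_mean R k n r <= 1.
Proof.
move=> n0; apply: cube_fin; first exact: measurable_exp_vcap.
by move=> x; exact: exp_vcap01.
Qed.

Lemma low_high_mean n r : 0 <= n ->
  n * @cap_mean R k n r = low_mean n r + n * high_mean n r.
Proof.
move=> n0; rewrite /low_mean -mulrDr; congr (_ * _).
have [h1 _] := cap_mean_fin r n0.
have [h2 _] := cube_fin (measurable_low n r) (fun x => low_integrand01 r x n0).
have [h3 _] := cube_fin (measurable_high n r) (fun x => high_integrand01 r x n0).
apply: EFin_inj; rewrite -h1 EFinD -h2 -h3 -ge0_integralD//.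
- apply: eq_integral => x _; rewrite -EFinD -mulrDl leNgt.
  by case: (mlast x < r); rewrite /= ?addr0 ?add0r mul1r.
- exact: measurable_cube.
- by apply/measurable_EFinP/measurable_funTS; exact: measurable_low.
- by apply/measurable_EFinP/measurable_funTS; exact: measurable_high.
Qed.

Lemma low_mean_ge0 n r : 0 <= n -> 0 <= low_mean n r.
Proof.
move=> n0; apply: mulr_ge0 => //.
have [_ /andP[//]] := cube_fin (measurable_low n r) (fun x => low_integrand01 r x n0).
Qed.

Lemma high_mean01 n r : 0 <= n -> 0 <= high_mean n r <= 1.
Proof. by move=> n0; have [] := cube_fin (measurable_high n r) (fun x => high_integrand01 r x n0). Qed.

(** For the points counted here the half ball is not cut by the bottom of the cube, so
    that it contains a cube of side proportional to [r]. *)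
Lemma high_mean_bound n r K : 0 <= n -> k.+1%:R <= K -> 0 < r -> r <= K ->
  high_mean n r <= expR (- (n * (r / (2 * K)) ^+ k.+1)).
Proof.
move=> n0 kK r0 rK.
have K0 : 0 < K by exact: lt_le_trans rK.
have K1 : 1 <= K by rewrite (le_trans _ kK)// ler1n.
have a0 : 0 < r / (2 * K) by rewrite divr_gt0// mulr_gt0.
have mc := @measurable_cube R k.+1.
suff [_ /andP[]] : (\int[lam k.+1]_(x in @cube R k.+1) ((r <= mlast x)%R%:R * expR (- (n * vcap x r)))%:E =
   (high_mean n r)%:E)%E /\ 0 <= high_mean n r <= expR (- (n * (r / (2 * K)) ^+ k.+1)) by [].
apply: (@fine_integral_bound _ _ _ _ _ _ (fun=> expR (- (n * (r / (2 * K)) ^+ k.+1)))) => //.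
- by apply: measurable_funTS; exact: measurable_high.
- move=> x cx; have /andP[-> _] := high_integrand01 r x n0 => /=.
  case: (leP r (mlast x)) => rx; last by rewrite mul0r expR_ge0.
  rewrite mul1r ler_expR lerN2 ler_wpM2l//.
  apply: le_trans (vcap_lower cx kK r0 rK); rewrite exprSr; apply: ler_wpM2l; first exact/exprn_ge0/ltW.
  rewrite le_min lexx andbT (le_trans _ rx)// ler_pdivrMr ?mulr_gt0//.
  by rewrite ler_peMr//; [exact: ltW|lra].
- by rewrite integral_cst//= lebesgue_tuple_cube mule1.
Qed.

Lemma low_vcap_lower (x : k.+1.-tuple R) r K : @cube R k.+1 x -> k.+1%:R <= K -> 0 < r -> r <= K ->
  mlast x < r -> (r / (2 * K)) ^+ k * (mlast x / (2 * K)) <= vcap x r.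
Proof.
move=> cx kK r0 rK xr.
have K0 : 0 < K by exact: lt_le_trans rK.
have K1 : 1 <= K by rewrite (le_trans _ kK)// ler1n.
have a0 : 0 < r / (2 * K) by rewrite divr_gt0// mulr_gt0.
have /cube_mrcons[_ /andP[h0 _]] := cx.
apply: le_trans (vcap_lower cx kK r0 rK); apply: ler_wpM2l; first exact/exprn_ge0/ltW.
rewrite le_min ler_pM2r ?invr_gt0 ?mulr_gt0// (ltW xr) andbT.
by rewrite ler_pdivrMr ?mulr_gt0//; nra.
Qed.

(** The volume cut out below [x] grows at least linearly in the height of [x], and the
    exponential integrates to the inverse of the slope, uniformly in [n]. *)
Lemma low_mean_bound n r K : 0 < n -> k.+1%:R <= K -> 0 < r -> r <= K ->
  low_mean n r <= 2 * K / (r / (2 * K)) ^+ k.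
Proof.
move=> n0 kK r0 rK.
have K0 : 0 < K by exact: lt_le_trans rK.
have a0 : 0 < r / (2 * K) by rewrite divr_gt0// mulr_gt0.
have mc := @measurable_cube R k.+1.
set A := _ ^+ k; have A0 : 0 < A by rewrite exprn_gt0.
pose b := n * A / (2 * K); have b0 : 0 < b by rewrite divr_gt0 ?mulr_gt0.
have mg : measurable_fun [set: R] (fun h : R => expR (- (b * h))).
  by apply: measurableT_comp => //; apply: measurable_funN; apply: measurable_funM.
rewrite /low_mean; set I := fine _.
suff [_ /andP[_ h]] : (\int[lam k.+1]_(x in @cube R k.+1) ((mlast x < r)%R%:R * expR (- (n * vcap x r)))%:E =
   I%:E)%E /\ 0 <= I <= b^-1.
  rewrite -ler_pdivlMl//; apply: le_trans h _; rewrite le_eqVlt; apply/orP; left.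
  by apply/eqP; rewrite /b; field; rewrite !gt_eqF.
apply: (@fine_integral_bound _ _ _ _ _ _ (fun x => expR (- (b * mlast x)))) => //.
- by apply: measurable_funTS; exact: measurable_low.
- by apply: measurable_funTS; apply: (measurableT_comp mg); exact: measurable_mlast.
- move=> x cx; have /andP[-> _] := low_integrand01 r x (ltW n0) => /=.
  case: (ltP (mlast x) r) => rx; last by rewrite mul0r expR_ge0.
  rewrite mul1r ler_expR lerN2 /b -mulrA -mulrA ler_pM2l//.
  by rewrite (mulrC (2 * K)^-1); exact: low_vcap_lower.
- rewrite (@integral_cube_mlast R k (fun h => expR (- (b * h)))) => [||h]; [|exact: mg|exact: expR_ge0].
  rewrite -(integral_expRN b0); apply: ge0_subset_integral => //=.
  + by apply/measurable_EFinP; exact: measurable_funTS.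
  + by move=> h /=; rewrite !in_itv/= andbT => /andP[].
Qed.

(** The limit of [low_mean]: the integral of [expR (- (h * vball u r))] over the heights
    [h > 0] is [(vball u r)^-1]. *)
Definition inv_vball_mean r : R :=
  fine (\int[lam k]_(u in @cube R k) ((vball u r)^-1)%:E)%E.

Lemma measurable_vball_at r : measurable_fun [set: k.-tuple R] (fun u => vball u r).
Proof.
apply: (@measurableT_comp _ _ _ _ _ _ (fun p : k.-tuple R * R => vball p.1 p.2) _
  (fun u => (u, r))); first exact: measurable_vball.
exact: measurable_fun_pair.
Qed.

Lemma measurable_inv_vball r : measurable_fun [set: k.-tuple R] (fun u => (vball u r)^-1).
Proof. by apply: measurable_inv_fun; exact: measurable_vball_at. Qed.

Lemma inv_vball_mean_fin r K : k%:R <= K -> 1 <= K -> 0 < r -> r <= K ->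
  (\int[lam k]_(u in @cube R k) ((vball u r)^-1)%:E = (inv_vball_mean r)%:E)%E /\
  0 <= inv_vball_mean r <= ((r / (2 * K)) ^+ k)^-1.
Proof.
move=> kK K1 r0 rK.
have K0 : 0 < K by exact: lt_le_trans rK.
have a0 : 0 < r / (2 * K) by rewrite divr_gt0// mulr_gt0.
have mc := @measurable_cube R k.
apply: (@fine_integral_bound _ _ _ _ _ _ (fun=> ((r / (2 * K)) ^+ k)^-1)) => //.
- by apply: measurable_funTS; exact: measurable_inv_vball.
- move=> u cu; rewrite invr_ge0 vball_ge0/= lef_pV2 ?posrE ?exprn_gt0//.
    exact: vball_lower.
  by apply: lt_le_trans (vball_lower cu kK K1 r0 rK); rewrite exprn_gt0.
- by rewrite integral_cst//= lebesgue_tuple_cube mule1.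
Qed.

Lemma low_mean_squash n r : 0 < n ->
  ((low_mean n r)%:E = \int[lam k.+1]_(y in @halfcyl R k)
    ((mlast y < n)%R%:R * ((mlast (squash n y) < r)%R%:R * expR (- (n * vcap (squash n y) r))))%:E)%E.
Proof.
move=> n0; have [h _] := cube_fin (measurable_low n r) (fun x => low_integrand01 r x (ltW n0)).
by rewrite /low_mean EFinM -h integral_squash//; exact: measurable_low.
Qed.

Lemma mlast_squash n (y : k.+1.-tuple R) : mlast (squash n y) = mlast y / n.
Proof. exact: mlast_mrcons. Qed.

Lemma mbelast_squash n (y : k.+1.-tuple R) : mbelast (squash n y) = mbelast y.
Proof. exact: mbelast_mrcons. Qed.

Lemma cube_squash n (y : k.+1.-tuple R) : 0 < n -> halfcyl y -> mlast y < n -> @cube R k.+1 (squash n y).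
Proof.
move=> n0 [cy]; rewrite /= in_itv/= andbT => y0 yn; rewrite cube_cylinder/= mbelast_squash mlast_squash.
by split => //; rewrite in_itv/= divr_gt0//= ltr_pdivrMr// mul1r.
Qed.

(** At height [h / n] the half ball lies between the cylinders of height [h / n] over
    the balls of radius [r] and [r - h / n], and the volume of a ball is continuous in
    its radius. *)
Lemma cvg_vcap_squash (s : nat -> R) r (y : k.+1.-tuple R) : (forall j, 0 < s j) ->
  s j @[j --> \oo] --> +oo -> 0 < r -> halfcyl y ->
  s j * vcap (squash (s j) y) r @[j --> \oo] --> mlast y * vball (mbelast y) r.
Proof.
move=> s0 soo r0 hy; have [cy] := hy; rewrite /= in_itv/= andbT => y0.
pose dl j := mlast y / s j.
have dl0 : dl j @[j --> \oo] --> 0.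
  rewrite -(mulr0 (mlast y)); apply: cvgM; first exact: cvg_cst.
  by apply/gtr0_cvgV0; [exact: nearW|].
(* the horizontal radius [Num.sqrt (r ^+ 2 - dl j ^+ 2)] is at least [r - dl j] *)
pose lo j := mlast y * (vball (mbelast y) r - ball_vol R k * (r ^+ k - (r - dl j) ^+ k)).
have lo_cvg : lo j @[j --> \oo] --> mlast y * vball (mbelast y) r.
  have -> : mlast y * vball (mbelast y) r =
    mlast y * (vball (mbelast y) r - ball_vol R k * (r ^+ k - (r - 0) ^+ k)).
    by rewrite subr0 subrr mulr0 subr0.
  apply: cvgM; first exact: cvg_cst.
  apply: cvgB; first exact: cvg_cst.
  apply: cvgM; first exact: cvg_cst.
  apply: cvgB; first exact: cvg_cst.
  by apply: cvg_exprn; apply: cvgB => //; exact: cvg_cst.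
apply: (squeeze_cvgr _ lo_cvg (cvg_cst (mlast y * vball (mbelast y) r))).
near=> j.
have dlj : dl j < Num.min 1 r.
  near: j; apply: (cvgr_lt _ dl0); by rewrite lt_min ltr01 r0.
move: dlj; rewrite lt_min => /andP[dl1 dlr].
have hs : mlast (squash (s j) y) = dl j by rewrite mlast_squash.
have dlp : 0 < dl j by rewrite divr_gt0.
have sdl : s j * dl j = mlast y by rewrite /dl mulrC divfK ?gt_eqF.
apply/andP; split; last first.
  rewrite -sdl -mulrA ler_pM2l// -hs -[X in vball X](mbelast_squash (s j) y).
  by apply: vcap_upper; rewrite hs.
rewrite /lo -sdl -mulrA ler_pM2l//.
have hslab : dl j * vball (mbelast y) (Num.sqrt (r ^+ 2 - dl j ^+ 2)) <= vcap (squash (s j) y) r.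
  have := @vcap_slab R k (squash (s j) y) r (dl j).
  by rewrite hs mbelast_squash; apply; rewrite ?dlp ?dl1//; exact: ltW.
apply: le_trans hslab; rewrite ler_pM2l//.
have rd0 : 0 < r - dl j by rewrite subr_gt0.
have h1 := @vball_lipschitz R k (mbelast y) (r - dl j) r rd0.
have h2 : vball (mbelast y) (r - dl j) <= vball (mbelast y) (Num.sqrt (r ^+ 2 - dl j ^+ 2)).
  apply: vball_mono; rewrite -[X in X <= _](ger0_norm (ltW rd0)) -sqrtr_sqr ler_wsqrtr//; nra.
have h3 : r - dl j <= r by rewrite gerBl ltW.
by move: (h1 h3) h2; lra.
Unshelve. all: by end_near. Qed.

(** In the stretched coordinates the integrand converges by [cvg_vcap_squash] and is
    dominated by an exponential in the height. *)
Lemma cvg_low_mean (s : nat -> R) r K : (forall j, 0 < s j) ->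
  s j @[j --> \oo] --> +oo -> k.+1%:R <= K -> 0 < r -> r <= K ->
  low_mean (s j) r @[j --> \oo] --> inv_vball_mean r.
Proof.
move=> s0 soo kK r0 rK.
have K0 : 0 < K by exact: lt_le_trans rK.
have K1 : 1 <= K by rewrite (le_trans _ kK)// ler1n.
have kK' : k%:R <= K by rewrite (le_trans _ kK)// ler_nat.
have a0 : 0 < r / (2 * K) by rewrite divr_gt0// mulr_gt0.
set A := (r / (2 * K)) ^+ k; have A0 : 0 < A by rewrite exprn_gt0.
pose b := A / (2 * K); have b0 : 0 < b by rewrite divr_gt0 ?mulr_gt0.
have mh := @measurable_halfcyl R k.
have mexp c : measurable_fun [set: R] (fun h : R => expR (- (c * h))).
  by apply: measurableT_comp => //; apply: measurable_funN; apply: measurable_funM.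
have limE : (\int[lam k.+1]_(y in @halfcyl R k) (expR (- (mlast y * vball (mbelast y) r)))%:E =
   (inv_vball_mean r)%:E)%E.
  have [<- _] := inv_vball_mean_fin kK' K1 r0 rK.
  rewrite /halfcyl ge0_integral_cylinder//.
  - apply: eq_integral => u; rewrite inE => cu.
    have v0 : 0 < vball u r by apply: lt_le_trans (vball_lower cu kK' K1 r0 rK).
    rewrite -integral_expRN//; apply: eq_integral => h _.
    by rewrite mlast_mrcons mbelast_mrcons mulrC.
  - exact: measurable_cube.
  - apply/measurable_EFinP; apply: measurableT_comp => //; apply: measurable_funN.
    apply: measurable_funM; first exact: measurable_mlast.
    by apply: (measurableT_comp (measurable_vball_at r)); exact: measurable_mbelast.
apply/cvg_EFinP; rewrite -limE.
under eq_cvg do rewrite low_mean_squash//.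
apply: (@real_dominated_cvg _ _ _ _ _ _ _ (fun y => expR (- (b * mlast y)))) => //.
- move=> j; apply: measurable_funTS; apply: measurable_funM.
    exact: measurable_mlast_lt.
  by apply: (measurableT_comp (measurable_low (s j) r)); exact: measurable_squash.
- by apply: measurable_funTS; apply: (measurableT_comp (mexp b)); exact: measurable_mlast.
- move=> y hy; have := cvg_vcap_squash s0 soo r0 hy => hc.
  have : expR (- (s j * vcap (squash (s j) y) r)) @[j --> \oo] --> expR (- (mlast y * vball (mbelast y) r)).
    by apply: continuous_cvg; [exact: continuous_expR|exact: cvgN].
  apply: cvg_trans; apply: near_eq_cvg; near=> j.
  have [_] := hy; rewrite /= in_itv/= andbT => y0.
  have h1 : mlast y < s j by near: j; exact: cvgry_gt.
  have h2 : mlast y / r < s j by near: j; exact: cvgry_gt.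
  rewrite ltr_pdivrMr// in h2.
  have -> : mlast (squash (s j) y) < r by rewrite mlast_squash ltr_pdivrMr// mulrC.
  by rewrite h1 !mul1r.
- move=> j y hy; rewrite ger0_norm; last by rewrite !mulr_ge0// expR_ge0.
  case: (ltP (mlast y) (s j)) => ys; last by rewrite mul0r expR_ge0.
  case: (ltP (mlast (squash (s j) y)) r) => yr; last by rewrite mul0r mulr0 expR_ge0.
  rewrite !mul1r ler_expR lerN2.
  have h := low_vcap_lower (cube_squash (s0 j) hy ys) kK r0 rK yr.
  rewrite -(ler_pM2l (s0 j)) in h; apply: le_trans h; rewrite mlast_squash /b -/A.
  rewrite le_eqVlt; apply/orP; left; apply/eqP; field.
  by rewrite !gt_eqF.
- rewrite (@integral_halfcyl_mlast R k (fun h => expR (- (b * h)))) => [||h]; [|exact: mexp|exact: expR_ge0].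
  by rewrite integral_expRN// ltry.
Unshelve. all: by end_near. Qed.

End means.

(** * Passage to the limit in the mean *)

Lemma Gamma2 (R : realType) : Gamma (1 + 1) = 1 :> R.
Proof.
have := @integral_pkern_exp R 1 1 1 ltr01 ltr01 ltr01.
rewrite powR1 mul1r divr1.
have -> : (\int[leb]_(r in `]0%R, +oo[) (@pkern R 1 r * expR (- (1 * r `^ 1)))%:E =
           \int[leb]_(r in `]0%R, +oo[) (expR (- (1 * r)))%:E)%E.
  apply: eq_integral => r; rewrite inE/= in_itv/= andbT => r0.
  by rewrite /pkern subrr powRr0 !mul1r powRr1// ltW.
by rewrite integral_expRN// invr1 => -[].
Qed.

Lemma cvg_powR_neg (R : realType) (s : nat -> R) (c : R) : (forall j, 0 < s j) ->
  s j @[j --> \oo] --> +oo -> 0 < c -> s j `^ (- c) @[j --> \oo] --> 0.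
Proof.
move=> s0 soo c0; apply/cvgr0Pnorm_lt => e e0; near=> j.
have h : e `^ (- c^-1) < s j by near: j; exact: cvgry_gt.
rewrite ger0_norm ?powR_ge0// powRN invf_plt ?posrE ?powR_gt0//.
have -> : e^-1 = (e `^ (- c^-1)) `^ c.
  by rewrite -powRrM mulNr mulVf ?gt_eqF// powR_inv1// ltW.
by rewrite gt0_ltr_powR ?nnegrE ?powR_ge0// ltW.
Unshelve. all: by end_near. Qed.

Lemma measurable_fine_integral (R : realType) k (f : k.-tuple R * R -> R) :
  measurable_fun [set: k.-tuple R * R] f -> (forall p, 0 <= f p) ->
  measurable_fun [set: R] (fun r => fine (\int[lam k]_(x in @cube R k) (f (x, r))%:E)%E).
Proof.
move=> mf f0; apply: (@measurableT_comp _ _ _ _ _ _ (@fine R)).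
  exact: fine_measurable.
apply: (@measurable_integral_in _ _ _ _ R (lam k) _ (fun p : R * k.-tuple R => (f (p.2, p.1))%:E)).
- exact: measurable_cube.
- apply/measurable_EFinP; apply: (measurableT_comp mf).
  by apply: measurable_fun_pair; [exact: measurable_snd|exact: measurable_fst].
- by move=> p; rewrite lee_fin.
Qed.

Section means_measurable.
Context (R : realType) (k : nat).

Lemma measurable_cap_mean (n : R) : measurable_fun [set: R] (@cap_mean R k n).
Proof.
apply: (@measurable_fine_integral R k.+1 (fun p => expR (- (n * vcap p.1 p.2)))).
  exact: measurable_exp_vcap_joint.
by move=> p; exact: expR_ge0.
Qed.

Lemma measurable_low_mean (n : R) : measurable_fun [set: R] (@low_mean R k n).
Proof.
apply: measurable_funM => //.
apply: (@measurable_fine_integral R k.+1 (fun p => (mlast p.1 < p.2)%R%:R * expR (- (n * vcap p.1 p.2)))).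
  apply: measurable_funM; last exact: measurable_exp_vcap_joint.
  apply: measurable_natr_bool; apply: measurable_fun_ltr => //.
  by apply: (measurableT_comp (@measurable_mlast R k)).
by move=> p; rewrite mulr_ge0// expR_ge0.
Qed.

Lemma measurable_high_mean (n : R) : measurable_fun [set: R] (@high_mean R k n).
Proof.
apply: (@measurable_fine_integral R k.+1 (fun p => (p.2 <= mlast p.1)%R%:R * expR (- (n * vcap p.1 p.2)))).
  apply: measurable_funM; last exact: measurable_exp_vcap_joint.
  apply: measurable_natr_bool; apply: measurable_fun_ler => //.
  by apply: (measurableT_comp (@measurable_mlast R k)).
by move=> p; rewrite mulr_ge0// expR_ge0.
Qed.

Lemma measurable_inv_vball_mean : measurable_fun [set: R] (@inv_vball_mean R k).
Proof.
apply: (@measurable_fine_integral R k (fun p => (vball p.1 p.2)^-1)).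
  by apply: measurable_inv_fun; exact: measurable_vball.
by move=> p; rewrite invr_ge0 vball_ge0.
Qed.

End means_measurable.

Section boundary.
Context (R : realType) (k : nat).
Implicit Types (a K : R).

Lemma pkern_divX a (r : R) : k%:R < a -> 0 < r ->
  pkern a r / r ^+ k = a / (a - k%:R) * pkern (a - k%:R) r.
Proof.
move=> ka r0; have ak : a - k%:R != 0 by rewrite subr_eq0 gt_eqF.
rewrite /pkern mulrA divfK// -mulrA -powR_mulrn ?ltW// -powRB ?(gt_eqF r0) ?implybT//.
by congr (_ * _ `^ _); ring.
Qed.

(** The bound of [low_mean_bound] against the kernel of exponent [a] is a multiple of
    the kernel of exponent [a - k]. *)
Lemma pkern_low_bound a K (r : R) : k%:R < a -> 0 < r -> 0 < K ->
  pkern a r * (2 * K / (r / (2 * K)) ^+ k) =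
  (2 * K) ^+ k.+1 * (a / (a - k%:R)) * pkern (a - k%:R) r.
Proof.
move=> ka r0 K0; rewrite -[RHS]mulrA -pkern_divX// expr_div_n invf_div exprS; field.
by rewrite expf_neq0// gt_eqF.
Qed.

Lemma integral_pkern_low_bound a K : k%:R < a -> 0 < K ->
  (\int[leb]_(r in `]0%R, K[) (pkern a r * (2 * K / (r / (2 * K)) ^+ k))%:E < +oo)%E.
Proof.
move=> ka K0; have mI : measurable (`]0, K[%classic : set R) by exact: measurable_itv.
have a0 : 0 < a by apply: le_lt_trans ka.
have ak : 0 < a - k%:R by rewrite subr_gt0.
have -> : (\int[leb]_(r in `]0%R, K[) (pkern a r * (2 * K / (r / (2 * K)) ^+ k))%:E =
  \int[leb]_(r in `]0%R, K[) (((2 * K) ^+ k.+1 * (a / (a - k%:R)))%:E * (pkern (a - k%:R) r)%:E))%E.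
  apply: eq_integral => r; rewrite inE/= in_itv/= => /andP[r0 _].
  by rewrite pkern_low_bound// EFinM.
rewrite ge0_integralZl//=.
- by rewrite integral_pkern// -EFinM ltry.
- by apply/measurable_EFinP/measurable_funTS; exact: measurable_pkern.
- by move=> r _; rewrite lee_fin pkern_ge0// ltW.
- by rewrite lee_fin mulr_ge0// ?divr_ge0 ?exprn_ge0 ?mulr_ge0 ?ltW.
Qed.

(** The domination by [low_mean_bound] is integrable near [0] exactly because [a > k]. *)
Lemma cvg_integral_low (s : nat -> R) a K : (forall j, 0 < s j) ->
  s j @[j --> \oo] --> +oo -> k.+1%:R <= K -> k%:R < a ->
  (\int[leb]_(r in `]0%R, K[) (pkern a r * @low_mean R k (s j) r)%:E @[j --> \oo] -->
   \int[leb]_(r in `]0%R, K[) (pkern a r * @inv_vball_mean R k r)%:E)%E.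
Proof.
move=> s0 soo kK ka.
have K0 : 0 < K by rewrite (lt_le_trans _ kK).
have a0 : 0 < a by apply: le_lt_trans ka.
apply: (@real_dominated_cvg _ _ R leb _ (fun j r => pkern a r * @low_mean R k (s j) r)
    (fun r => pkern a r * @inv_vball_mean R k r) (fun r => pkern a r * (2 * K / (r / (2 * K)) ^+ k))).
- exact: measurable_itv.
- move=> j; apply: measurable_funTS; apply: measurable_funM; first exact: measurable_pkern.
  exact: measurable_low_mean.
- apply: (@eq_measurable_fun _ _ _ _ _ (fun r => (2 * K) ^+ k.+1 * (a / (a - k%:R)) * pkern (a - k%:R) r)).
    by move=> r; rewrite inE/= in_itv/= => /andP[r0 _]; rewrite pkern_low_bound.
  by apply: measurable_funTS; apply: measurable_funM => //; exact: measurable_pkern.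
- move=> r; rewrite /= in_itv/= => /andP[r0 rK].
  apply: cvgM; first exact: cvg_cst.
  by apply: (cvg_low_mean s0 soo kK) => //; exact: ltW.
- move=> j r; rewrite /= in_itv/= => /andP[r0 rK].
  have p0 : 0 <= pkern a r by rewrite pkern_ge0// ltW.
  rewrite ger0_norm; last by rewrite mulr_ge0// low_mean_ge0// ltW.
  by rewrite ler_wpM2l// low_mean_bound// ltW.
- exact: integral_pkern_low_bound.
Qed.

Lemma integral_inv_vball_fin a K : k%:R <= K -> 1 <= K -> k%:R < a ->
  (\int[leb]_(r in `]0%R, K[) (pkern a r * @inv_vball_mean R k r)%:E < +oo)%E.
Proof.
move=> kK K1 ka.
have K0 : 0 < K by rewrite (lt_le_trans _ K1).
have a0 : 0 < a by apply: le_lt_trans ka.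
apply: le_lt_trans (integral_pkern_low_bound ka K0); apply: ge0_le_integral => //.
- move=> r; rewrite /= in_itv/= => /andP[r0 rK]; rewrite lee_fin mulr_ge0 ?pkern_ge0 ?(ltW a0)//.
  by have [_ /andP[]] := inv_vball_mean_fin kK K1 r0 (ltW rK).
- apply/measurable_EFinP/measurable_funTS; apply: measurable_funM; first exact: measurable_pkern.
  exact: measurable_inv_vball_mean.
- apply/measurable_EFinP.
  apply: (@eq_measurable_fun _ _ _ _ _ (fun r => (2 * K) ^+ k.+1 * (a / (a - k%:R)) * pkern (a - k%:R) r)).
    by move=> r; rewrite inE/= in_itv/= => /andP[r0 _]; rewrite pkern_low_bound.
  by apply: measurable_funTS; apply: measurable_funM => //; exact: measurable_pkern.
- move=> r; rewrite /= in_itv/= => /andP[r0 rK]; rewrite lee_fin ler_wpM2l ?pkern_ge0 ?(ltW a0)//.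
  have [_ /andP[_ h]] := inv_vball_mean_fin kK K1 r0 (ltW rK).
  apply: le_trans h _; rewrite ler_peMl//; last by lra.
  by rewrite invr_ge0 exprn_ge0// divr_ge0 ?mulr_ge0 ?ltW.
Qed.

End boundary.

Section bulk.
Context (R : realType) (k : nat).

(** The scale at which a ball contains a bounded number of points on average. *)
Definition rscale (n : R) : R := n `^ (- k.+1%:R^-1).

Lemma rscale_gt0 n : 0 < n -> 0 < rscale n.
Proof. by move=> n0; rewrite powR_gt0. Qed.

Lemma rscale_exp n : 0 < n -> n * rscale n ^+ k.+1 = 1.
Proof.
move=> n0; rewrite -powR_mulrn ?powR_ge0// /rscale -powRrM mulNr mulVf// powR_inv1 ?ltW//.
by rewrite divff// gt_eqF.
Qed.

Lemma rscale_expX n (r : R) : 0 < n -> n * (rscale n * r) ^+ k.+1 = r ^+ k.+1.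
Proof. by move=> n0; rewrite exprMn mulrA rscale_exp// mul1r. Qed.

Lemma rscale_powR n a : 0 < n -> rscale n `^ a = n `^ (- (a / k.+1%:R)).
Proof. by move=> n0; rewrite /rscale -powRrM mulNr mulrC. Qed.

Lemma rscale_powR1 n a : 0 < n -> n * rscale n `^ a = n `^ (1 - a / k.+1%:R).
Proof.
move=> n0; rewrite rscale_powR// powRD ?(gt_eqF n0) ?implybT//.
by rewrite powRr1// ltW.
Qed.

Lemma cvg_rscale (s : nat -> R) : (forall j, 0 < s j) ->
  s j @[j --> \oo] --> +oo -> rscale (s j) @[j --> \oo] --> 0.
Proof. by move=> s0 soo; apply: cvg_powR_neg => //; rewrite invr_gt0. Qed.

Lemma pkern_scale a c (r : R) : 0 < c -> 0 < r -> c * pkern a (c * r) = c `^ a * pkern a r.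
Proof.
move=> c0 r0; have e : c `^ a = c * c `^ (a - 1).
  rewrite -[X in _ = X * _](powRr1 (ltW c0)) -powRD ?(gt_eqF c0) ?implybT//.
  by rewrite addrC subrK.
by rewrite /pkern powRM ?(ltW c0) ?(ltW r0)// e; ring.
Qed.

Lemma integral_pkern_scale a c K (g : R -> R) : 0 < a -> 0 < c ->
  measurable_fun [set: R] g -> (forall r, 0 <= g r) ->
  (\int[leb]_(r in `]0%R, K[) (pkern a r * g r)%:E =
   (c `^ a)%:E * \int[leb]_(r in `]0%R, +oo[) (pkern a r * ((c * r < K)%R%:R * g (c * r)))%:E)%E.
Proof.
move=> a0 c0 mg g0; have cc0 : c != 0 by rewrite gt_eqF.
pose f (r : R) := ((0 < r < K)%R%:R * `|pkern a r * g r|)%:E.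
have mf : measurable_fun [set: R] f.
  apply/measurable_EFinP; apply: measurable_funM.
    by apply: measurable_natr_bool; apply: measurable_and; exact: measurable_fun_ltr.
  apply: measurableT_comp => //.
  by apply: measurable_funM => //; exact: measurable_pkern.
have f0 r : (0 <= f r)%E by rewrite lee_fin mulr_ge0.
have -> : (\int[leb]_(r in `]0%R, K[) (pkern a r * g r)%:E = \int[leb]_r f r)%E.
  rewrite integral_mkcond; apply: eq_integral => r _; rewrite patchE mem_setE /f in_itv/=.
  case: ifPn => h; last by rewrite mul0r.
  by rewrite mul1r ger0_norm// mulr_ge0// pkern_ge0 ?ltW//; case/andP: h.
have := @ge0_integral_affine R 0 c f cc0 mf f0.
rewrite gtr0_norm// => /(congr1 (fun z => c%:E * z)%E); rewrite muleA -EFinM divff// mul1e => <-.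
rewrite -!ge0_integralZl//=; last 4 first.
- by move=> r _; rewrite lee_fin mulr_ge0 ?pkern_ge0 ?(ltW a0)// mulr_ge0.
- by rewrite lee_fin powR_ge0.
- by apply: (measurableT_comp mf); apply: measurable_funD => //; exact: measurable_funM.
- by rewrite lee_fin ltW.
- rewrite [RHS]integral_mkcond; apply: eq_integral => r _.
  rewrite patchE mem_setE /f in_itv/= andbT add0r pmulr_rgt0//.
  case: ltP => r0 /=; last by rewrite mul0r mule0.
  rewrite -!EFinM; congr EFin.
  case: ltP => _; last by rewrite !mul0r !mulr0.
  rewrite !mul1r ger0_norm; last by rewrite mulr_ge0// pkern_ge0// ltW.
  by rewrite mulrA pkern_scale// -mulrA.
apply/measurable_EFinP/measurable_funTS; apply: measurable_funM; first exact: measurable_pkern.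
apply: measurable_funM.
  by apply: measurable_natr_bool; apply: measurable_fun_ltr => //; apply: measurable_funM.
by apply: (measurableT_comp mg); exact: measurable_funM.
Qed.

(** The probability that a half ball around a point far from the boundary is empty, at
    the scale [rscale n]. *)
Definition void_limit (r : R) : R := expR (- (ball_vol R k.+1 / 2 * r ^+ k.+1)).

(** The rescaled radius tends to [0], so that [vcap_inner] eventually applies and makes
    the sequence constant. *)
Lemma cvg_vcap_scaled (s : nat -> R) (r : R) (x : k.+1.-tuple R) : (forall j, 0 < s j) ->
  s j @[j --> \oo] --> +oo -> 0 < r -> @cube R k.+1 x ->
  expR (- (s j * vcap x (rscale (s j) * r))) @[j --> \oo] --> void_limit r.
Proof.
move=> s0 soo r0 cx; have [e e0 he] := vcap_inner cx.
apply: (@cvg_trans _ ((cst (void_limit r) : nat -> R) @ \oo)); last exact: cvg_cst.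
apply: near_eq_cvg; near=> j.
rewrite he; first by rewrite /void_limit/= mulrCA rscale_expX.
rewrite mulr_gt0 ?rscale_gt0//= -ltr_pdivlMr//.
near: j; apply: (cvgr_lt _ (cvg_rscale s0 soo)); by rewrite divr_gt0.
Unshelve. all: by end_near. Qed.

Lemma cvg_cap_mean_scaled (s : nat -> R) (r : R) : (forall j, 0 < s j) ->
  s j @[j --> \oo] --> +oo -> 0 < r ->
  @cap_mean R k (s j) (rscale (s j) * r) @[j --> \oo] --> void_limit r.
Proof.
move=> s0 soo r0; apply/cvg_EFinP.
have -> : (void_limit r)%:E = (\int[lam k.+1]_(x in @cube R k.+1) (void_limit r)%:E)%E.
  by rewrite integral_cst//= ?lebesgue_tuple_cube ?mule1//; exact: measurable_cube.
under eq_cvg do rewrite -(proj1 (cap_mean_fin k _ (ltW (s0 _)))).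
apply: cube_bounded_cvg.
- by move=> j; apply: measurable_funTS; exact: measurable_exp_vcap.
- by move=> x cx; exact: cvg_vcap_scaled.
- move=> j x _; rewrite ger0_norm ?expR_ge0//.
  by case/andP: (exp_vcap01 x (rscale (s j) * r) (ltW (s0 j))).
Qed.

Lemma cvg_high_mean_scaled (s : nat -> R) (r : R) : (forall j, 0 < s j) ->
  s j @[j --> \oo] --> +oo -> 0 < r ->
  @high_mean R k (s j) (rscale (s j) * r) @[j --> \oo] --> void_limit r.
Proof.
move=> s0 soo r0; apply/cvg_EFinP.
have -> : (void_limit r)%:E = (\int[lam k.+1]_(x in @cube R k.+1) (void_limit r)%:E)%E.
  by rewrite integral_cst//= ?lebesgue_tuple_cube ?mule1//; exact: measurable_cube.
under eq_cvg do rewrite -(proj1 (cube_fin (measurable_high _ _) (fun x => high_integrand01 _ x (ltW (s0 _))))).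
apply: cube_bounded_cvg.
- by move=> j; apply: measurable_funTS; exact: measurable_high.
- move=> x cx; have := cvg_vcap_scaled s0 soo r0 cx.
  have /cube_mrcons[_ /andP[h0 _]] := cx.
  apply: cvg_trans; apply: near_eq_cvg; near=> j.
  suff -> : rscale (s j) * r <= mlast x by rewrite mul1r.
  rewrite -ler_pdivlMr//; near: j; apply: (cvgr_le _ (cvg_rscale s0 soo)); by rewrite divr_gt0.
- move=> j x _; have /andP[h1 h2] := high_integrand01 (rscale (s j) * r) x (ltW (s0 j)).
  by rewrite ger0_norm.
Unshelve. all: by end_near. Qed.

Lemma integral_void_limit a : 0 < a ->
  (\int[leb]_(r in `]0%R, +oo[) (pkern a r * void_limit r)%:E =
   ((ball_vol R k.+1 / 2) `^ (- (a / k.+1%:R)) * Gamma (1 + a / k.+1%:R))%:E)%E.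
Proof.
move=> a0; have v0 : 0 < ball_vol R k.+1 / 2 by rewrite divr_gt0 ?ball_vol_gt0.
rewrite -(integral_pkern_exp a0 v0 (ltr0Sn R k)).
apply: eq_integral => r; rewrite inE/= in_itv/= andbT => r0.
by rewrite /void_limit powR_mulrn// ltW.
Qed.

(** The domination comes from [high_mean_bound], which does not depend on [n] at the
    scale [rscale n]. *)
Lemma cvg_integral_high (s : nat -> R) a K : (forall j, 0 < s j) ->
  s j @[j --> \oo] --> +oo -> k.+1%:R <= K -> 0 < a ->
  (\int[leb]_(r in `]0%R, +oo[) (pkern a r * ((rscale (s j) * r < K)%R%:R *
      @high_mean R k (s j) (rscale (s j) * r)))%:E @[j --> \oo] -->
   \int[leb]_(r in `]0%R, +oo[) (pkern a r * void_limit r)%:E)%E.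
Proof.
move=> s0 soo kK a0.
have K0 : 0 < K by rewrite (lt_le_trans _ kK).
have b0 : 0 < ((2 * K)^-1) ^+ k.+1 by rewrite exprn_gt0// invr_gt0 mulr_gt0.
pose g (r : R) := pkern a r * expR (- (((2 * K)^-1) ^+ k.+1 * r `^ k.+1%:R)).
apply: (@real_dominated_cvg _ _ R leb _ (fun j r => pkern a r * ((rscale (s j) * r < K)%R%:R *
      @high_mean R k (s j) (rscale (s j) * r))) (fun r => pkern a r * void_limit r) g).
- exact: measurable_itv.
- move=> j; apply: measurable_funTS; apply: measurable_funM; first exact: measurable_pkern.
  apply: measurable_funM.
    by apply: measurable_natr_bool; apply: measurable_fun_ltr => //; exact: measurable_funM.
  by apply: (measurableT_comp (@measurable_high_mean R k (s j))); exact: measurable_funM.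
- apply: measurable_funTS; apply: measurable_funM; first exact: measurable_pkern.
  apply: measurableT_comp => //; apply: measurable_funN; apply: measurable_funM => //.
- move=> r; rewrite /= in_itv/= andbT => r0; apply: cvgM; first exact: cvg_cst.
  have := cvg_high_mean_scaled s0 soo r0.
  apply: cvg_trans; apply: near_eq_cvg; near=> j.
  suff -> : rscale (s j) * r < K by rewrite mul1r.
  rewrite -ltr_pdivlMr//; near: j; apply: (cvgr_lt _ (cvg_rscale s0 soo)); by rewrite divr_gt0.
- move=> j r; rewrite /= in_itv/= andbT => r0.
  have p0 : 0 <= pkern a r by rewrite pkern_ge0// ltW.
  have /andP[h0 _] := high_mean01 k (rscale (s j) * r) (ltW (s0 j)).
  rewrite ger0_norm; last by rewrite mulr_ge0// mulr_ge0.
  rewrite /g; apply: ler_wpM2l => //.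
  case: ltP => rK; last by rewrite mul0r expR_ge0.
  rewrite mul1r; apply: (le_trans (high_mean_bound (ltW (s0 j)) kK _ (ltW rK))).
    by rewrite mulr_gt0// rscale_gt0.
  by rewrite (powR_mulrn _ (ltW r0)) exprMn mulrA rscale_expX// mulrC lexx.
- by rewrite integral_pkern_exp// ltry.
Unshelve. all: by end_near. Qed.

End bulk.

(** * Convergence of the expected weight *)

Lemma cvge_pinfty_pos (R : realType) (f : R -> \bar R) (l : \bar R) :
  (forall s : nat -> R, (forall j, 0 < s j) -> s j @[j --> \oo] --> +oo ->
    f (s j) @[j --> \oo] --> l) -> f x @[x --> +oo] --> l.
Proof.
move=> h; apply/cvge_pinftyP => s soo.
have soo' : Num.max (s j) 1 @[j --> \oo] --> +oo.
  apply/cvgryPge => A; near=> j; rewrite le_max; apply/orP; left; near: j.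
  exact: cvgry_ge.
have s0' j : 0 < Num.max (s j) 1 by rewrite lt_max ltr01 orbT.
apply: cvg_trans (h _ s0' soo'); apply: near_eq_cvg; near=> j.
congr f; apply/max_l; near: j; exact: cvgry_ge.
Unshelve. all: by end_near. Qed.

Section expected_weight.
Context disp (T : measurableType disp) (R : realType) (P : probability T R).
Context (k : nat) (n : R) (X : T -> {fset k.+1.-tuple R}).
Hypotheses (hX : is_poisson_process P n X) (n0 : 0 < n).
Context (a K : R).
Hypotheses (a0 : 0 < a) (kK : k.+1%:R <= K).

Let K0 : 0 < K. Proof. by rewrite (lt_le_trans _ kK). Qed.

Let mI : measurable (`]0, K[%classic : set R). Proof. exact: measurable_itv. Qed.

Lemma measurable_pkern_mcount :
  measurable_fun [set: T * R] (fun p => (pkern a p.2 * mcount p.2 (X p.1))%:E).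
Proof.
apply/measurable_EFinP; apply: measurable_funM.
  by apply: (measurableT_comp (@measurable_pkern R a)); exact: measurable_snd.
exact: (measurable_mcount_joint hX).
Qed.

Lemma pkern_mcount_ge0 (p : T * R) : (0 <= (pkern a p.2 * mcount p.2 (X p.1))%:E)%E.
Proof. by rewrite lee_fin mulr_ge0 ?mcount_ge0// pkern_ge0// ltW. Qed.

Lemma measurable_mdst_weight : measurable_fun [set: T] (fun w => mdst_weight a (X w)).
Proof.
rewrite (_ : (fun w => _) = (fun w => fine (\int[leb]_(r in `]0%R, K[) (pkern a r * mcount r (X w))%:E)%E
   - K `^ a * mcount K (X w))); last first.
  apply/funext => w; rewrite -mdst_weight_integral//=; first by rewrite addrK.
  exact: (pp_cube hX).
apply: measurable_funB; last by apply: measurable_funM => //; exact: (measurable_mcount hX).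
apply: (measurableT_comp (fine_measurable measurableT)).
apply: (@measurable_integral_in _ _ _ _ R leb _ (fun p : T * measurableTypeR R => (pkern a p.2 * mcount p.2 (X p.1))%:E)) => //.
- exact: measurable_pkern_mcount.
- exact: pkern_mcount_ge0.
Qed.

Lemma mdst_weight_ge0 S : 0 <= @mdst_weight R k.+1 a S.
Proof. by apply: sumr_ge0 => x _; exact: powR_ge0. Qed.

(** Expectation of [mdst_weight_integral], by Tonelli. *)
Lemma expected_mdst_weight :
  (\int[P]_w (mdst_weight a (X w))%:E + (K `^ a * (n * @cap_mean R k n K))%:E =
   \int[leb]_(r in `]0%R, K[) (pkern a r * (n * @cap_mean R k n r))%:E)%E.
Proof.
rewrite [X in (_ + X = _)%E](_ : _ = \int[P]_w (K `^ a * mcount K (X w))%:E)%E; last first.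
  rewrite EFinM -(mean_mcount hX n0) -ge0_integralZl//=.
  - by apply/measurable_EFinP; exact: (measurable_mcount hX).
  - by move=> w _; rewrite lee_fin mcount_ge0.
  - by rewrite lee_fin powR_ge0.
rewrite -ge0_integralD//=; last 4 first.
- by move=> w _; rewrite lee_fin mdst_weight_ge0.
- by apply/measurable_EFinP; exact: measurable_mdst_weight.
- by move=> w _; rewrite lee_fin mulr_ge0 ?mcount_ge0// powR_ge0.
- by apply/measurable_EFinP; apply: measurable_funM => //; exact: (measurable_mcount hX).
transitivity (\int[P]_w \int[leb]_(r in `]0%R, K[) (pkern a r * mcount r (X w))%:E)%E.
  apply: eq_integral => w _; rewrite -EFinD; apply: mdst_weight_integral => //.
  exact: (pp_cube hX).
rewrite (@tonelli_in _ _ _ _ R P leb _ _ measurableT mI (fun p => (pkern a p.2 * mcount p.2 (X p.1))%:E)); last 2 first.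
- exact: measurable_pkern_mcount.
- exact: pkern_mcount_ge0.
apply: eq_integral => r _ /=.
rewrite EFinM -(mean_mcount hX n0) -ge0_integralZl//=.
- by apply/measurable_EFinP; exact: (measurable_mcount hX).
- by move=> w _; rewrite lee_fin mcount_ge0.
- by rewrite lee_fin pkern_ge0// ltW.
Qed.

End expected_weight.

Section expected_limit.
Context (R : realType) (k : nat).
Implicit Types (n a K : R).

(** The radius is rescaled in the second integral only: the points near the bottom of
    the cube have edges of order [1]. *)
Lemma integral_cap_split n a K : 0 < n -> 0 < a -> 0 < K ->
  (\int[leb]_(r in `]0%R, K[) (pkern a r * (n * @cap_mean R k n r))%:E =
   \int[leb]_(r in `]0%R, K[) (pkern a r * @low_mean R k n r)%:E +
   (n `^ (1 - a / k.+1%:R))%:E *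
   \int[leb]_(r in `]0%R, +oo[) (pkern a r * ((rscale k n * r < K)%R%:R *
      @high_mean R k n (rscale k n * r)))%:E)%E.
Proof.
move=> n0 a0 K0; have mI : measurable (`]0, K[%classic : set R) by exact: measurable_itv.
have hh r : 0 <= high_mean k n r by case/andP: (high_mean01 k r (ltW n0)).
rewrite -(rscale_powR1 k a n0) EFinM -muleA -integral_pkern_scale ?rscale_gt0//; last first.
  exact: measurable_high_mean.
have mh : measurable_fun [set: R] (fun r => pkern a r * high_mean k n r).
  by apply: measurable_funM; [exact: measurable_pkern|exact: measurable_high_mean].
rewrite -ge0_integralZl//=; last 3 first.
- by apply/measurable_EFinP; exact: measurable_funTS.
- by move=> r _; rewrite lee_fin mulr_ge0// pkern_ge0// ltW.
- by rewrite lee_fin ltW.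
rewrite -ge0_integralD//=; last 4 first.
- by move=> r _; rewrite lee_fin mulr_ge0 ?low_mean_ge0 ?(ltW n0)// pkern_ge0// ltW.
- apply/measurable_EFinP; apply: measurable_funTS; apply: measurable_funM; first exact: measurable_pkern.
  exact: measurable_low_mean.
- by move=> r _; rewrite lee_fin mulr_ge0 ?(ltW n0)// mulr_ge0// pkern_ge0// ltW.
- apply/measurable_EFinP; apply: measurable_funTS; exact: measurable_funM.
by apply: eq_integral => r _; rewrite -EFinM -EFinD low_high_mean ?(ltW n0)//; congr EFin; ring.
Qed.

(** At a radius at least the diameter only the lowest point counts, and the process is
    empty with vanishing probability. *)
Lemma cvg_cap_mean_diam (s : nat -> R) K : (forall j, 0 < s j) ->
  s j @[j --> \oo] --> +oo -> k.+1%:R <= K ->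
  s j * @cap_mean R k (s j) K @[j --> \oo] --> (1 : R).
Proof.
move=> s0 soo kK; have K0 : 0 < K by rewrite (lt_le_trans _ kK).
have K1 : 1 <= K by rewrite (le_trans _ kK)// ler1n.
have kK' : k%:R <= K by rewrite (le_trans _ kK)// ler_nat.
have -> : (1 : R) = @inv_vball_mean R k K.
  have [h _] := inv_vball_mean_fin kK' K1 K0 (lexx K); apply: EFin_inj; rewrite -h.
  transitivity (\int[lam k]_(u in @cube R k) 1)%E.
    by rewrite integral_cst//= ?lebesgue_tuple_cube ?mule1//; exact: measurable_cube.
  by apply: eq_integral => u; rewrite inE => cu; rewrite vball_full// invr1.
have h0 j : high_mean k (s j) K = 0.
  rewrite /high_mean integral0_eq// => x /cube_mrcons[_ /andP[_ x1]].
  by rewrite leNgt (lt_le_trans x1 K1) mul0r.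
rewrite (_ : (fun j => _) = (fun j => low_mean k (s j) K)); last first.
  by apply/funext => j; rewrite low_high_mean ?(ltW (s0 j))// h0 mulr0 addr0.
exact: (cvg_low_mean s0 soo kK).
Qed.

(** The limiting mean weight of the on-line nearest-neighbour graph, see
    [ong_limit_mean]. It does not depend on [K] beyond the diameter of the cube, where
    [inv_vball_mean] equals [1]. *)
Definition ong_mean a K : R :=
  fine (\int[leb]_(r in `]0%R, K[) (pkern a r * @inv_vball_mean R k r)%:E)%E - K `^ a.

(** The power [n `^ (1 - a / k.+1%:R)] multiplying the second part tends to [0] if [a >
    k.+1] and is [1] if [a = k.+1]. *)
Lemma cvg_integral_cap (s : nat -> R) a K : (forall j, 0 < s j) ->
  s j @[j --> \oo] --> +oo -> k.+1%:R <= K -> k.+1%:R <= a ->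
  (\int[leb]_(r in `]0%R, K[) (pkern a r * (s j * @cap_mean R k (s j) r))%:E @[j --> \oo] -->
   (ong_mean a K + K `^ a + (if a == k.+1%:R then 2 * (ball_vol R k.+1)^-1 else 0))%:E)%E.
Proof.
move=> s0 soo kK ka.
have K0 : 0 < K by rewrite (lt_le_trans _ kK).
have K1 : 1 <= K by rewrite (le_trans _ kK)// ler1n.
have kK' : k%:R <= K by rewrite (le_trans _ kK)// ler_nat.
have a0 : 0 < a by rewrite (lt_le_trans _ ka).
have ka' : k%:R < a by rewrite (lt_le_trans _ ka)// ltr_nat.
set c := if _ then _ else _.
have -> : ((ong_mean a K + K `^ a + c)%:E =
  \int[leb]_(r in `]0%R, K[) (pkern a r * @inv_vball_mean R k r)%:E + c%:E)%E.
  rewrite /ong_mean subrK EFinD fineK//.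
  rewrite ge0_fin_numE ?(integral_inv_vball_fin kK' K1 ka')//.
  apply: integral_ge0 => r /=; rewrite in_itv/= => /andP[r0 rK].
  rewrite lee_fin mulr_ge0 ?pkern_ge0 ?(ltW a0)//.
  by have [_ /andP[]] := inv_vball_mean_fin kK' K1 r0 (ltW rK).
under eq_cvg do rewrite (integral_cap_split (s0 _) a0 K0).
apply: cvgeD; [by rewrite fin_num_adde_defl|exact: cvg_integral_low|].
have hc := cvg_integral_high s0 soo kK a0.
rewrite integral_void_limit// in hc.
rewrite /c; case: eqP => [ad|/eqP ad].
  rewrite ad divff// in hc *; rewrite powR_inv1 ?divr_ge0 ?(ltW (ball_vol_gt0 _ _))// Gamma2 mulr1 invf_div in hc.
  apply: cvg_trans hc; apply: near_eq_cvg; near=> j.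
  by rewrite subrr powRr0 mul1e.
have ad' : 0 < a / k.+1%:R - 1.
  by rewrite subr_gt0 ltr_pdivlMr// mul1r lt_neqAle eq_sym ad.
have h0 := cvg_powR_neg s0 soo ad'; rewrite opprB in h0.
have -> : (0%R%:E = 0%R%:E * ((ball_vol R k.+1 / 2) `^ (- (a / k.+1%:R)) * Gamma (1 + a / k.+1%:R))%:E :> \bar R)%E.
  by rewrite mul0e.
by apply: cvgeM => //; apply/cvg_EFinP.
Unshelve. all: by end_near. Qed.

Lemma expected_mdst_limit a disp (T : measurableType disp) (P : probability T R)
    (X : R -> T -> {fset k.+1.-tuple R}) :
  (forall n, 0 < n -> is_poisson_process P n (X n)) -> k.+1%:R <= a ->
  ('E_P[fun w => mdst_weight a (X n w)])%E @[n --> +oo] -->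
   (ong_mean a k.+1%:R + (if a == k.+1%:R then 2 * (ball_vol R k.+1)^-1 else 0))%:E.
Proof.
move=> hX ka; apply: cvge_pinfty_pos => s s0 soo.
have a0 : 0 < a by rewrite (lt_le_trans _ ka).
have h1 := cvg_integral_cap s0 soo (lexx _) ka.
have h2 : (((k.+1%:R : R) `^ a * (s j * @cap_mean R k (s j) k.+1%:R))%:E @[j --> \oo] --> ((k.+1%:R : R) `^ a)%:E)%E.
  apply/cvg_EFinP; rewrite -[X in _ --> X]mulr1; apply: cvgM; first exact: cvg_cst.
  exact: cvg_cap_mean_diam.
have -> : (ong_mean a k.+1%:R + (if a == k.+1%:R then 2 * (ball_vol R k.+1)^-1 else 0))%:E =
  ((ong_mean a k.+1%:R + k.+1%:R `^ a + (if a == k.+1%:R then 2 * (ball_vol R k.+1)^-1 else 0))%:E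
    - (k.+1%:R `^ a)%:E)%E.
  set c := if _ then _ else _.
  by rewrite -EFinB; congr EFin; rewrite [X in _ = X - _]addrAC addrK.
apply: cvg_trans (cvgeB _ h1 h2); last by rewrite fin_num_adde_defl.
apply: near_eq_cvg; near=> j.
rewrite -(expected_mdst_weight (hX _ (s0 j)) (s0 j) a0 (lexx _)) addeK//.
by rewrite expectation.unlock.
Unshelve. all: by end_near. Qed.

End expected_limit.

(** * Convergence in mean of the rescaled weight *)

Lemma le_integral_dist d (T : measurableType d) (R : realType)
    (mu : {measure set T -> \bar R}) (D : set T) (f g : T -> R) (x y : R) :
  measurable D -> measurable_fun D f -> measurable_fun D g ->
  (forall t, D t -> 0 <= f t) -> (forall t, D t -> 0 <= g t) ->
  (\int[mu]_(t in D) (f t)%:E = x%:E)%E -> (\int[mu]_(t in D) (g t)%:E = y%:E)%E ->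
  (`|x - y|%:E <= \int[mu]_(t in D) `|f t - g t|%:E)%E.
Proof.
move: f g x y; have half (f g : T -> R) x y : measurable D -> measurable_fun D f -> measurable_fun D g ->
    (forall t, D t -> 0 <= f t) -> (forall t, D t -> 0 <= g t) ->
    (\int[mu]_(t in D) (f t)%:E = x%:E)%E -> (\int[mu]_(t in D) (g t)%:E = y%:E)%E ->
    ((x - y)%:E <= \int[mu]_(t in D) `|f t - g t|%:E)%E.
  move=> mD mf mg f0 g0 fx gy.
  have mfg : measurable_fun D (fun t => `|f t - g t|).
    by apply: measurableT_comp => //; exact: measurable_funB.
  rewrite EFinB leeBlDr// -fx -gy -ge0_integralD//=; last 2 first.
  - exact/measurable_EFinP.
  - exact/measurable_EFinP.
  apply: ge0_le_integral => //.
  - exact/measurable_EFinP.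
  - by apply/measurable_EFinP; exact: measurable_funD.
  - by move=> t Dt; rewrite -EFinD lee_fin; have := ler_norm (f t - g t); lra.
move=> f g x y mD mf mg f0 g0 fx gy.
have [xy|xy] := leP y x; first by rewrite ger0_norm ?subr_ge0//; exact: half.
rewrite ltr0_norm ?subr_lt0// opprB.
under eq_integral do rewrite distrC.
exact: half.
Qed.

(** The hypothesis bounds the second moment of [Z - m]; it is spelled out with the
    moments of [Z] because only an upper bound of the second one is at hand. *)
Lemma L1_le_L2 d (T : measurableType d) (R : realType) (P : probability T R)
    (Z : T -> R) (z z2 m b : R) : measurable_fun setT Z -> (forall w, 0 <= Z w) -> 0 <= m ->
  (\int[P]_w (Z w)%:E = z%:E)%E -> (\int[P]_w (Z w ^+ 2)%:E <= z2%:E)%E -> 0 < b ->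
  z2 - 2 * m * z + m ^+ 2 <= b ->
  (\int[P]_w `|Z w - m|%:E <= (Num.sqrt b)%:E)%E.
Proof.
move=> mZ Z0 m0 Zz Zz2 b0 hb.
have mD2 : measurable_fun setT (fun w => (Z w - m) ^+ 2).
  by apply: measurable_funX; exact: measurable_funB.
have hD2 : (\int[P]_w ((Z w - m) ^+ 2)%:E <= b%:E)%E.
  have e : (\int[P]_w ((Z w - m) ^+ 2)%:E + (2 * m * z)%:E <= (z2 + m ^+ 2)%:E)%E.
    rewrite EFinM -Zz -ge0_integralZl//=; last 3 first.
    - exact/measurable_EFinP.
    - by move=> w _; rewrite lee_fin.
    - by rewrite lee_fin mulr_ge0.
    rewrite -ge0_integralD//=; last 4 first.
    - by move=> w _; rewrite lee_fin sqr_ge0.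
    - exact/measurable_EFinP.
    - by move=> w _; rewrite lee_fin mulr_ge0// mulr_ge0.
    - by apply/measurable_EFinP; exact: measurable_funM.
    have -> : (\int[P]_w (((Z w - m) ^+ 2)%:E + (2 * m)%:E * (Z w)%:E) =
      \int[P]_w ((Z w ^+ 2)%:E + (m ^+ 2)%:E))%E.
      by apply: eq_integral => w _; rewrite -!EFinM -!EFinD; congr EFin; ring.
    rewrite ge0_integralD//=; last 3 first.
    - by move=> w _; rewrite lee_fin sqr_ge0.
    - by apply/measurable_EFinP; exact: measurable_funX.
    - by move=> w _; rewrite lee_fin sqr_ge0.
    rewrite integral_cst//= probability_setT mule1 EFinD.
    exact: leeD2r.
  rewrite -leeBrDr// -EFinB in e; apply: le_trans e _; rewrite lee_fin.
  by move: hb; lra.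
have s0 : 0 < Num.sqrt b by rewrite sqrtr_gt0.
set t := Num.sqrt b in s0 *.
have tb : t * t = b by rewrite -expr2 sqr_sqrtr// ltW.
(* [y <= t / 2 + y ^+ 2 / (2 * t)], with the [t] that balances both terms *)
apply: (@le_trans _ _ (\int[P]_w ((t / 2)%:E + ((2 * t)^-1)%:E * ((Z w - m) ^+ 2)%:E))%E).
  apply: ge0_le_integral => //.
  - apply/measurable_EFinP; apply: measurableT_comp => //; exact: measurable_funB.
  - apply/measurable_EFinP; apply: measurable_funD => //; exact: measurable_funM.
  - move=> w _; rewrite -EFinM -EFinD lee_fin -(real_normK (num_real (Z w - m))).
    set y := `|_|; have -> : t / 2 + (2 * t)^-1 * y ^+ 2 = (t * t + y ^+ 2) / (2 * t).
      by field; rewrite gt_eqF.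
    by rewrite ler_pdivlMr ?mulr_gt0//; have := sqr_ge0 (y - t); lra.
rewrite ge0_integralD//=; last 3 first.
- by move=> w _; rewrite lee_fin divr_ge0// ltW.
- by move=> w _; rewrite lee_fin mulr_ge0 ?sqr_ge0// invr_ge0 mulr_ge0// ltW.
- by apply/measurable_EFinP; exact: measurable_funM.
rewrite integral_cst//= probability_setT mule1.
rewrite ge0_integralZl//=; last 3 first.
- exact/measurable_EFinP.
- by move=> w _; rewrite lee_fin sqr_ge0.
- by rewrite lee_fin invr_ge0 mulr_ge0// ltW.
apply: (@le_trans _ _ ((t / 2)%:E + ((2 * t)^-1)%:E * b%:E)%E).
  apply: leeD2l; apply: lee_wpmul2l => //.
  by rewrite lee_fin invr_ge0 mulr_ge0// ltW.
rewrite -EFinM -EFinD lee_fin -tb le_eqVlt; apply/orP; left; apply/eqP; field.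
by rewrite gt_eqF.
Qed.

Section excess.
Context disp (T : measurableType disp) (R : realType) (P : probability T R).
Context (k : nat) (n : R) (X : T -> {fset k.+1.-tuple R}).
Hypotheses (hX : is_poisson_process P n X) (n0 : 0 < n).
Context (a K : R).
Hypotheses (a0 : 0 < a) (kK : k.+1%:R <= K).

Let K0 : 0 < K. Proof. by rewrite (lt_le_trans _ kK). Qed.
Let mI : measurable (`]0, K[%classic : set R). Proof. exact: measurable_itv. Qed.

(** For rescaled radii smaller than [K], the proportion of the points that start an edge
    longer than the radius. *)
Definition excess (w : T) (r : R) : R :=
  (rscale k n * r < K)%R%:R * (`|mcount (rscale k n * r) (X w) - mcount K (X w)| / n).

Lemma excess_ge0 w r : 0 <= excess w r.
Proof. by rewrite mulr_ge0// divr_ge0// ltW. Qed.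

Lemma measurable_excess_joint : measurable_fun [set: T * R] (fun p => excess p.1 p.2).
Proof.
apply: measurable_funM.
  apply: measurable_natr_bool; apply: measurable_fun_ltr => //.
  by apply: measurable_funM => //; exact: measurable_snd.
apply: measurable_funM => //; apply: measurableT_comp => //; apply: measurable_funB.
  apply: (@measurableT_comp _ _ _ _ _ _ (fun p : T * R => mcount p.2 (X p.1)) _
    (fun p : T * R => (p.1, rscale k n * p.2))); first exact: (measurable_mcount_joint hX).
  apply: measurable_fun_pair; first exact: measurable_fst.
  by apply: measurable_funM => //; exact: measurable_snd.
apply: (@measurableT_comp _ _ _ _ _ _ (fun w => mcount K (X w))); last exact: measurable_fst.
exact: (measurable_mcount hX).
Qed.

Lemma measurable_mcount_section w : measurable_fun [set: R] (fun r => mcount r (X w)).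
Proof.
apply: (@measurableT_comp _ _ _ _ _ _ (fun p : T * R => mcount p.2 (X p.1)) _ (fun r : R => (w, r))).
  exact: (measurable_mcount_joint hX).
exact: measurable_fun_pair.
Qed.

Lemma measurable_excess_section w : measurable_fun [set: R] (excess w).
Proof.
apply: (@measurableT_comp _ _ _ _ _ _ (fun p : T * R => excess p.1 p.2) _ (fun r : R => (w, r))).
  exact: measurable_excess_joint.
exact: measurable_fun_pair.
Qed.

Lemma measurable_excess r : measurable_fun [set: T] (excess^~ r).
Proof.
apply: (@measurableT_comp _ _ _ _ _ _ (fun p : T * R => excess p.1 p.2) _ (fun w => (w, r))).
  exact: measurable_excess_joint.
exact: measurable_fun_pair.
Qed.

(** The rescaled form of [mdst_weight_integral], with the points without an edge
    removed. *)
Lemma mdst_weight_excess w :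
  ((n `^ (a / k.+1%:R - 1) * mdst_weight a (X w))%:E =
   \int[leb]_(r in `]0%R, +oo[) (pkern a r * excess w r)%:E)%E.
Proof.
pose g r := `|mcount r (X w) - mcount K (X w)| / n.
have g0 r : 0 <= g r by rewrite divr_ge0// ltW.
have mg : measurable_fun [set: R] g.
  apply: measurable_funM => //; apply: measurableT_comp => //; apply: measurable_funB => //.
  exact: measurable_mcount_section.
have m0 : 0 <= mcount K (X w) / n by rewrite divr_ge0 ?mcount_ge0// ltW.
have e1 : ((mdst_weight a (X w) / n)%:E = \int[leb]_(r in `]0%R, K[) (pkern a r * g r)%:E)%E.
  have h1 : ((mdst_weight a (X w) / n)%:E + (K `^ a * (mcount K (X w) / n))%:E =
    \int[leb]_(r in `]0%R, K[) (pkern a r * g r)%:E + (K `^ a * (mcount K (X w) / n))%:E)%E.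
    rewrite [in RHS]EFinM muleC -(integral_pkern a0 K0) -ge0_integralZl//=; last 2 first.
    - by apply/measurable_EFinP/measurable_funTS; exact: measurable_pkern.
    - by move=> r _; rewrite lee_fin pkern_ge0// ltW.
    rewrite -ge0_integralD//=; last 4 first.
    - by move=> r _; rewrite lee_fin mulr_ge0// pkern_ge0// ltW.
    - apply/measurable_EFinP/measurable_funTS; apply: measurable_funM => //; exact: measurable_pkern.
    - by move=> r _; rewrite lee_fin mulr_ge0// pkern_ge0// ltW.
    - apply/measurable_EFinP/measurable_funTS; apply: measurable_funM => //; exact: measurable_pkern.
    transitivity ((n^-1)%:E * \int[leb]_(r in `]0%R, K[) (pkern a r * mcount r (X w))%:E)%E.
      rewrite -(mdst_weight_integral a0 (pp_cube hX (w := w)) kK) -EFinD -EFinM; congr EFin.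
      by rewrite mulrA -mulrDl mulrC.
    rewrite -ge0_integralZl//=; last 3 first.
    - apply/measurable_EFinP/measurable_funTS; apply: measurable_funM; first exact: measurable_pkern.
      exact: measurable_mcount_section.
    - by move=> r _; rewrite lee_fin mulr_ge0 ?mcount_ge0// pkern_ge0// ltW.
    - by rewrite lee_fin invr_ge0 ltW.
    apply: eq_integral => r; rewrite inE/= in_itv/= => /andP[_ rK].
    rewrite -!EFinM -EFinD /g ger0_norm ?subr_ge0 ?mcount_mono ?(ltW rK)//; congr EFin.
    by ring.
  by move: h1 => /(congr1 (fun z => z - (K `^ a * (mcount K (X w) / n))%:E)%E); rewrite !addeK.
have := integral_pkern_scale K a0 (rscale_gt0 k n0) mg g0.
rewrite -e1 => /(congr1 (fun z => ((rscale k n `^ a)^-1)%:E * z)%E).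
rewrite muleA -!EFinM mulVf ?gt_eqF ?powR_gt0 ?rscale_gt0// mul1e => <-; congr EFin.
rewrite rscale_powR// powRN invrK powRB ?(gt_eqF n0) ?implybT// powRr1 ?(ltW n0)//.
by ring.
Qed.

Local Notation cr r := (rscale k n * r).

Lemma void_limit01 (r : R) : 0 <= r -> 0 <= void_limit k r <= 1.
Proof.
move=> r0; rewrite /void_limit expR_ge0 -expR0 ler_expR oppr_le0.
by rewrite mulr_ge0 ?exprn_ge0// divr_ge0// ltW// ball_vol_gt0.
Qed.

Lemma excess_le_mcount w r : excess w r <= (cr r < K)%R%:R * (mcount (cr r) (X w) / n).
Proof.
rewrite /excess; case: ltP => rK; last by rewrite !mul0r.
rewrite !mul1r ger0_norm ?subr_ge0 ?mcount_mono ?(ltW rK)// ler_pM2r ?invr_gt0//.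
by rewrite gerBl mcount_ge0.
Qed.

Lemma mean_mcountV r : (\int[P]_w (mcount r (X w) / n)%:E = (@cap_mean R k n r)%:E)%E.
Proof.
rewrite (_ : cap_mean k n r = n^-1 * (n * cap_mean k n r)); last by rewrite mulKf// gt_eqF.
rewrite EFinM -(mean_mcount hX n0) -ge0_integralZl//=.
- by apply: eq_integral => w _; rewrite -EFinM mulrC.
- by apply/measurable_EFinP; exact: (measurable_mcount hX).
- by move=> w _; rewrite lee_fin mcount_ge0.
- by rewrite lee_fin invr_ge0 ltW.
Qed.

Lemma measurable_mcountV r : measurable_fun [set: T] (fun w => mcount r (X w) / n).
Proof. by apply: measurable_funM => //; exact: (measurable_mcount hX). Qed.

Lemma excess_dist_crude r : 0 <= r ->
  (\int[P]_w `|excess w r - void_limit k r|%:E <=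
   ((cr r < K)%R%:R * cap_mean k n (cr r) + void_limit k r)%:E)%E.
Proof.
move=> r0; have /andP[v0 _] := void_limit01 r0.
apply: (@le_trans _ _ (\int[P]_w (((cr r < K)%R%:R)%:E * (mcount (cr r) (X w) / n)%:E + (void_limit k r)%:E))%E).
  apply: ge0_le_integral => //.
  - apply/measurable_EFinP; apply: measurableT_comp => //; apply: measurable_funB => //.
    exact: measurable_excess.
  - apply/measurable_EFinP; apply: measurable_funD => //; apply: measurable_funM => //.
    exact: measurable_mcountV.
  - move=> w _; rewrite -EFinM -EFinD lee_fin (le_trans (ler_normB _ _))//.
    by rewrite (ger0_norm v0) ger0_norm ?excess_ge0// lerD2r excess_le_mcount.
have mV : measurable_fun [set: T] (fun w => (mcount (cr r) (X w) / n)%:E).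
  by apply/measurable_EFinP; exact: measurable_mcountV.
have pV w : (0 <= (mcount (cr r) (X w) / n)%:E)%E.
  by rewrite lee_fin divr_ge0 ?mcount_ge0// ltW.
rewrite ge0_integralD//=; last 2 first.
- by move=> w _; rewrite mule_ge0// lee_fin.
- by apply: emeasurable_funM.
rewrite integral_cst//= probability_setT mule1 ge0_integralZl//= ?lee_fin//.
by rewrite mean_mcountV -EFinM.
Qed.

(** The mean of [mcount K] is the contribution of the points without an edge; the rest
    is a deviation bounded through the second moment. *)
Lemma excess_dist_fine r : 0 < r -> cr r < K ->
  (\int[P]_w `|excess w r - void_limit k r|%:E <=
   (@cap_mean R k n K + Num.sqrt ((@cap_mean R k n (cr r) - void_limit k r) ^+ 2 + n^-1 + (4 * cr r) ^+ k.+1))%:E)%E.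
Proof.
move=> r0 rK; have /andP[v0 _] := void_limit01 (ltW r0).
have c0 : 0 < cr r by rewrite mulr_gt0// rscale_gt0.
set b := _ + _ + _.
have b0 : 0 < b.
  apply: ltr_wpDr; first by rewrite exprn_ge0// mulr_ge0// ltW.
  by apply: ltr_wpDl; rewrite ?sqr_ge0// invr_gt0.
apply: (@le_trans _ _ (\int[P]_w ((mcount K (X w) / n)%:E + `|mcount (cr r) (X w) / n - void_limit k r|%:E))%E).
  apply: ge0_le_integral => //.
  - apply/measurable_EFinP; apply: measurableT_comp => //; apply: measurable_funB => //.
    exact: measurable_excess.
  - apply/measurable_EFinP; apply: measurable_funD; first exact: measurable_mcountV.
    by apply: measurableT_comp => //; apply: measurable_funB => //; exact: measurable_mcountV.
  - move=> w _; rewrite -EFinD lee_fin /excess rK mul1r.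
    have hm : 0 <= mcount (cr r) (X w) - mcount K (X w) by rewrite subr_ge0 mcount_mono// ltW.
    rewrite (ger0_norm hm) mulrBl (_ : _ - _ - _ = mcount (cr r) (X w) / n - void_limit k r - mcount K (X w) / n); last by ring.
    rewrite (le_trans (ler_normB _ _))// addrC lerD2r ger0_norm//.
    by rewrite divr_ge0 ?mcount_ge0// ltW.
rewrite ge0_integralD//=; last 3 first.
- by move=> w _; rewrite lee_fin divr_ge0 ?mcount_ge0// ltW.
- by apply/measurable_EFinP; exact: measurable_mcountV.
- apply/measurable_EFinP; apply: measurableT_comp => //; apply: measurable_funB => //.
  exact: measurable_mcountV.
rewrite mean_mcountV EFinD; apply: leeD2l.
apply: (@L1_le_L2 _ _ _ _ _ (cap_mean k n (cr r)) (((n * cap_mean k n (cr r)) ^+ 2 + n + n ^+ 2 * (4 * cr r) ^+ k.+1) / n ^+ 2)) => //.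
- exact: measurable_mcountV.
- by move=> w; rewrite divr_ge0 ?mcount_ge0// ltW.
- exact: mean_mcountV.
- rewrite [X in (_ <= X)%E]EFinM muleC.
  rewrite (_ : (\int[P]_w _)%E = ((n ^+ 2)^-1%:E * \int[P]_w (mcount (cr r) (X w) ^+ 2)%:E)%E); last first.
    rewrite -ge0_integralZl//=.
    + by apply: eq_integral => w _; rewrite -EFinM expr_div_n mulrC.
    + by apply/measurable_EFinP; apply: measurable_funX; exact: (measurable_mcount hX).
    + by move=> w _; rewrite lee_fin sqr_ge0.
    + by rewrite lee_fin invr_ge0 sqr_ge0.
  apply: lee_wpmul2l; first by rewrite lee_fin invr_ge0 sqr_ge0.
  by apply: (sqr_mcount hX n0); exact: ltW.
- rewrite /b le_eqVlt; apply/orP; left; apply/eqP; field.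
  by rewrite gt_eqF.
Qed.

Definition excess_dist (r : R) : R := fine (\int[P]_w `|excess w r - void_limit k r|%:E)%E.

Lemma excess_distE r : 0 <= r ->
  (\int[P]_w `|excess w r - void_limit k r|%:E = (excess_dist r)%:E)%E.
Proof.
move=> r0; rewrite fineK// ge0_fin_numE; last by apply: integral_ge0 => w _; rewrite lee_fin.
by rewrite (le_lt_trans (excess_dist_crude r0))// ltry.
Qed.

Lemma excess_dist_ge0 r : 0 <= excess_dist r.
Proof. by rewrite fine_ge0// integral_ge0// => w _; rewrite lee_fin. Qed.

Lemma measurable_void_limit : measurable_fun [set: R] (@void_limit R k).
Proof.
apply: measurableT_comp => //; apply: measurable_funN; exact: measurable_funM.
Qed.

Lemma measurable_excess_diff :
  measurable_fun [set: T * R] (fun p => `|excess p.1 p.2 - void_limit k p.2|).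
Proof.
apply: measurableT_comp => //; apply: measurable_funB; first exact: measurable_excess_joint.
by apply: (measurableT_comp measurable_void_limit); exact: measurable_snd.
Qed.

Lemma measurable_excess_dist : measurable_fun [set: R] excess_dist.
Proof.
apply: (measurableT_comp (fine_measurable measurableT)).
apply: (@measurable_integral_in _ _ _ _ R P _ (fun p : R * T => `|excess p.2 p.1 - void_limit k p.1|%:E)) => //.
- apply/measurable_EFinP.
  apply: (@measurableT_comp _ _ _ _ _ _ (fun p : T * R => `|excess p.1 p.2 - void_limit k p.2|) _ (fun p : R * T => (p.2, p.1))).
    exact: measurable_excess_diff.
  by apply: measurable_fun_pair; [exact: measurable_snd|exact: measurable_fst].
Qed.

(** The limit is an integral against the same kernel, so that the distance is at most
    the integral of the distances at fixed radius. *)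
Lemma L1_dist_excess (c : R) :
  (\int[leb]_(r in `]0%R, +oo[) (pkern a r * void_limit k r)%:E = c%:E)%E ->
  (\int[P]_w `|n `^ (a / k.+1%:R - 1) * mdst_weight a (X w) - c|%:E <=
   \int[leb]_(r in `]0%R, +oo[) (pkern a r * excess_dist r)%:E)%E.
Proof.
move=> hc; have mJ : measurable (`]0, +oo[%classic : set R) by exact: measurable_itv.
have mf : measurable_fun [set: T * R] (fun p => (pkern a p.2 * `|excess p.1 p.2 - void_limit k p.2|)%:E).
  apply/measurable_EFinP; apply: measurable_funM; last exact: measurable_excess_diff.
  by apply: (measurableT_comp (@measurable_pkern R a)); exact: measurable_snd.
have f0 (p : T * R) : (0 <= (pkern a p.2 * `|excess p.1 p.2 - void_limit k p.2|)%:E)%E.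
  by rewrite lee_fin mulr_ge0// pkern_ge0// ltW.
apply: (@le_trans _ _ (\int[P]_w \int[leb]_(r in `]0%R, +oo[) (pkern a r * `|excess w r - void_limit k r|)%:E)%E).
  apply: ge0_le_integral => //.
  - apply/measurable_EFinP; apply: measurableT_comp => //; apply: measurable_funB => //.
    by apply: measurable_funM => //; exact: (measurable_mdst_weight hX a0 kK).
  - exact: (@measurable_integral_in _ _ _ _ R leb _ _ mJ mf f0).
  - move=> w _; apply: le_trans (@le_integral_dist _ _ R leb _ (fun r => pkern a r * excess w r)
      (fun r => pkern a r * void_limit k r) _ _ mJ _ _ _ _ (esym (mdst_weight_excess w)) hc) _.
    + by apply: measurable_funTS; apply: measurable_funM; [exact: measurable_pkern|exact: measurable_excess_section].
    + by apply: measurable_funTS; apply: measurable_funM; [exact: measurable_pkern|exact: measurable_void_limit].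
    + by move=> r _; rewrite mulr_ge0 ?excess_ge0// pkern_ge0// ltW.
    + by move=> r _; rewrite mulr_ge0 ?expR_ge0// pkern_ge0// ltW.
    rewrite le_eqVlt; apply/orP; left; apply/eqP; apply: eq_integral => r _.
    by rewrite -mulrBr normrM ger0_norm// pkern_ge0// ltW.
rewrite (@tonelli_in _ _ _ _ R P leb _ _ measurableT mJ _ mf f0).
rewrite le_eqVlt; apply/orP; left; apply/eqP; apply: eq_integral => r; rewrite inE/= in_itv/= andbT => r0.
rewrite EFinM -(excess_distE (ltW r0)) -ge0_integralZl//=.
- apply/measurable_EFinP; apply: measurableT_comp => //; apply: measurable_funB => //.
  exact: measurable_excess.
- by rewrite lee_fin pkern_ge0// ltW.
Qed.

(** The three terms bound [cap_mean] by [1] for small radii, then its parts [low_mean]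
    and [high_mean]. The power comes from [n^-1 = rscale n ^+ k.+1] and [rscale n * r <
    K]. *)
Definition tail_bound (r : R) : R :=
  (r < 1)%R%:R + (2 * K) ^+ k.+1 * K * ((1 <= r)%R%:R * r `^ (- k.+1%:R)) +
  expR (- (((2 * K)^-1) ^+ k.+1 * r `^ k.+1%:R)).

Lemma cap_mean_tail r : 0 < r -> (cr r < K)%R%:R * cap_mean k n (cr r) <= tail_bound r.
Proof.
move=> r0; have c0 := rscale_gt0 k n0; have cr0 : 0 < cr r by rewrite mulr_gt0.
have e0 : 0 <= expR (- (((2 * K)^-1) ^+ k.+1 * r `^ k.+1%:R)) by exact: expR_ge0.
have t0 : 0 <= (2 * K) ^+ k.+1 * K * ((1 <= r)%R%:R * r `^ (- k.+1%:R)).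
  by rewrite mulr_ge0 ?mulr_ge0 ?exprn_ge0 ?powR_ge0// ?mulr_ge0// ?(ltW K0).
case: (ltP (cr r) K) => rK; last by rewrite mul0r /tail_bound addr_ge0// addr_ge0.
rewrite mul1r /tail_bound.
have [r1|r1] := ltP r 1.
  rewrite mulr0n mul0r mulr0 addr0.
  by have [_ /andP[_ h]] := cap_mean_fin k (cr r) (ltW n0); rewrite mulr1n; move: h e0; lra.
rewrite mulr0n mulr1n add0r mul1r.
rewrite -(ler_pM2l n0) low_high_mean ?(ltW n0)// mulrDr; apply: lerD; last first.
  rewrite ler_pM2l//; apply: le_trans (high_mean_bound (ltW n0) kK cr0 (ltW rK)) _.
  by rewrite (powR_mulrn _ (ltW r0)) exprMn mulrA rscale_expX// mulrC lexx.
apply: le_trans (low_mean_bound n0 kK cr0 (ltW rK)) _.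
rewrite powRN (powR_mulrn _ (ltW r0)).
(* in terms of [c = rscale n], both sides are multiples of [c ^- k * r ^- k], in the
   ratio [K / (c * r) >= 1] *)
have nE : n = (rscale k n ^+ k.+1)^-1.
  by apply: (@mulIf _ (rscale k n ^+ k.+1)); rewrite ?rscale_exp// ?mulVf// expf_neq0// gt_eqF.
rewrite [X in _ <= X](_ : _ = (rscale k n ^+ k.+1)^-1 * ((2 * K) ^+ k.+1 * K / r ^+ k.+1)); last by rewrite -nE.
set c := rscale k n in c0 rK *.
have -> : 2 * K / (c * r / (2 * K)) ^+ k = (2 * K) ^+ k.+1 / (c ^+ k * r ^+ k).
  by rewrite expr_div_n exprMn invf_div mulrA -exprS.
have -> : (c ^+ k.+1)^-1 * ((2 * K) ^+ k.+1 * K * (r ^+ k.+1)^-1) =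
  (2 * K) ^+ k.+1 / (c ^+ k * r ^+ k) * (K / (c * r)).
  rewrite (exprS c) (exprS r); field.
  by rewrite !expf_neq0 ?gt_eqF.
rewrite ler_peMr//; last by rewrite ler_pdivlMr ?mul1r// ltW.
by rewrite divr_ge0 ?mulr_ge0 ?exprn_ge0 ?mulr_ge0 ?ltW.
Qed.

End excess.

Section excess_limit.
Context (R : realType) (k : nat).
Context disp (T : measurableType disp) (P : probability T R).
Context (X : R -> T -> {fset k.+1.-tuple R}) (s : nat -> R) (a : R).
Hypotheses (hX : forall n, 0 < n -> is_poisson_process P n (X n)).
Hypotheses (s0 : forall j, 0 < s j) (soo : s j @[j --> \oo] --> +oo).
Hypotheses (a0 : 0 < a) (ak : a < k.+1%:R).

Let K : R := k.+1%:R.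
Let K0 : 0 < K. Proof. by rewrite /K. Qed.

Lemma measurable_tail_bound : measurable_fun [set: R] (@tail_bound R k K).
Proof.
apply: measurable_funD; last first.
  apply: measurableT_comp => //; apply: measurable_funN; apply: measurable_funM => //.
apply: measurable_funD; first by apply: measurable_natr_bool; exact: measurable_fun_ltr.
apply: measurable_funM => //; apply: measurable_funM => //.
by apply: measurable_natr_bool; exact: measurable_fun_ler.
Qed.

(** Integrability at infinity of the power term is the place where [a < k.+1] is needed. *)
Lemma integral_tail_bound :
  (\int[leb]_(r in `]0%R, +oo[) (pkern a r * (tail_bound k K r + void_limit k r))%:E < +oo)%E.
Proof.
have mJ : measurable (`]0, +oo[%classic : set R) by exact: measurable_itv.
have mp := @measurable_pkern R a.
pose f1 (r : R) := pkern a r * (r < 1)%R%:R.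
pose f2 (r : R) := pkern a r * ((1 <= r)%R%:R * r `^ (- K)).
pose f3 (r : R) := pkern a r * expR (- (((2 * K)^-1) ^+ k.+1 * r `^ k.+1%:R)).
pose f4 (r : R) := pkern a r * void_limit k r.
pose C := (2 * K) ^+ k.+1 * K.
have C0 : 0 <= C by rewrite mulr_ge0 ?exprn_ge0 ?mulr_ge0 ?ltW.
have p0 r : 0 <= pkern a r by rewrite pkern_ge0// ltW.
have m1 : measurable_fun [set: R] f1.
  by apply: measurable_funM => //; apply: measurable_natr_bool; exact: measurable_fun_ltr.
have m2 : measurable_fun [set: R] f2.
  apply: measurable_funM => //; apply: measurable_funM => //.
  by apply: measurable_natr_bool; exact: measurable_fun_ler.
have m3 : measurable_fun [set: R] f3.
  apply: measurable_funM => //; apply: measurableT_comp => //; apply: measurable_funN.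
  exact: measurable_funM.
have m4 : measurable_fun [set: R] f4 by apply: measurable_funM => //; exact: measurable_void_limit.
have n1 r : 0 <= f1 r by rewrite mulr_ge0.
have n2 r : 0 <= f2 r by rewrite mulr_ge0// mulr_ge0// powR_ge0.
have n3 r : 0 <= f3 r by rewrite mulr_ge0// expR_ge0.
have n4 r : 0 <= f4 r by rewrite mulr_ge0// expR_ge0.
have i2 : (\int[leb]_(r in `]0%R, +oo[) (f2 r)%:E < +oo)%E.
  pose b := K - a; have b0 : 0 < b by rewrite subr_gt0.
  have h := integral_powR_tail b0.
  apply: (@le_lt_trans _ _ ((a / b)%:E * \int[leb]_(r in `[1%R, +oo[) (b * r `^ (- b - 1))%:E)%E); last first.
    apply: (@le_lt_trans _ _ ((a / b)%:E * 1)%E); last by rewrite mule1 ltry.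
    by apply: lee_wpmul2l => //; rewrite lee_fin divr_ge0// ltW.
  rewrite -ge0_integralZl//=; last 3 first.
  - by apply/measurable_EFinP/measurable_funTS; exact: measurable_funM.
  - by move=> r _; rewrite lee_fin mulr_ge0 ?powR_ge0// ltW.
  - by rewrite lee_fin divr_ge0// ltW.
  rewrite integral_mkcond [X in (_ <= X)%E]integral_mkcond le_eqVlt; apply/orP; left; apply/eqP.
  apply: eq_integral => r _; rewrite !patchE !mem_setE !in_itv/= !andbT.
  have [r1|r1] := leP 1 r; last first.
    by case: ifPn => // _; rewrite /f2 leNgt r1 mul0r mulr0.
  have r0 : 0 < r by exact: lt_le_trans r1.
  rewrite r0 /f2 r1 mul1r -EFinM; congr EFin.
  rewrite mulrA divfK ?gt_eqF// /pkern -mulrA -powRD ?(gt_eqF r0) ?implybT//.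
  by congr (_ * _ `^ _); rewrite /b; ring.
have finD (f g : R -> R) : measurable_fun [set: R] f -> measurable_fun [set: R] g ->
    (forall r, 0 <= f r) -> (forall r, 0 <= g r) ->
    (\int[leb]_(r in `]0%R, +oo[) (f r)%:E < +oo)%E -> (\int[leb]_(r in `]0%R, +oo[) (g r)%:E < +oo)%E ->
    (\int[leb]_(r in `]0%R, +oo[) (f r + g r)%:E < +oo)%E.
  move=> mf mg f0 g0 hf hg.
  have -> : (\int[leb]_(r in `]0%R, +oo[) (f r + g r)%:E =
    \int[leb]_(r in `]0%R, +oo[) (f r)%:E + \int[leb]_(r in `]0%R, +oo[) (g r)%:E)%E.
    under eq_integral do rewrite EFinD; rewrite ge0_integralD//=.
    - by move=> r _; rewrite lee_fin.
    - by apply/measurable_EFinP; exact: measurable_funTS.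
    - by move=> r _; rewrite lee_fin.
    - by apply/measurable_EFinP; exact: measurable_funTS.
  exact: lte_add_pinfty.
have iC : (\int[leb]_(r in `]0%R, +oo[) (C * f2 r)%:E < +oo)%E.
  have -> : (\int[leb]_(r in `]0%R, +oo[) (C * f2 r)%:E = C%:E * \int[leb]_(r in `]0%R, +oo[) (f2 r)%:E)%E.
    under eq_integral do rewrite EFinM; rewrite ge0_integralZl//=.
    - by apply/measurable_EFinP; exact: measurable_funTS.
    - by move=> r _; rewrite lee_fin.
  by rewrite lte_mul_pinfty// lee_fin.
have -> : (fun r => (pkern a r * (tail_bound k K r + void_limit k r))%:E) =
  (fun r => ((f1 r + C * f2 r) + (f3 r + f4 r))%:E).
  apply/funext => r; congr EFin.
  by rewrite /f1 /f2 /f3 /f4 /tail_bound /C; ring.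
have nC r : 0 <= C * f2 r by rewrite mulr_ge0.
have mC : measurable_fun [set: R] (fun r => C * f2 r) by exact: measurable_funM.
apply: (finD).
- exact: measurable_funD.
- exact: measurable_funD.
- by move=> r; rewrite addr_ge0.
- by move=> r; rewrite addr_ge0.
- by apply: (finD) => //; rewrite integral_pkern_lt// ltry.
apply: (finD) => //; last by rewrite integral_void_limit// ltry.
by rewrite integral_pkern_exp// ?ltry// exprn_gt0// invr_gt0 mulr_gt0.
Qed.

Lemma cvg_excess_dist r : 0 < r -> excess_dist P (s j) (X (s j)) K r @[j --> \oo] --> 0.
Proof.
move=> r0.
pose b j := (@cap_mean R k (s j) (rscale k (s j) * r) - void_limit k r) ^+ 2 + (s j)^-1
  + (4 * (rscale k (s j) * r)) ^+ k.+1.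
have sV : (s j)^-1 @[j --> \oo] --> 0 by apply/gtr0_cvgV0; [exact: nearW|].
have cc := cvg_rscale k s0 soo.
have b_cvg : b j @[j --> \oo] --> 0.
  rewrite (_ : 0 = (void_limit k r - void_limit k r) ^+ 2 + 0 + (4 * (0 * r)) ^+ k.+1); last first.
    by rewrite subrr mul0r mulr0 !expr0n /= !addr0.
  apply: cvgD; last first.
    by apply: cvg_exprn; apply: cvgM; [exact: cvg_cst|apply: cvgM; [|exact: cvg_cst]].
  apply: cvgD => //; apply: cvg_exprn; apply: cvgB; last exact: cvg_cst.
  exact: cvg_cap_mean_scaled.
have sb_cvg : Num.sqrt (b j) @[j --> \oo] --> 0.
  by rewrite -sqrtr0; apply: continuous_cvg => //; exact: sqrt_continuous.
have capK : @cap_mean R k (s j) K @[j --> \oo] --> 0.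
  rewrite (_ : (fun j => _) = (fun j => (s j)^-1 * (s j * cap_mean k (s j) K))); last first.
    by apply/funext => j; rewrite mulKf// gt_eqF.
  by rewrite -(mul0r 1); apply: cvgM => //; exact: cvg_cap_mean_diam.
have h : @cap_mean R k (s j) K + Num.sqrt (b j) @[j --> \oo] --> 0.
  by rewrite -[X in _ --> X](addr0 0); exact: cvgD.
apply: (squeeze_cvgr _ (cvg_cst 0) h); near=> j.
rewrite excess_dist_ge0/= -lee_fin -(excess_distE (hX (s0 j)) (s0 j) K (ltW r0)).
apply: (excess_dist_fine (hX (s0 j)) (s0 j) r0).
rewrite -ltr_pdivlMr//; near: j; apply: (cvgr_lt _ cc); by rewrite divr_gt0.
Unshelve. all: by end_near. Qed.

Lemma mdst_weight_L1 :
  (\int[P]_w `|s j `^ (a / k.+1%:R - 1) * mdst_weight a (X (s j) w) -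
     (ball_vol R k.+1 / 2) `^ (- (a / k.+1%:R)) * Gamma (1 + a / k.+1%:R)|%:E)%E @[j --> \oo] --> 0%E.
Proof.
set c := _ * Gamma _.
have h : (\int[leb]_(r in `]0%R, +oo[) (pkern a r * excess_dist P (s j) (X (s j)) K r)%:E @[j --> \oo] --> 0)%E.
  have -> : (0 = \int[leb]_(r in `]0%R, +oo[) (@cst R R 0 r)%:E :> \bar R)%E by rewrite integral0.
  apply: (@real_dominated_cvg _ _ R leb _ (fun j r => pkern a r * excess_dist P (s j) (X (s j)) K r)
    (cst 0) (fun r => pkern a r * (tail_bound k K r + void_limit k r))).
  - exact: measurable_itv.
  - move=> j; apply: measurable_funTS; apply: measurable_funM; first exact: measurable_pkern.
    by apply: measurable_excess_dist; exact: hX.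
  - apply: measurable_funTS; apply: measurable_funM; first exact: measurable_pkern.
    by apply: measurable_funD; [exact: measurable_tail_bound|exact: measurable_void_limit].
  - move=> r; rewrite /= in_itv/= andbT => r0; rewrite -(mulr0 (pkern a r)).
    by apply: cvgM; [exact: cvg_cst|exact: cvg_excess_dist].
  - move=> j r; rewrite /= in_itv/= andbT => r0.
    have p0 : 0 <= pkern a r by rewrite pkern_ge0// ltW.
    rewrite ger0_norm; last by rewrite mulr_ge0// excess_dist_ge0.
    apply: ler_wpM2l => //; rewrite -lee_fin -(excess_distE (hX (s0 j)) (s0 j) K (ltW r0)).
    apply: le_trans (excess_dist_crude (hX (s0 j)) (s0 j) K (ltW r0)) _.
    by rewrite lee_fin lerD2r; apply: cap_mean_tail.
  - exact: integral_tail_bound.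
apply: (@squeeze_cvge _ _ _ _ (cst 0%E) _ _ _ _ _ h); [|exact: cvg_cst].
apply: nearW => j; apply/andP; split; first by apply: integral_ge0 => w _; rewrite lee_fin.
by apply: (L1_dist_excess (hX (s0 j))) => //; exact: integral_void_limit.
Qed.

End excess_limit.

(** The power of [2] in the limit is due to half balls having half the volume of balls. *)
Lemma mdst_weight_cvg_L1 (R : realType) (k : nat) (a : R) disp (T : measurableType disp)
    (P : probability T R) (X : R -> T -> {fset k.+1.-tuple R}) :
  (forall n, 0 < n -> is_poisson_process P n (X n)) -> 0 < a -> a < k.+1%:R ->
  cvg_L1 P (fun n w => n `^ (a / k.+1%:R - 1) * mdst_weight a (X n w))
    (2 `^ (a / k.+1%:R) * Gamma (1 + a / k.+1%:R) * ball_vol R k.+1 `^ (- (a / k.+1%:R))).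
Proof.
move=> hX a0 ak; split.
  exists 0; split => // n n0; apply/Lfun1_integrable.
  have mL := measurable_mdst_weight (hX _ n0) a0 (lexx _).
  apply/integrableP; split.
    by apply/measurable_EFinP; exact: measurable_funM.
  have -> : (\int[P]_w `|(n `^ (a / k.+1%:R - 1) * mdst_weight a (X n w))%:E| =
     (n `^ (a / k.+1%:R - 1))%:E * \int[P]_w (mdst_weight a (X n w))%:E)%E.
    rewrite -ge0_integralZl//=.
    - apply: eq_integral => w _; rewrite -EFinM ger0_norm// mulr_ge0 ?powR_ge0//.
      exact: mdst_weight_ge0.
    - exact/measurable_EFinP.
    - by move=> w _; rewrite lee_fin mdst_weight_ge0.
    - by rewrite lee_fin powR_ge0.
  rewrite lte_mul_pinfty ?lee_fin ?powR_ge0//.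
  apply: (@le_lt_trans _ _ (\int[leb]_(r in `]0%R, k.+1%:R[) (pkern a r * (n * @cap_mean R k n r))%:E)%E).
    rewrite -(expected_mdst_weight (hX _ n0) n0 a0 (lexx _)).
    rewrite leeDl// lee_fin mulr_ge0 ?powR_ge0// mulr_ge0 ?(ltW n0)//.
    by have [_ /andP[]] := cap_mean_fin k k.+1%:R (ltW n0).
  apply: (@le_lt_trans _ _ (n%:E * \int[leb]_(r in `]0%R, k.+1%:R[) (pkern a r)%:E)%E); last first.
    by rewrite integral_pkern// -EFinM ltry.
  rewrite -ge0_integralZl//=; last 3 first.
  - by apply/measurable_EFinP/measurable_funTS; exact: measurable_pkern.
  - by move=> r _; rewrite lee_fin pkern_ge0// ltW.
  - by rewrite lee_fin ltW.
  apply: ge0_le_integral => //=.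
  - move=> r _; have [_ /andP[h _]] := cap_mean_fin k r (ltW n0).
    by rewrite lee_fin mulr_ge0 ?pkern_ge0 ?(ltW a0)// mulr_ge0// ltW.
  - apply/measurable_EFinP/measurable_funTS; apply: measurable_funM; first exact: measurable_pkern.
    by apply: measurable_funM => //; exact: measurable_cap_mean.
  - apply/measurable_EFinP/measurable_funTS; apply: measurable_funM => //; exact: measurable_pkern.
  - move=> r _; rewrite -EFinM lee_fin mulrCA ler_pM2l// ler_piMr ?pkern_ge0 ?(ltW a0)//.
    by have [_ /andP[]] := cap_mean_fin k r (ltW n0).
apply: cvge_pinfty_pos => s s0 soo.
have := mdst_weight_L1 hX s0 soo a0 ak.
have -> : (ball_vol R k.+1 / 2) `^ (- (a / k.+1%:R)) * Gamma (1 + a / k.+1%:R) =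
  2 `^ (a / k.+1%:R) * Gamma (1 + a / k.+1%:R) * ball_vol R k.+1 `^ (- (a / k.+1%:R)).
  have e x : (2^-1 : R) `^ (- x) = 2 `^ x.
    by rewrite -[2^-1](powR_inv1 (ler0n R 2)) -powRrM mulrN mulN1r opprK.
  rewrite powRM ?invr_ge0 ?(ltW (ball_vol_gt0 _ _))// e.
  by ring.
apply: cvg_trans; apply: near_eq_cvg; near=> j.
by rewrite Lnorm1.
Unshelve. all: by end_near. Qed.

(** * The on-line nearest-neighbour graph *)

Section nearest_earlier.
Context (R : realType) (k : nat).
Implicit Types (Y : nat -> k.-tuple R).

(** Written as in [ong_weight], to which it is related by [ong_weightE]. *)
Definition ong_dist Y i : R := \big[Num.min/eucl (Y i) (Y 0%N)]_(0 <= j < i) eucl (Y i) (Y j).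

Lemma ong_dist_powR a Y i : 0 <= a ->
  0 <= ong_dist Y i /\
  \big[Num.min/eucl (Y i) (Y 0%N) `^ a]_(0 <= j < i) eucl (Y i) (Y j) `^ a = ong_dist Y i `^ a.
Proof.
move=> a0; rewrite /ong_dist; elim: (index_iota 0 i) => [|j l [h0 ih]].
  by rewrite !big_nil; split => //; exact: eucl_ge0.
rewrite !big_cons ih; split; first by rewrite le_min h0 eucl_ge0.
have [h|h] := leP (eucl (Y i) (Y j)) (\big[Num.min/eucl (Y i) (Y 0%N)]_(j <- l) eucl (Y i) (Y j)).
  by rewrite min_l// ge0_ler_powR ?nnegrE ?eucl_ge0.
by rewrite min_r// ge0_ler_powR ?nnegrE ?eucl_ge0// ltW.
Qed.

Lemma lt_ong_dist Y i r : (0 < i)%N ->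
  (r < ong_dist Y i) <-> (forall j, (j < i)%N -> r < eucl (Y i) (Y j)).
Proof.
move=> i0; rewrite /ong_dist; split => h.
  move=> j ji; have : j \in index_iota 0 i by rewrite mem_index_iota.
  move: h; elim: (index_iota 0 i) => // j' l ih; rewrite big_cons lt_min in_cons => /andP[h1 h2].
  by move=> /predU1P[->//|]; exact: ih.
have h0 := h 0%N i0.
have {}h j : j \in index_iota 0 i -> r < eucl (Y i) (Y j) by rewrite mem_index_iota => /h.
elim: (index_iota 0 i) h => [|j l ih] h; first by rewrite big_nil.
rewrite big_cons lt_min h ?mem_head//= ih// => j' hj'; apply: h.
by rewrite in_cons hj' orbT.
Qed.

Lemma ong_weightE a Y m : 0 <= a ->
  ong_weight a m Y = \sum_(i < m.-1) ong_dist Y i.+1 `^ a.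
Proof.
move=> a0; rewrite /ong_weight; case: m => [|m]; first by rewrite big_geq// big_ord0.
rewrite big_add1 /= big_mkord; apply: eq_bigr => i _.
by have [_ ->] := ong_dist_powR Y i.+1 a0.
Qed.

(** The probability that the point of index [i] is at distance more than [r] from all
    earlier ones, see [prob_lt_ong_dist]. *)
Definition late_mean i (r : R) : R := fine (\int[lam k]_(u in @cube R k) ((1 - vball u r) ^+ i)%:E)%E.

Lemma late_mean01 i r :
  (\int[lam k]_(u in @cube R k) ((1 - vball u r) ^+ i)%:E = (late_mean i r)%:E)%E /\
  0 <= late_mean i r <= 1.
Proof.
have mc := @measurable_cube R k.
apply: (@fine_integral_bound _ _ _ _ _ _ (fun=> 1)) => //.
- by apply: measurable_funTS; apply: measurable_funX; apply: measurable_funB => //; exact: measurable_vball_at.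
- move=> u _; have h0 := vball_ge0 u r; have h1 := vball_le1 u r.
  by rewrite exprn_ge0 ?subr_ge0// exprn_ile1 ?subr_ge0// lerBlDr lerDl.
- by rewrite integral_cst//= lebesgue_tuple_cube mule1.
Qed.

Lemma measurable_late_mean i : measurable_fun [set: R] (late_mean i).
Proof.
apply: (@measurable_fine_integral R k (fun p => (1 - vball p.1 p.2) ^+ i)).
  by apply: measurable_funX; apply: measurable_funB => //; exact: measurable_vball.
by move=> p; rewrite exprn_ge0// subr_ge0 vball_le1.
Qed.

Lemma late_mean_full i r : k%:R <= r -> 1 <= r -> (0 < i)%N -> late_mean i r = 0.
Proof.
move=> kr r1 i0; have [h _] := late_mean01 i r; apply: EFin_inj; rewrite -h.
rewrite integral0_eq// => u cu; rewrite vball_full// ?subrr ?expr0n ?eqn0Ngt ?i0//.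
exact: lt_le_trans r1.
Qed.

End nearest_earlier.

Section ong_sample.
Context disp (T : measurableType disp) (R : realType) (P : probability T R).
Context (k m : nat) (U : nat -> T -> k.-tuple R).
Hypothesis hU : is_iid_uniform P m U.

Local Notation near_step r := (@outer R k (fun x y => eucl x y <= r)).

(** For the different cells [c] these events are disjoint, and each of them is a product
    event. *)
Definition cell_event r N i (c : grid k N) (l : nat) : set (k.-tuple R) :=
  if l == i then @cube R k `&` [set x | pred1 c (gcell N x)]
  else if (l < i)%N then @cube R k `&` [set x | ~~ near_step r c (gcell N x)]
  else setT.

Lemma measurable_cell_event r N i (c : grid k N) l : measurable (cell_event r i c l).
Proof.
rewrite /cell_event; case: ifP => _; first exact: measurable_gcellP.
by case: ifP => _ //; exact: (@measurable_gcellP R k N (fun c' => ~~ near_step r c c')).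
Qed.

Lemma gvol_compl r N (c : grid k N) :
  \sum_(c' | ~~ near_step r c c') gmesh R k N = 1 - vstep R (fun N => @outer R k (fun x y => eucl x y <= r) N) c.
Proof.
rewrite /vstep -[X in X - _](gmesh_total R k N) [in RHS](bigID (near_step r c))/=.
by rewrite addrAC subrr add0r.
Qed.

Lemma prob_cell_event r N i (c : grid k N) : (i < m)%N ->
  P (\bigcap_(l : 'I_m) (U l @^-1` cell_event r i c l)) =
  (gmesh R k N * (1 - vstep R (fun N => @outer R k (fun x y => eucl x y <= r) N) c) ^+ i)%:E.
Proof.
move=> im; rewrite (unif_indep hU); last by move=> l; exact: measurable_cell_event.
pose g l : R := if l == i then gmesh R k N else if (l < i)%N then 1 - vstep R (fun N => @outer R k (fun x y => eucl x y <= r) N) c else 1.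
have gE (l : 'I_m) : P (U l @^-1` cell_event r i c l) = (g l)%:E.
  rewrite (unif_law hU)//; last exact: measurable_cell_event.
  rewrite /cell_event /g; case: ifP => _; [|case: ifP => _].
  - by rewrite setIAC setIid lebesgue_gcellP big_pred1_eq.
  - rewrite setIAC setIid (@lebesgue_gcellP R k N (fun c' => ~~ near_step r c c')).
    by rewrite gvol_compl.
  - by rewrite setTI lebesgue_tuple_cube.
rewrite (eq_bigr (fun l : 'I_m => (g l)%:E)); last by move=> l _; exact: gE.
rewrite prodEFin; congr EFin; rewrite -(big_mkord xpredT g).
rewrite (@big_cat_nat _ _ _ i)//=; last exact: ltnW.
rewrite [X in _ * X]big_ltn// (_ : g i = gmesh R k N); last by rewrite /g eqxx.
rewrite mulrCA; congr (_ * _).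
rewrite [X in _ * X]big_nat_cond [X in _ * X]big1 ?mulr1; last first.
  by move=> l /andP[/andP[il _] _]; rewrite /g gtn_eqF// ltnNge (ltnW il).
rewrite big_nat_cond (eq_bigr (fun=> 1 - vstep R (fun N => @outer R k (fun x y => eucl x y <= r) N) c)); last first.
  by move=> l /andP[/andP[_ li] _]; rewrite /g ltn_eqF// li.
by rewrite -big_nat_cond prodr_const_nat subn0.
Qed.

(** The samples lie in the cube only almost surely, and cells are meaningful in the cube
    only. *)
Definition isolated_event r i : set T := [set w | (forall j, (j <= i)%N -> @cube R k (U j w)) /\
  (forall j, (j < i)%N -> r < eucl (U i w) (U j w))].

Definition cell_isolated r N i (w : T) : R :=
  \sum_(c : grid k N) \1_(\bigcap_(l : 'I_m) (U l @^-1` cell_event r i c l)) w.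

Lemma cell_isolatedE r N i w : (i < m)%N ->
  cell_isolated r N i w = (`[< (forall j, (j <= i)%N -> @cube R k (U j w)) /\
    (forall j, (j < i)%N -> ~~ near_step r (gcell N (U i w)) (gcell N (U j w))) >])%:R.
Proof.
move=> im; have memE (c : grid k N) : (w \in \bigcap_(l : 'I_m) (U l @^-1` cell_event r i c l)) =
   (c == gcell N (U i w)) && `[< (forall j, (j <= i)%N -> @cube R k (U j w)) /\
    (forall j, (j < i)%N -> ~~ near_step r (gcell N (U i w)) (gcell N (U j w))) >].
  apply/idP/andP.
    rewrite inE => h; have := h (Ordinal im) I; rewrite /= /cell_event eqxx => -[ci /= /eqP cE].
    rewrite -cE eqxx; split => //; apply/asboolP; split => j.
      rewrite leq_eqVlt => /predU1P[->//|ji].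
      have := h (Ordinal (ltn_trans ji im)) I; rewrite /= /cell_event ltn_eqF// ji.
      by case.
    move=> ji; have := h (Ordinal (ltn_trans ji im)) I; rewrite /= /cell_event ltn_eqF// ji.
    by rewrite cE => -[].
  move=> [/eqP-> /asboolP[h1 h2]]; rewrite inE => l _ /=; rewrite /cell_event.
  case: eqP => [->|_]; first by split; [exact: h1|rewrite /= eqxx].
  by case: ifP => // li; split; [apply: h1; exact: ltnW|exact: h2].
rewrite /cell_isolated (bigD1 (gcell N (U i w)))//= big1 ?addr0.
  by rewrite indicE memE eqxx.
by move=> c /negbTE cN; rewrite indicE memE cN.
Qed.

Lemma cvg_cell_isolated r i w : (i < m)%N ->
  cell_isolated r N i w @[N --> \oo] --> (\1_(isolated_event r i) w : R).
Proof.
move=> im; apply: (@cvg_trans _ ((cst (\1_(isolated_event r i) w : R) : nat -> R) @ \oo)); last exact: cvg_cst.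
apply: near_eq_cvg.
have [cw|ncw] := pselect (forall j, (j <= i)%N -> @cube R k (U j w)); last first.
  apply: nearW => N; rewrite cell_isolatedE// indicE memNset => [|[]//].
  by rewrite asboolF// => -[].
have h : \forall N \near \oo, forall j, j \in iota 0 i ->
   near_step r (gcell N (U i w)) (gcell N (U j w)) = (eucl (U i w) (U j w) <= r).
  apply: near_seq => j; rewrite mem_iota add0n => ji.
  by apply: outer_dball_approx; apply: cw => //; exact: ltnW.
near=> N; rewrite cell_isolatedE// indicE; congr (nat_of_bool _)%:R.
have hN : forall j, (j < i)%N -> near_step r (gcell N (U i w)) (gcell N (U j w)) = (eucl (U i w) (U j w) <= r).
  move=> j ji; have ji' : j \in iota 0 i by rewrite mem_iota add0n.
  by move: j ji' {ji}; near: N.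
apply/idP/asboolP; rewrite inE => -[_ h2]; split => // j ji.
  by rewrite hN// -ltNge; exact: h2.
by have := h2 j ji; rewrite hN// -ltNge.
Unshelve. all: by end_near. Qed.

Lemma measurable_U_preimage l A : (l < m)%N -> measurable A -> measurable (U l @^-1` A).
Proof. by move=> lm mA; have := unif_measurable hU lm measurableT mA; rewrite setTI. Qed.

Lemma measurable_cell_bigcap r N i (c : grid k N) :
  measurable (\bigcap_(l : 'I_m) (U l @^-1` cell_event r i c l)).
Proof.
apply: fin_bigcap_measurable; first exact: finite_finset.
by move=> l _; apply: measurable_U_preimage => //; exact: measurable_cell_event.
Qed.

Lemma integral_cell_isolated r N i : (i < m)%N ->
  (\int[P]_w (cell_isolated r N i w)%:E =
   (\sum_(c : grid k N) (1 - vstep R (fun N => @outer R k (fun x y => eucl x y <= r) N) c) ^+ i * gmesh R k N)%:E)%E.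
Proof.
move=> im; rewrite /cell_isolated.
under eq_integral do rewrite -sumEFin.
rewrite ge0_integral_sum//.
- rewrite -sumEFin; apply: eq_bigr => c _.
  rewrite mulrC -prob_cell_event//.
  exact: esym (measure_integral_indic P (measurable_cell_bigcap r i c)).
- move=> c; apply/measurable_EFinP; exact: measurable_indic (measurable_cell_bigcap r i c).
Qed.

(** The joint law is only known through products of events, whence the decomposition
    according to the cell of the last point. The discrete probabilities are Riemann sums
    by [integral_cell_isolated]. *)
Lemma integral_isolated_event r i : (i < m)%N ->
  (\int[P]_w (\1_(isolated_event r i) w : R)%:E = (late_mean k i r)%:E)%E.
Proof.
move=> im; have [h _] := late_mean01 k i r; rewrite -h.
have h1 : ((\int[P]_w (cell_isolated r N i w)%:E)%E @[N --> \oo] --> \int[P]_w (\1_(isolated_event r i) w : R)%:E)%E.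
  apply: (@real_dominated_cvg _ _ R P _ (fun N w => cell_isolated r N i w) _ (fun=> 1)) => //.
  - move=> N; apply: measurable_sum => c; exact: measurable_indic (measurable_cell_bigcap r i c).
  - by move=> w _; exact: cvg_cell_isolated.
  - by move=> N w _; rewrite cell_isolatedE//; case: asbool; rewrite ?normr1 ?normr0.
  - by rewrite integral_cst//= probability_setT mule1 ltry.
have h2 : ((\int[P]_w (cell_isolated r N i w)%:E)%E @[N --> \oo] -->
   (\int[lam k]_(u in @cube R k) ((1 - vball u r) ^+ i)%:E))%E.
  under eq_cvg do rewrite integral_cell_isolated//.
  apply: (@cvg_step_integral R k (fun N => @outer R k (fun x y => eucl x y <= r) N)
    (fun x y => eucl x y <= r) (@outer_dball_approx R k r) _ (fun v => (1 - v) ^+ i)).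
  - move=> x; apply: measurableI; [exact: measurable_cube|exact: measurable_dball].
  - move=> v; apply: (@continuous_comp _ _ _ (fun v : R => 1 - v) (fun x : R => x ^+ i)).
      by apply: cvgB; [exact: cvg_cst|exact: cvg_id].
    exact: exprn_continuous.
  - move=> v /andP[v0 v1]; rewrite exprn_ge0 ?subr_ge0// exprn_ile1 ?subr_ge0//.
    by rewrite lerBlDr lerDl.
exact: (cvg_unique _ h1 h2).
Qed.

Local Notation dist_at i w := (ong_dist (U ^~ w) i).

Lemma measurable_ong_dist i : (0 < i)%N -> (i < m)%N -> measurable_fun [set: T] (fun w => dist_at i w).
Proof.
move=> i0 im; rewrite /ong_dist.
have mE j : (j < i)%N -> measurable_fun [set: T] (fun w => eucl (U i w) (U j w)).
  move=> ji; apply: measurable_eucl; apply: (unif_measurable hU) => //.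
  exact: ltn_trans im.
have : {subset index_iota 0 i <= [pred j | (j < i)%N]} by move=> j; rewrite mem_index_iota.
elim: (index_iota 0 i) => [|j l ih] hl.
  by under eq_fun do rewrite big_nil; exact: mE.
under eq_fun do rewrite big_cons.
apply: measurable_minr; first by apply/mE/hl/mem_head.
by apply: ih => j' hj'; apply: hl; rewrite in_cons hj' orbT.
Qed.

Lemma ong_dist_ge0 Y i : 0 <= @ong_dist R k Y i.
Proof. by have [] := ong_dist_powR Y i ler01. Qed.

Lemma prob_lt_ong_dist i r : (0 < i)%N -> (i < m)%N ->
  (\int[P]_w ((r < dist_at i w)%R%:R)%:E = (late_mean k i r)%:E)%E.
Proof.
move=> i0 im; rewrite -(integral_isolated_event r im).
have mcube j : (j < m)%N -> measurable (U j @^-1` ~` @cube R k).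
  by move=> jm; apply: measurable_U_preimage => //; apply: measurableC; exact: measurable_cube.
have mb : measurable_fun [set: T] (fun w => (r < dist_at i w)%R).
  by apply: measurable_fun_ltr => //; exact: measurable_ong_dist.
have mB : measurable [set w | r < dist_at i w].
  by have := mb measurableT [set true] I; rewrite setTI; exact.
have mI : measurable (isolated_event r i).
  rewrite (_ : isolated_event r i = [set w | r < dist_at i w] `\`
     \bigcup_(j in [set j | (j <= i)%N]) (U j @^-1` ~` @cube R k)); last first.
    apply/seteqP; split => w /=.
      move=> [h1 h2]; split; first exact/lt_ong_dist.
      by move=> [j /= ji]; apply; exact: h1.
    move=> [/lt_ong_dist h1 h2]; split; last exact: h1.
    by move=> j ji; apply: contrapT => h; apply: h2; exists j.
  apply: measurableD => //; apply: bigcup_measurable => j /= ji.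
  by apply: mcube; exact: leq_ltn_trans im.
rewrite -[RHS](measure_integral_indic P mI) integral_bool//.
apply/eqP; rewrite eq_le; apply/andP; split; last first.
  by apply: le_measure; rewrite ?inE// => w [_ h]; exact/lt_ong_dist.
pose G j : set T := if (j <= i)%N then U j @^-1` ~` @cube R k else set0.
have mG j : measurable (G j).
  by rewrite /G; case: ifP => // ji; apply: mcube; exact: leq_ltn_trans im.
have mGU : measurable (\bigcup_j G j) by exact: bigcup_measurable.
have G0 : P (\bigcup_j G j) = 0%E.
  apply: measure_negligible => //; apply: negligible_bigcup => j; exists (G j); split => //.
  rewrite /G; case: ifP => // ji; have jm := leq_ltn_trans ji im.
  apply: (etrans (unif_law hU jm (measurableC (@measurable_cube R k)))).
  by rewrite setICl measure0.
rewrite -(measureU0 mI mGU G0); apply: le_measure; rewrite ?inE//; first exact: measurableU.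
move=> w /= /(lt_ong_dist _ _ i0) h.
have [cw|] := pselect (forall j, (j <= i)%N -> @cube R k (U j w)); first by left.
move=> /existsNP[j /not_implyP[ji nc]]; right; exists j => //.
by rewrite /G ji.
Qed.

Lemma expected_ong_dist a i : 0 < a -> (0 < i)%N -> (i < m)%N ->
  (\int[P]_w (dist_at i w `^ a)%:E =
   \int[leb]_(r in `]0%R, +oo[) (pkern a r * late_mean k i r)%:E)%E.
Proof.
move=> a0 i0 im; have mJ : measurable (`]0, +oo[%classic : set R) by exact: measurable_itv.
pose f (p : T * R) := (pkern a p.2 * (p.2 < dist_at i p.1)%R%:R)%:E.
have mf : measurable_fun [set: T * R] f.
  apply/measurable_EFinP; apply: measurable_funM.
    by apply: (measurableT_comp (@measurable_pkern R a)); exact: measurable_snd.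
  apply: measurable_natr_bool; apply: measurable_fun_ltr; first exact: measurable_snd.
  by apply: (@measurableT_comp _ _ _ _ _ _ (fun w => dist_at i w)); [exact: measurable_ong_dist|exact: measurable_fst].
have f0 p : (0 <= f p)%E by rewrite lee_fin mulr_ge0// pkern_ge0// ltW.
transitivity (\int[P]_w \int[leb]_(r in `]0%R, +oo[) f (w, r))%E.
  by apply: eq_integral => w _; rewrite -integral_pkern_lt// ong_dist_ge0.
rewrite (@tonelli_in _ _ _ _ R P leb _ _ measurableT mJ f mf f0).
apply: eq_integral => r _; rewrite [RHS]EFinM -(prob_lt_ong_dist r i0 im) -ge0_integralZl//=.
- apply/measurable_EFinP; apply: measurable_natr_bool; apply: measurable_fun_ltr => //.
  exact: measurable_ong_dist.
- by rewrite lee_fin pkern_ge0// ltW.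
Qed.

(** The term [K `^ a] completes the sum over [i] with its value at [i = 0], where
    [late_mean] is [1]. *)
Lemma expected_ong_weight a K : 0 < a -> k%:R <= K -> 1 <= K -> (0 < m)%N ->
  ('E_P[fun w => ong_weight a m (U ^~ w)] + (K `^ a)%:E =
   \int[leb]_(r in `]0%R, K[) (pkern a r * \sum_(i < m) late_mean k i r)%:E)%E.
Proof.
move=> a0 kK K1 m0; have K0 : 0 < K by exact: lt_le_trans K1.
have mI : measurable (`]0, K[%classic : set R) by exact: measurable_itv.
have l0 i r : 0 <= late_mean k i r by have [_ /andP[]] := late_mean01 k i r.
have mg i : measurable_fun [set: R] (fun r => pkern a r * late_mean k i r).
  by apply: measurable_funM; [exact: measurable_pkern|exact: measurable_late_mean].
have g0 i r : 0 <= pkern a r * late_mean k i r by apply: mulr_ge0; [rewrite pkern_ge0// ltW|exact: l0].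
transitivity (\sum_(i < m) \int[leb]_(r in `]0%R, K[) (pkern a r * late_mean k i r)%:E)%E; last first.
  rewrite -ge0_integral_sum//.
  - by apply: eq_integral => r _; rewrite sumEFin mulr_sumr.
  - by move=> i; apply/measurable_EFinP; apply: measurable_funTS; exact: mg.
  - by move=> i r _; rewrite lee_fin; exact: g0.
have late0 r : late_mean k 0 r = 1.
  have [h _] := late_mean01 k 0 r; apply: EFin_inj; rewrite -h.
  under eq_integral do rewrite expr0.
  by rewrite integral_cst//= ?lebesgue_tuple_cube ?mule1//; exact: measurable_cube.
rewrite -(big_mkord xpredT (fun i => \int[leb]_(r in `]0%R, K[) (pkern a r * late_mean k i r)%:E)%E).
rewrite big_ltn// addeC; congr (_ + _)%E.
  by rewrite -integral_pkern//; apply: eq_integral => r _; rewrite late0 mulr1.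
rewrite big_add1 big_mkord expectation.unlock.
under eq_integral do rewrite ong_weightE ?(ltW a0)// -sumEFin.
have im (i : 'I_m.-1) : (i.+1 < m)%N by rewrite -ltn_predRL.
rewrite ge0_integral_sum//; last 2 first.
- move=> i; apply/measurable_EFinP.
  apply: (@measurableT_comp _ _ _ _ _ _ (fun x : R => x `^ a)); first exact: measurable_powR.
  exact: measurable_ong_dist.
- by move=> i w _; rewrite lee_fin powR_ge0.
apply: eq_bigr => i _; rewrite expected_ong_dist//.
rewrite (_ : `]0%R, K[%classic = `]0, +oo[%classic `&` `]0, K[); last first.
  by apply/seteqP; split => r /=; rewrite !in_itv/=; [move=> /andP[-> ->]|case].
rewrite [RHS]integral_mkcondr; apply: eq_integral => r; rewrite inE/= in_itv/= andbT => r0.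
rewrite patchE mem_setE in_itv/= r0/=; case: ifPn => //; rewrite -leNgt => Kr.
by rewrite late_mean_full ?mulr0// (le_trans _ Kr).
Qed.

End ong_sample.

Section ong_limit.
Context (R : realType) (k : nat).
Implicit Types (a K : R).

Lemma late_sumE m r :
  (\int[lam k]_(u in @cube R k) (\sum_(i < m) (1 - vball u r) ^+ i)%:E =
   (\sum_(i < m) late_mean k i r)%:E)%E.
Proof.
have mc := @measurable_cube R k.
under eq_integral do rewrite -sumEFin.
rewrite ge0_integral_sum//.
- by rewrite -sumEFin; apply: eq_bigr => i _; have [-> _] := late_mean01 k i r.
- move=> i; apply/measurable_EFinP/measurable_funTS; apply: measurable_funX.
  by apply: measurable_funB => //; exact: measurable_vball_at.
- by move=> i u _; rewrite lee_fin exprn_ge0// subr_ge0 vball_le1.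
Qed.

Lemma geometric_sum (v : R) m : 0 < v -> \sum_(i < m) (1 - v) ^+ i = v^-1 * (1 - (1 - v) ^+ m).
Proof.
move=> v0; have := subrX1 (1 - v) m.
rewrite (_ : 1 - v - 1 = - v) ?mulNr; last by ring.
move=> h; rewrite (_ : 1 - (1 - v) ^+ m = v * \sum_(i < m) (1 - v) ^+ i).
  by rewrite mulKf// gt_eqF.
by rewrite -[RHS]opprK -h opprB.
Qed.

Lemma geometric_sum_le (v : R) m : 0 < v <= 1 -> 0 <= \sum_(i < m) (1 - v) ^+ i <= v^-1.
Proof.
move=> /andP[v0 v1]; have v1' : 0 <= 1 - v by rewrite subr_ge0.
apply/andP; split; first by apply: sumr_ge0 => i _; exact: exprn_ge0.
by rewrite geometric_sum// ler_piMr ?invr_ge0 ?(ltW v0)// gerBl exprn_ge0.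
Qed.

Lemma late_sum_le K m r : k%:R <= K -> 1 <= K -> 0 < r -> r <= K ->
  0 <= \sum_(i < m) late_mean k i r <= @inv_vball_mean R k r.
Proof.
move=> kK K1 r0 rK; have mc := @measurable_cube R k.
apply/andP; split; first by apply: sumr_ge0 => i _; have [_ /andP[]] := late_mean01 k i r.
have [h _] := inv_vball_mean_fin kK K1 r0 rK.
rewrite -lee_fin -h -late_sumE; apply: ge0_le_integral => //.
- move=> u _; rewrite lee_fin; apply: sumr_ge0 => i _; rewrite exprn_ge0// subr_ge0.
  exact: vball_le1.
- apply/measurable_EFinP/measurable_funTS; apply: measurable_sum => i; apply: measurable_funX.
  by apply: measurable_funB => //; exact: measurable_vball_at.
- by apply/measurable_EFinP/measurable_funTS; exact: measurable_inv_vball.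
- move=> u cu; rewrite lee_fin.
  have v0 : 0 < vball u r.
    apply: lt_le_trans (vball_lower cu kK K1 r0 rK).
    by rewrite exprn_gt0// divr_gt0// mulr_gt0// (lt_le_trans _ K1).
  have vv : 0 < vball u r <= 1 by rewrite v0 vball_le1.
  by have /andP[] := geometric_sum_le m vv.
Qed.

Lemma cvg_late_sum K r : k%:R <= K -> 1 <= K -> 0 < r -> r <= K ->
  \sum_(i < m) late_mean k i r @[m --> \oo] --> @inv_vball_mean R k r.
Proof.
move=> kK K1 r0 rK; have mc := @measurable_cube R k.
have K0 : 0 < K by exact: lt_le_trans K1.
have [h _] := inv_vball_mean_fin kK K1 r0 rK.
apply/cvg_EFinP; rewrite -h; under eq_cvg do rewrite -late_sumE.
have vr u : @cube R k u -> 0 < vball u r.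
  move=> cu; apply: lt_le_trans (vball_lower cu kK K1 r0 rK).
  by rewrite exprn_gt0// divr_gt0// mulr_gt0.
apply: (@real_dominated_cvg _ _ R (lam k) _ (fun m u => \sum_(i < m) (1 - vball u r) ^+ i) _ (fun u => (vball u r)^-1)) => //.
- move=> m; apply: measurable_funTS; apply: measurable_sum => i; apply: measurable_funX.
  by apply: measurable_funB => //; exact: measurable_vball_at.
- by apply: measurable_funTS; exact: measurable_inv_vball.
- move=> u cu; have v0 := vr u cu.
  rewrite (_ : (fun m => _) = (fun m => (vball u r)^-1 * (1 - (1 - vball u r) ^+ m))); last first.
    by apply/funext => m; exact: geometric_sum.
  rewrite -[X in _ --> X]mulr1; apply: cvgM; first exact: cvg_cst.
  rewrite -[X in _ --> X]subr0; apply: cvgB; first exact: cvg_cst.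
  by apply: cvg_expr; rewrite ger0_norm ?subr_ge0 ?vball_le1// gtrBl.
- move=> m u cu; have v0 := vr u cu.
  have vv : 0 < vball u r <= 1 by rewrite v0 vball_le1.
  by have /andP[h1 h2] := geometric_sum_le m vv; rewrite ger0_norm.
- by rewrite h ltry.
Qed.

(** The partial geometric sums increase to the inverse of the volume, which is
    integrable against the kernel as [a > k]. *)
Lemma ong_limit_mean a K : k%:R <= K -> 1 <= K -> k%:R < a ->
  is_ong_limit k a (@ong_mean R k a K).
Proof.
move=> kK K1 ka disp T P U hU.
have K0 : 0 < K by exact: lt_le_trans K1.
have a0 : 0 < a by apply: le_lt_trans ka.
have mp := @measurable_pkern R a.
have p0 r : 0 <= pkern a r by rewrite pkern_ge0// ltW.
have hfin := integral_inv_vball_fin kK K1 ka.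
have h : ((\int[leb]_(r in `]0%R, K[) (pkern a r * \sum_(i < m) late_mean k i r)%:E)%E @[m --> \oo] -->
  \int[leb]_(r in `]0%R, K[) (pkern a r * @inv_vball_mean R k r)%:E)%E.
  apply: (@real_dominated_cvg _ _ R leb _ (fun m r => pkern a r * \sum_(i < m) late_mean k i r)
    (fun r => pkern a r * @inv_vball_mean R k r) (fun r => pkern a r * @inv_vball_mean R k r)) => //.
  - move=> m; apply: measurable_funTS; apply: measurable_funM => //.
    by apply: measurable_sum => i; exact: measurable_late_mean.
  - by apply: measurable_funTS; apply: measurable_funM => //; exact: measurable_inv_vball_mean.
  - move=> r; rewrite /= in_itv/= => /andP[r0 rK]; apply: cvgM; first exact: cvg_cst.
    by apply: (cvg_late_sum kK K1 r0); exact: ltW.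
  - move=> m r; rewrite /= in_itv/= => /andP[r0 rK].
    have /andP[h1 h2] := late_sum_le m kK K1 r0 (ltW rK).
    rewrite ger0_norm; last by apply: mulr_ge0.
    exact: ler_wpM2l.
have -> : ((ong_mean k a K)%:E = \int[leb]_(r in `]0%R, K[) (pkern a r * @inv_vball_mean R k r)%:E - (K `^ a)%:E)%E.
  rewrite /ong_mean EFinB fineK// ge0_fin_numE//.
  apply: integral_ge0 => r /=; rewrite in_itv/= => /andP[r0 rK].
  rewrite lee_fin mulr_ge0//.
  by have [_ /andP[]] := inv_vball_mean_fin kK K1 r0 (ltW rK).
apply: cvg_trans (cvgeB _ h (cvg_cst (K `^ a)%:E)); last by rewrite fin_num_adde_defl// fin_numN.
apply: near_eq_cvg; near=> m.
rewrite -(expected_ong_weight (hU m) a0 kK K1); last by near: m; exact: nbhs_infty_gt.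
by rewrite addeK.
Unshelve. all: by end_near. Qed.

(** For radii less than [1 / 4] a ball fills at most half of the cube, so that
    [inv_vball_mean] is at least [2] there and at least [1] elsewhere. *)
Lemma ong_mean_gt0 a K : (0 < k)%N -> k%:R <= K -> 1 <= K -> k%:R < a -> 0 < @ong_mean R k a K.
Proof.
move=> k0 kK K1 ka; have K0 : 0 < K by exact: lt_le_trans K1.
have a0 : 0 < a by apply: le_lt_trans ka.
have mc := @measurable_cube R k.
have mI : measurable (`]0, K[%classic : set R) by exact: measurable_itv.
have mp := @measurable_pkern R a.
have p0 r : 0 <= pkern a r by rewrite pkern_ge0// ltW.
have hfin := integral_inv_vball_fin kK K1 ka.
have mb : measurable_fun [set: R] (fun r : R => (r < 4^-1)%R%:R : R).
  by apply: measurable_natr_bool; exact: measurable_fun_ltr.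
have inv_ge r : 0 < r -> r < K -> 1 + (r < 4^-1)%R%:R <= @inv_vball_mean R k r.
  move=> r0 rK; have [h _] := inv_vball_mean_fin kK K1 r0 (ltW rK).
  rewrite -lee_fin -h.
  have -> : ((1 + (r < 4^-1)%R%:R)%:E = \int[lam k]_(u in @cube R k) (1 + (r < 4^-1)%R%:R)%:E)%E.
    by rewrite integral_cst//= ?lebesgue_tuple_cube ?mule1.
  apply: ge0_le_integral => //.
  - by apply/measurable_EFinP/measurable_funTS; exact: measurable_inv_vball.
  - move=> u cu; rewrite lee_fin.
    have v0 : 0 < vball u r.
      by apply: lt_le_trans (vball_lower cu kK K1 r0 (ltW rK)); rewrite exprn_gt0// divr_gt0// mulr_gt0.
    rewrite -[X in _ <= X]mul1r ler_pdivlMr//.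
    have [r4|r4] := ltP r 4^-1; last by rewrite mulr0n addr0 mul1r vball_le1.
    have r2 : 2 * r <= 2^-1 by move: r4; lra.
    have r20 : 0 <= 2 * r by rewrite mulr_ge0// ltW.
    have r21 : 2 * r <= 1 by move: r2; lra.
    have h1 : vball u r <= 2 * r.
      apply: le_trans (vball_upper u (ltW r0)) _.
      by rewrite -(prednK k0) exprS ler_piMr// exprn_ile1.
    by rewrite mulr1n; move: h1 r2; lra.
have h1 : ((K `^ a + (Num.min 4^-1 K) `^ a)%:E <= \int[leb]_(r in `]0%R, K[) (pkern a r * @inv_vball_mean R k r)%:E)%E.
  have m0 : 0 < Num.min 4^-1 K by rewrite lt_min K0 andbT invr_gt0.
  apply: (@le_trans _ _ (\int[leb]_(r in `]0%R, K[) ((pkern a r)%:E + (pkern a r * (r < 4^-1)%R%:R)%:E))%E).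
    rewrite ge0_integralD//=; last 4 first.
    - by move=> r _; rewrite lee_fin.
    - by apply/measurable_EFinP; exact: measurable_funTS.
    - by move=> r _; rewrite lee_fin; apply: mulr_ge0.
    - by apply/measurable_EFinP; apply: measurable_funTS; exact: measurable_funM.
    rewrite integral_pkern// EFinD; apply: leeD2l.
    rewrite -(integral_pkern a0 m0).
    rewrite integral_mkcond [X in (_ <= X)%E]integral_mkcond; apply: ge0_le_integral => //.
    - by move=> r _; rewrite patchE; case: ifP => // _; rewrite lee_fin.
    - by apply/(measurable_restrictT _ (measurable_itv _)); apply/measurable_EFinP; exact: measurable_funTS.
    - apply/(measurable_restrictT _ mI); apply/measurable_EFinP; apply: measurable_funTS; exact: measurable_funM.
    - move=> r _; rewrite !patchE !mem_setE !in_itv/= lt_min.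
      case: (0 < r) => //=; case: (r < 4^-1); case: (r < K) => //=.
        by rewrite mulr1.
      by rewrite mulr0.
  apply: ge0_le_integral => //.
  - by move=> r _; rewrite -EFinD lee_fin addr_ge0//; apply: mulr_ge0.
  - by apply/measurable_EFinP; apply: measurable_funTS; apply: measurable_funD => //; exact: measurable_funM.
  - by apply/measurable_EFinP; apply: measurable_funTS; apply: measurable_funM => //; exact: measurable_inv_vball_mean.
  - move=> r; rewrite /= in_itv/= => /andP[r0 rK]; rewrite -EFinD lee_fin.
    by have := ler_wpM2l (p0 r) (inv_ge r r0 rK); rewrite mulrDr mulr1.
rewrite /ong_mean subr_gt0 -lte_fin fineK; last first.
  by rewrite ge0_fin_numE//; apply: le_trans h1; rewrite lee_fin addr_ge0 ?powR_ge0.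
apply: lt_le_trans h1; rewrite lte_fin ltrDl powR_gt0//.
by rewrite lt_min K0 andbT invr_gt0.
Qed.

End ong_limit.

(** * The on-line nearest-neighbour graph on the line *)

Section dimension_one.
Context (R : realType).
Implicit Types (a h r s : R).

(** The length of [`[h - r, h + r]] inside the unit interval. *)
Definition seg_len h r : R := Num.min (h + r) 1 - Num.max (h - r) 0.

Lemma vball1 (x : 1.-tuple R) r : 0 < mlast x < 1 -> 0 < r ->
  vball x r = seg_len (mlast x) r.
Proof.
set h := mlast x => /andP[h0 h1] r0.
set lo := Num.max (h - r) 0; set hi := Num.min (h + r) 1.
have lohi : lo < hi by rewrite lt_min !gt_max; apply/andP; split; apply/andP; split; lra.
pose S : set R := [set y | 0 < y < 1 /\ `|h - y| <= r].
have mS : measurable S.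
  rewrite (_ : S = `]0, 1[%classic `&` `[h - r, h + r]%classic).
    by apply: measurableI; exact: measurable_itv.
  apply/seteqP; split => y; rewrite /S/= !in_itv/= ler_norml.
    by move=> [-> /andP[h2 h3]]; split => //; apply/andP; split; lra.
  by move=> [-> /andP[h2 h3]]; split => //; apply/andP; split; lra.
have SE : @cube R 1 `&` dball x r = [set y | [set: 0.-tuple R] (mbelast y) /\ S (mlast y)].
  have eE (y : 1.-tuple R) : (eucl x y <= r) = (`|h - mlast y| <= r).
    rewrite eucl_le (ltW r0)/= sqdistE_mrcons /sqdist big_ord0 add0r.
    by rewrite -[RHS]ler_sqr ?nnegrE ?(ltW r0)// real_normK ?num_real.
  apply/seteqP; split => y.
    by move=> [/cube_mrcons[_ hy]]; rewrite /dball/= eE.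
  move=> [_ [hy]]; rewrite -eE => e; split => //; apply/cube_mrcons; split => //.
  by move=> [].
have -> : vball x r = fine (leb S).
  rewrite /vball SE lebesgue_tuple_cylinder//=.
  by rewrite (_ : lam 0 [set: 0.-tuple R] = 1%E) ?mul1e//; exact: diracT.
have oS : `]lo, hi[%classic `<=` S.
  move=> y; rewrite /S/= in_itv/= gt_max lt_min => /andP[/andP[? ?] /andP[? ?]].
  by rewrite ler_norml; split; apply/andP; split; lra.
have Sc : S `<=` `[lo, hi]%classic.
  move=> y; rewrite /S/= => -[/andP[? ?]]; rewrite in_itv/= ler_norml ge_max le_min => /andP[? ?].
  by apply/andP; split; apply/andP; split; lra.
have -> : leb S = (hi - lo)%:E; last by [].
apply/eqP; rewrite eq_le; apply/andP; split.
  apply: (@le_trans _ _ (leb (`[lo, hi]%classic : set R))); first by apply: le_measure; rewrite ?inE//; exact: measurable_itv.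
  by rewrite lebesgue_measure_itv/= lte_fin lohi -EFinB.
apply: (@le_trans _ _ (leb (`]lo, hi[%classic : set R))); last by apply: le_measure; rewrite ?inE//; exact: measurable_itv.
by rewrite lebesgue_measure_itv/= lte_fin lohi -EFinB.
Qed.

(** The inverse of [seg_len] splits according to the ends of the unit interval that [`[h
    - r, h + r]] goes past: [0], [1], neither or both. *)
Definition cut_left h r : R := (0 < h)%R%:R * (h < r)%R%:R * (h + r < 1)%R%:R / (h + r).
Definition cut_right h r : R := cut_left (1 - h) r.
Definition uncut h r : R := (r <= h)%R%:R * (h + r <= 1)%R%:R / (2 * r).
Definition cut_both h r : R := (2^-1 < r)%R%:R * (1 - r <= h)%R%:R * (h <= r)%R%:R.

(** The boundaries between the four cases are shared out so that exactly one term is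
    nonzero everywhere, which makes the identity exact. *)
Lemma inv_seg_len h r : 0 < h < 1 -> 0 < r < 1 ->
  (seg_len h r)^-1 = cut_left h r + cut_right h r + (uncut h r + cut_both h r).
Proof.
move=> /andP[h0 h1] /andP[r0 r1]; rewrite /seg_len /cut_right /cut_left /uncut /cut_both.
rewrite h0 subr_gt0 h1 !mul1r.
have [l1|l1] := ltP (h + r) 1; have [l2|l2] := ltP (h - r) 0.
- have -> : h < r by lra. have -> : (1 - h < r) = false by apply/negbTE; rewrite -leNgt; lra.
  have -> : (r <= h) = false by apply/negbTE; rewrite -ltNge; lra.
  have -> : (1 - r <= h) = false by apply/negbTE; rewrite -ltNge; lra.
  by rewrite !mulr0n !mulr1n !(mul0r, mulr0, mul1r, addr0, subr0).
- have -> : (h < r) = false by apply/negbTE; rewrite -leNgt; lra.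
  have -> : (1 - h < r) = false by apply/negbTE; rewrite -leNgt; lra.
  have -> : r <= h by lra. have -> : h + r <= 1 by lra.
  have -> : (1 - r <= h) = false by apply/negbTE; rewrite -ltNge; lra.
  rewrite !mulr0n !mulr1n !(mul0r, mulr0, mul1r, addr0, add0r); congr (_^-1); ring.
- have -> : h < r by lra.
  have -> : (1 - h + r < 1) = false by apply/negbTE; rewrite -leNgt; lra.
  have -> : (r <= h) = false by apply/negbTE; rewrite -ltNge; lra.
  have -> : 2^-1 < r by lra. have -> : 1 - r <= h by lra. have -> : h <= r by lra.
  by rewrite !mulr0n !mulr1n !(mul0r, mulr0, mul1r, addr0, add0r, subr0, invr1).
have [hr|hr] := eqVneq h r; last first.
  have {hr}hr : r < h by rewrite lt_neqAle eq_sym hr; lra.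
  have [e|e] := eqVneq (h + r) 1; last first.
  + have {e}e : 1 < h + r by rewrite lt_neqAle eq_sym e.
    have -> : (h < r) = false by apply/negbTE; rewrite -leNgt; lra.
    have -> : 1 - h < r by lra. have -> : 1 - h + r < 1 by lra.
    have -> : (h + r <= 1) = false by apply/negbTE; rewrite -ltNge; lra.
    have -> : (h <= r) = false by apply/negbTE; rewrite -ltNge; lra.
    rewrite !mulr0n !mulr1n !(mul0r, mulr0, mul1r, addr0, add0r); congr (_^-1); ring.
  + have -> : (h < r) = false by apply/negbTE; rewrite -leNgt; lra.
    have -> : (1 - h < r) = false by apply/negbTE; rewrite -leNgt; lra.
    have -> : (h + r <= 1) by lra. have -> : r <= h by lra.
    have -> : (h <= r) = false by apply/negbTE; rewrite -ltNge; lra.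
    rewrite !mulr0n !mulr1n !(mul0r, mulr0, mul1r, addr0, add0r); congr (_^-1); lra.
rewrite hr ltxx lexx !(mul0r, mulr0, add0r, mul1r).
have -> : (1 - r + r < 1) = false by rewrite subrK ltxx.
rewrite mulr0n !(mul0r, mulr0, add0r, mul1r) mulr1n mulr1.
have [e|e] := eqVneq (r + r) 1; last first.
+ have {e}e : 1 < r + r by rewrite lt_neqAle eq_sym e -hr; move: l1; rewrite hr.
  have -> : (r + r <= 1) = false by apply/negbTE; rewrite -ltNge.
  have -> : 2^-1 < r by lra. have -> : 1 - r <= r by lra.
  by rewrite !mulr0n !mulr1n !(mul0r, mulr0, mul1r, addr0, add0r, subrr, subr0, invr1).
have -> : r + r <= 1 by lra. have -> : (2^-1 < r) = false by apply/negbTE; rewrite -leNgt; lra.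
rewrite !mulr0n !mulr1n !(mul0r, mulr0, mul1r, addr0, add0r, subrr, subr0).
congr (_^-1); lra.
Qed.

Lemma integral_restrict (D D' : set R) (b : R -> bool) (f : R -> R) :
  (forall x, D' x <-> D x /\ b x) ->
  (\int[leb]_(x in D) (f x * (b x)%:R)%:E = \int[leb]_(x in D') (f x)%:E)%E.
Proof.
move=> h; rewrite integral_mkcond [RHS]integral_mkcond; apply: eq_integral => x _.
rewrite !patchE; have [xD|xD] := boolP (x \in D).
  have -> : (x \in D') = b x.
    by apply/idP/idP; rewrite inE; [move=> /h[]|move=> bx; apply/h; split => //; exact: set_mem].
  by case: (b x); rewrite ?mulr1 ?mulr0.
by rewrite (memNset _)// => /h[/mem_set]; rewrite (negbTE xD).
Qed.

Lemma integral_pkern_oo a s r : 0 < s -> s < r ->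
  (\int[leb]_(t in `]s, r[) (pkern a t)%:E = (r `^ a - s `^ a)%:E)%E.
Proof.
move=> s0 sr; have m D : measurable_fun D (fun t => (@pkern R a t)%:E).
  by apply/measurable_EFinP/measurable_funTS; exact: measurable_pkern.
by rewrite integral_itv_bndo_bndc// integral_itv_obnd_cbnd// integral_pkern_itv.
Qed.

Lemma integral_inv_seg_len r : 0 < r < 1 ->
  ((@inv_vball_mean R 1 r)%:E = \int[leb]_(h in `]0%R, 1%R[) ((seg_len h r)^-1)%:E)%E.
Proof.
move=> /andP[r0 r1].
have [<- _] := @inv_vball_mean_fin R 1 r 1 (lexx _) (lexx _) r0 (ltW r1).
have ml : measurable_fun [set: R] (fun h => seg_len h r).
  rewrite /seg_len; apply: measurable_funB.
    by apply: measurable_minr => //; exact: measurable_funD.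
  by apply: measurable_maxr => //; exact: measurable_funB.
transitivity (\int[lam 1]_(x in @cube R 1) (`|seg_len (mlast x) r|^-1)%:E)%E.
  apply: eq_integral => x; rewrite inE => /cube_mrcons[_ x01].
  by rewrite -vball1// ger0_norm// vball_ge0.
rewrite (@integral_cube_mlast R 0 (fun h => `|seg_len h r|^-1)) => [||h]; last by rewrite invr_ge0.
  apply: eq_integral => h; rewrite inE/= in_itv/= => /andP[h0 h1]; rewrite ger0_norm//.
  by rewrite /seg_len subr_ge0 le_min !ge_max; apply/andP; split; apply/andP; split; lra.
by apply: measurable_inv_fun; exact: measurableT_comp.
Qed.

Lemma cut_left_ge0 h r : 0 < r -> 0 <= cut_left h r.
Proof.
move=> r0; rewrite /cut_left; case: (ltP 0 h) => h0; last by rewrite !mul0r.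
by rewrite !mulr_ge0// invr_ge0 addr_ge0// ltW.
Qed.

Lemma measurable_cut_left : measurable_fun [set: R * R] (fun p => cut_left p.1 p.2).
Proof.
apply: measurable_funM; last first.
  by apply: measurable_inv_fun; apply: measurable_funD; [exact: measurable_fst|exact: measurable_snd].
apply: measurable_funM; last first.
  apply: measurable_natr_bool; apply: measurable_fun_ltr => //.
  by apply: measurable_funD; [exact: measurable_fst|exact: measurable_snd].
apply: measurable_funM; apply: measurable_natr_bool; apply: measurable_fun_ltr => //.
Qed.

Lemma measurable_cut_left_at r : measurable_fun [set: R] (fun h => cut_left h r).
Proof.
apply: (@measurableT_comp _ _ _ _ _ _ (fun p : R * R => cut_left p.1 p.2) _ (fun h : R => (h, r))).
  exact: measurable_cut_left.
exact: measurable_fun_pair.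
Qed.

(** The reflection [h |-> 1 - h]. *)
Lemma integral_cut_right r : 0 < r ->
  (\int[leb]_(h in `]0%R, 1%R[) (cut_right h r)%:E = \int[leb]_(h in `]0%R, 1%R[) (cut_left h r)%:E)%E.
Proof.
move=> r0.
have total (f : R -> R) : (forall h, ~~ (0 < h < 1) -> f h = 0) ->
    (\int[leb]_(h in `]0%R, 1%R[) (f h)%:E = \int[leb]_h (f h)%:E)%E.
  move=> f0; rewrite integral_mkcond; apply: eq_integral => h _.
  by rewrite patchE mem_setE in_itv/=; case: ifPn => // /f0 ->.
have cl h : ~~ (0 < h < 1) -> cut_left h r = 0.
  rewrite /cut_left; case: (ltP 0 h) => h0 /=; last by rewrite !mul0r.
  rewrite -leNgt => h1; have -> : (h + r < 1) = false by apply/negbTE; rewrite -leNgt; lra.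
  by rewrite mulr0 mul0r.
rewrite total; last first.
  move=> h hn; rewrite /cut_right cl//; apply: contra hn => /andP[h0 h1].
  by apply/andP; split; lra.
rewrite total//.
have n1 : (-1 : R) != 0 by rewrite oppr_eq0.
have m : measurable_fun [set: R] (fun h => (cut_left h r)%:E).
  by apply/measurable_EFinP; exact: measurable_cut_left_at.
have h0 h : (0 <= (cut_left h r)%:E)%E by rewrite lee_fin cut_left_ge0.
have := ge0_integral_affine 1 n1 m h0.
rewrite normrN1 invr1 mul1e => <-; apply: eq_integral => h _.
by rewrite /cut_right mulN1r.
Qed.

Lemma integral_uncut r : 0 < r -> r < 1 ->
  (\int[leb]_(h in `]0%R, 1%R[) (uncut h r)%:E = ((1 - 2 * r) / (2 * r) * (r < 2^-1)%R%:R)%:E)%E.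
Proof.
move=> r0 r1; have mI : measurable (`[r, 1 - r]%classic : set R) by exact: measurable_itv.
transitivity (\int[leb]_(h in `]0%R, 1%R[) ((2 * r)^-1 * ((r <= h) && (h <= 1 - r))%R%:R)%:E)%E.
  apply: eq_integral => h _; rewrite /uncut lerBrDr mulrC; congr (_ * _)%:E.
  by case: (r <= h); case: (h + r <= 1); rewrite ?mulr1 ?mulr0.
rewrite (@integral_restrict _ `[r, 1 - r]%classic).
  rewrite integral_cst//= lebesgue_measure_itv/= lte_fin.
  have -> : (r < 1 - r) = (r < 2^-1) by apply/idP/idP; lra.
  case: ifP => _; last by rewrite mule0 mulr0.
  by rewrite -EFinB -EFinM mulr1; congr EFin; rewrite mulrC; congr (_ / _); ring.
move=> h /=; rewrite !in_itv/=; split.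
  by move=> /andP[h1 h2]; rewrite h1 h2; split => //; apply/andP; split; lra.
by move=> [].
Qed.

Lemma integral_cut_both r : 0 < r -> r < 1 ->
  (\int[leb]_(h in `]0%R, 1%R[) (cut_both h r)%:E = ((2 * r - 1) * (2^-1 < r)%R%:R)%:E)%E.
Proof.
move=> r0 r1; have mI : measurable (`[1 - r, r]%classic : set R) by exact: measurable_itv.
transitivity (\int[leb]_(h in `]0%R, 1%R[) ((2^-1 < r)%R%:R * ((1 - r <= h) && (h <= r))%R%:R)%:E)%E.
  apply: eq_integral => h _; rewrite /cut_both -mulrA; congr (_ * _)%:E.
  by case: (1 - r <= h); case: (h <= r); rewrite ?mulr1 ?mulr0.
rewrite (@integral_restrict _ `[1 - r, r]%classic).
  rewrite integral_cst//= lebesgue_measure_itv/= lte_fin.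
  have -> : (1 - r < r) = (2^-1 < r) by apply/idP/idP; lra.
  case: ifP => _; last by rewrite mule0 mulr0.
  by rewrite mul1e -EFinB mulr1; congr EFin; ring.
move=> h /=; rewrite !in_itv/=; split.
  by move=> /andP[h1 h2]; rewrite h1 h2; split => //; apply/andP; split; lra.
by move=> [].
Qed.

Let mI : measurable (`]0, 1[%classic : set R). Proof. exact: measurable_itv. Qed.

Lemma pkern_divr a r : 1 < a -> 0 < r -> pkern a r / r = a / (a - 1) * pkern (a - 1) r.
Proof. by move=> a1 r0; have := @pkern_divX R 1 a r a1 r0; rewrite expr1. Qed.

Lemma pkern_mulr a r : 0 < a -> 0 < r -> pkern a r * r = a / (a + 1) * pkern (a + 1) r.
Proof.
move=> a0 r0; have a1 : 1 < a + 1 by rewrite ltrDr.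
have := pkern_divr a1 r0; rewrite addrK => h.
have a10 : a + 1 != 0 by rewrite gt_eqF// addr_gt0.
have -> : pkern (a + 1) r = (a + 1) / a * pkern a r * r by rewrite -h divfK// gt_eqF.
by field; rewrite a10 gt_eqF.
Qed.

Lemma integral_diff (D : set R) (f g h : R -> R) (x y : R) : measurable D ->
  measurable_fun [set: R] f -> measurable_fun [set: R] h ->
  (forall t, D t -> 0 <= f t) -> (forall t, D t -> 0 <= h t) ->
  (forall t, D t -> f t + h t = g t) ->
  (\int[leb]_(t in D) (h t)%:E = x%:E)%E -> (\int[leb]_(t in D) (g t)%:E = y%:E)%E ->
  (\int[leb]_(t in D) (f t)%:E = (y - x)%:E)%E.
Proof.
move=> mD mf mh f0 h0 fhg hx gy.
have e : (\int[leb]_(t in D) (f t)%:E + x%:E = y%:E)%E.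
  rewrite -hx -gy -ge0_integralD//=.
  - by apply: eq_integral => t; rewrite inE => Dt; rewrite -EFinD fhg.
  - by apply/measurable_EFinP; exact: measurable_funTS.
  - by apply/measurable_EFinP; exact: measurable_funTS.
by rewrite EFinB -e addeK.
Qed.

Lemma integral_pkernM (D : set R) a c y : measurable D -> 0 < a -> 0 <= c ->
  (\int[leb]_(r in D) (pkern a r)%:E = y%:E)%E ->
  (\int[leb]_(r in D) (c * pkern a r)%:E = (c * y)%:E)%E.
Proof.
move=> mD a0 c0 h; rewrite EFinM -h -ge0_integralZl//=.
- by apply/measurable_EFinP/measurable_funTS; exact: measurable_pkern.
- by move=> r _; rewrite lee_fin pkern_ge0// ltW.
Qed.

Lemma powR_half a : (2^-1 : R) `^ a = 2 `^ (- a).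
Proof. by rewrite -[2^-1](powR_inv1 (ler0n R 2)) -powRrM mulN1r. Qed.

Lemma half_powRD1 a : (2^-1 : R) `^ (a + 1) = 2 `^ (- a) / 2.
Proof.
have h0 : (0 : R) < 2^-1 by rewrite invr_gt0.
by rewrite powRD ?(gt_eqF h0) ?implybT// powR_half powRr1// ltW.
Qed.

Lemma half_powRB1 a : (2^-1 : R) `^ (a - 1) = 2 `^ (- a) * 2.
Proof.
have h0 : (0 : R) < 2^-1 by rewrite invr_gt0.
by rewrite powRB ?(gt_eqF h0) ?implybT// powR_half powRr1 ?(ltW h0)// invrK.
Qed.

Lemma integral_pkern_uncut a : 1 < a ->
  (\int[leb]_(r in `]0%R, 1%R[) (pkern a r * ((1 - 2 * r) / (2 * r) * (r < 2^-1)%R%:R))%:E =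
   (2 `^ (- a) / (a - 1))%:E)%E.
Proof.
move=> a1; have a0 : 0 < a by exact: lt_trans a1.
have h0 : (0 : R) < 2^-1 by rewrite invr_gt0.
have p0 r : 0 <= @pkern R a r by rewrite pkern_ge0// ltW.
under eq_integral do rewrite mulrA.
rewrite (@integral_restrict _ `]0, 2^-1[%classic); last first.
  move=> h /=; rewrite !in_itv/=; split; last by move=> [/andP[-> _]].
  by move=> /andP[h1 h2]; rewrite h1 h2; split => //; lra.
have a10 : 0 < a - 1 by rewrite subr_gt0.
have -> : 2 `^ (- a) / (a - 1) = a / (a - 1) / 2 * (2^-1) `^ (a - 1) - 2^-1 `^ a.
  by rewrite half_powRB1 powR_half; field; rewrite gt_eqF.
apply: (@integral_diff _ _ (fun r => a / (a - 1) / 2 * pkern (a - 1) r) (pkern a)).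
- exact: measurable_itv.
- apply: measurable_funM; first exact: measurable_pkern.
  apply: measurable_funM; last by apply: measurable_inv_fun; exact: measurable_funM.
  by apply: measurable_funB => //; exact: measurable_funM.
- exact: measurable_pkern.
- move=> r; rewrite /= in_itv/= => /andP[r0 r2]; rewrite mulr_ge0// divr_ge0//; lra.
- by [].
- move=> r; rewrite /= in_itv/= => /andP[r0 r2].
  have -> : a / (a - 1) / 2 * pkern (a - 1) r = pkern a r / r / 2.
    by rewrite pkern_divr//; ring.
  by field; rewrite gt_eqF.
- exact: integral_pkern.
- apply: integral_pkernM => //; last exact: integral_pkern.
  by rewrite !divr_ge0// ltW.
Qed.

Lemma integral_pkern_cut_both a : 0 < a ->
  (\int[leb]_(r in `]0%R, 1%R[) (pkern a r * ((2 * r - 1) * (2^-1 < r)%R%:R))%:E =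
   (2 * a / (a + 1) * (1 - 2 `^ (- a) / 2) - (1 - 2 `^ (- a)))%:E)%E.
Proof.
move=> a0; have h0 : (0 : R) < 2^-1 by rewrite invr_gt0.
have h1 : (2^-1 : R) < 1 by rewrite invf_lt1// ltr1n.
have p0 r : 0 <= @pkern R a r by rewrite pkern_ge0// ltW.
have a1 : 0 < a + 1 by rewrite addr_gt0.
under eq_integral do rewrite mulrA.
rewrite (@integral_restrict _ `]2^-1, 1[%classic); last first.
  move=> h /=; rewrite !in_itv/=; split; last by move=> [/andP[_ ->] ->].
  by move=> /andP[h2 h3]; rewrite h2 h3; split => //; lra.
apply: (@integral_diff _ _ (fun r => 2 * a / (a + 1) * pkern (a + 1) r) (pkern a)).
- exact: measurable_itv.
- apply: measurable_funM; first exact: measurable_pkern.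
  by apply: measurable_funB => //; exact: measurable_funM.
- exact: measurable_pkern.
- move=> r; rewrite /= in_itv/= => /andP[r0 r2]; rewrite mulr_ge0//; lra.
- by [].
- move=> r; rewrite /= in_itv/= => /andP[r0 r2].
  have -> : 2 * a / (a + 1) * pkern (a + 1) r = 2 * (pkern a r * r).
    by rewrite (pkern_mulr a0 (lt_trans h0 r0)); set q := pkern _ _; field; rewrite gt_eqF.
  by ring.
- by rewrite integral_pkern_oo// powR1 powR_half.
- apply: integral_pkernM => //; first by rewrite divr_ge0 ?mulr_ge0// ltW.
  by rewrite integral_pkern_oo// powR1 half_powRD1.
Qed.

(** In the coordinates [r] and [s = h + r] the integrand is [pkern a r / s] on [s / 2 <
    r < s < 1], where the integral over [r] is elementary. *)
Lemma integral_pkern_cut_left a : 0 < a ->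
  (\int[leb]_(r in `]0%R, 1%R[) ((pkern a r)%:E * \int[leb]_(h in `]0%R, 1%R[) (cut_left h r)%:E) =
   ((1 - 2 `^ (- a)) / a)%:E)%E.
Proof.
move=> a0; have p0 r : 0 <= @pkern R a r by rewrite pkern_ge0// ltW.
pose F (p : R * R) := (pkern a p.1 * ((p.1 < p.2)%R%:R * (p.2 < 2 * p.1)%R%:R * `|p.2|^-1))%:E.
have mF : measurable_fun [set: R * R] F.
  apply/measurable_EFinP; apply: measurable_funM.
    by apply: (measurableT_comp (@measurable_pkern R a)); exact: measurable_fst.
  apply: measurable_funM; last first.
    by apply: measurable_inv_fun; apply: measurableT_comp => //; exact: measurable_snd.
  apply: measurable_funM; apply: measurable_natr_bool; apply: measurable_fun_ltr.
  - exact: measurable_fst.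
  - exact: measurable_snd.
  - exact: measurable_snd.
  - by apply: measurable_funM => //; exact: measurable_fst.
have F0 p : (0 <= F p)%E by rewrite lee_fin; apply: mulr_ge0 => //; rewrite mulr_ge0// invr_ge0.
transitivity (\int[leb]_(r in `]0%R, 1%R[) \int[leb]_(s in `]0%R, 1%R[) F (r, s))%E.
  apply: eq_integral => r; rewrite inE/= in_itv/= => /andP[r0 r1].
  rewrite -ge0_integralZl//=; last 3 first.
  - by apply/measurable_EFinP/measurable_funTS; exact: measurable_cut_left_at.
  - by move=> h _; rewrite lee_fin cut_left_ge0.
  - by rewrite lee_fin.
  pose G s := ((r < s)%R%:R * (s < 2 * r)%R%:R * (s < 1)%R%:R * `|s|^-1)%:E.
  have mG : measurable_fun [set: R] G.
    apply/measurable_EFinP; apply: measurable_funM; last first.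
      by apply: (@measurable_inv_fun _ R R); exact: normr_measurable.
    by apply: measurable_funM; [apply: measurable_funM|]; apply: measurable_natr_bool; exact: measurable_fun_ltr.
  have G0 s : (0 <= G s)%E by rewrite lee_fin !mulr_ge0// invr_ge0.
  have n1 : (1 : R) != 0 by [].
  have := ge0_integral_affine r n1 mG G0; rewrite normr1 invr1 mul1e => hG.
  rewrite ge0_integralZl//=; last 3 first.
  - by apply/measurable_EFinP/measurable_funTS; exact: measurable_cut_left_at.
  - by move=> h _; rewrite lee_fin cut_left_ge0.
  - by rewrite lee_fin.
  transitivity ((pkern a r)%:E * \int[leb]_s G s)%E.
    congr (_ * _)%E; rewrite -hG integral_mkcond; apply: eq_integral => h _.
    rewrite patchE mem_setE in_itv/= /G mul1r /cut_left ltrDl.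
    have -> : (r + h < 2 * r) = (h < r) by apply/idP/idP; lra.
    rewrite (addrC r h).
    case: (ltP 0 h) => h0 /=; last by rewrite !mul0r.
    case: (ltP h 1) => h1; last first.
      have -> : (h + r < 1) = false by apply/negbTE; rewrite -leNgt; lra.
      by rewrite mulr0 mul0r.
    by rewrite ger0_norm// addr_ge0// ltW.
  rewrite -ge0_integralZl//=; last by rewrite lee_fin.
  rewrite [RHS]integral_mkcond; apply: eq_integral => s _.
  rewrite patchE mem_setE in_itv/= /F /G /= -EFinM.
  case: (ltP 0 s) => s0 /=; last first.
    have -> : (r < s) = false by apply/negbTE; rewrite -leNgt; lra.
    by rewrite !mul0r mulr0.
  by case: (s < 1); rewrite ?mulr1// !(mulr0, mul0r).
rewrite (@tonelli_in _ _ _ _ R leb leb _ _ mI mI F mF F0).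
have q0 : 0 <= (1 - 2 `^ (- a)) / a.
  rewrite divr_ge0 ?(ltW a0)// subr_ge0 powRN invf_le1 ?powR_gt0//.
  by rewrite -[X in X <= _](powRr0 2) ler_powR ?ler1n// ltW.
transitivity (\int[leb]_(s in `]0%R, 1%R[) ((1 - 2 `^ (- a)) / a * pkern a s)%:E)%E; last first.
  have h1 : (\int[leb]_(s in `]0%R, 1%R[) (@pkern R a s)%:E = 1%:E)%E by rewrite integral_pkern// powR1.
  by rewrite (integral_pkernM _ a0 q0 h1)// mulr1.
apply: eq_integral => s; rewrite inE/= in_itv/= => /andP[s0 s1].
have s20 : 0 < s / 2 by rewrite divr_gt0.
have s2s : s / 2 < s by lra.
transitivity (\int[leb]_(r in `]0%R, 1%R[) (s^-1 * pkern a r * ((s / 2 < r) && (r < s))%R%:R)%:E)%E.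
  apply: eq_integral => r _; rewrite /F/= gtr0_norm//; congr EFin.
  have -> : (s < 2 * r) = (s / 2 < r) by apply/idP/idP; lra.
  case: (r < s); case: (s / 2 < r); rewrite /= ?mulr0n ?mulr1n; ring.
rewrite (@integral_restrict _ `]s / 2, s[%classic); last first.
  move=> r /=; rewrite !in_itv/=; split; last by move=> [].
  by move=> /andP[r1 r2]; rewrite r1 r2; split => //; apply/andP; split; lra.
rewrite (@integral_pkernM _ _ _ (s `^ a - (s / 2) `^ a))//.
- congr EFin; rewrite powRM ?(ltW s0) ?invr_ge0// powR_half /pkern.
  have -> : s `^ a = s * s `^ (a - 1).
    rewrite -[X in _ = X * _](powRr1 (ltW s0)) -powRD ?(gt_eqF s0) ?implybT//.
    by rewrite addrC subrK.
  by field; rewrite !gt_eqF.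
- by rewrite invr_ge0 ltW.
- exact: integral_pkern_oo.
Qed.

Lemma ong_mean1E a : 2 <= a ->
  @ong_mean R 1 a 1 = 2 / (a * (a + 1)) * (1 + 2 `^ (- a) / (a - 1)).
Proof.
move=> a2; have a1 : 1 < a by apply: lt_le_trans a2; rewrite ltr1n.
have a0 : 0 < a by exact: lt_trans a1.
have p0 r : 0 <= @pkern R a r by rewrite pkern_ge0// ltW.
pose u r := pkern a r * ((1 - 2 * r) / (2 * r) * (r < 2^-1)%R%:R).
pose v r := pkern a r * ((2 * r - 1) * (2^-1 < r)%R%:R).
pose L r := ((pkern a r)%:E * \int[leb]_(h in `]0%R, 1%R[) (cut_left h r)%:E)%E.
have u0 r : 0 < r -> 0 <= u r.
  move=> r0; apply: mulr_ge0 => //; case: (ltP r 2^-1) => r2; last by rewrite mulr0.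
  by rewrite mulr1n mulr1 divr_ge0//; lra.
have v0 r : 0 <= v r.
  apply: mulr_ge0 => //; case: (ltP 2^-1 r) => r2; last by rewrite mulr0.
  by rewrite mulr1n mulr1; lra.
have mu : measurable_fun [set: R] u.
  apply: measurable_funM; first exact: measurable_pkern.
  apply: measurable_funM; last by apply: measurable_natr_bool; exact: measurable_fun_ltr.
  apply: measurable_funM; last by apply: measurable_inv_fun; exact: measurable_funM.
  by apply: measurable_funB => //; exact: measurable_funM.
have mv : measurable_fun [set: R] v.
  apply: measurable_funM; first exact: measurable_pkern.
  apply: measurable_funM; last by apply: measurable_natr_bool; exact: measurable_fun_ltr.
  by apply: measurable_funB => //; exact: measurable_funM.
have mL : measurable_fun (`]0, 1[%classic : set R) L.
  pose G (p : R * R) := (`|cut_left p.2 p.1|)%:E.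
  have mG : measurable_fun [set: R * R] G.
    apply/measurable_EFinP; apply: measurableT_comp => //.
    apply: (@measurableT_comp _ _ _ _ _ _ (fun p : R * R => cut_left p.1 p.2) _ (fun p : R * R => (p.2, p.1))).
      exact: measurable_cut_left.
    by apply: measurable_fun_pair; [exact: measurable_snd|exact: measurable_fst].
  have G0 p : (0 <= G p)%E by rewrite lee_fin.
  apply: (@eq_measurable_fun _ _ _ _ _ (fun r => (pkern a r)%:E * \int[leb]_(h in `]0%R, 1%R[) G (r, h))%E).
    move=> r; rewrite inE/= in_itv/= => /andP[r0 r1]; congr (_ * _)%E; apply: eq_integral => h _.
    by rewrite /G ger0_norm// cut_left_ge0.
  apply: measurable_funTS; apply: emeasurable_funM.
    by apply/measurable_EFinP; exact: measurable_pkern.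
  exact: (@measurable_integral_in _ _ _ _ R leb _ _ mI mG G0).
have L0 r : `]0, 1[%classic r -> (0 <= L r)%E.
  rewrite /= in_itv/= => /andP[r0 r1]; apply: mule_ge0; first by rewrite lee_fin.
  by apply: integral_ge0 => h _; rewrite lee_fin cut_left_ge0.
have mu' : measurable_fun (`]0, 1[%classic : set R) (fun r => (u r)%:E).
  by apply/measurable_EFinP; exact: measurable_funTS.
have mv' : measurable_fun (`]0, 1[%classic : set R) (fun r => (v r)%:E).
  by apply/measurable_EFinP; exact: measurable_funTS.
have u0' r : `]0, 1[%classic r -> (0 <= (u r)%:E)%E.
  by rewrite /= in_itv/= => /andP[r0 _]; rewrite lee_fin u0.
have JE : (\int[leb]_(r in `]0%R, 1%R[) (pkern a r * @inv_vball_mean R 1 r)%:E =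
  \int[leb]_(r in `]0%R, 1%R[) (L r + L r + ((u r)%:E + (v r)%:E)))%E.
  apply: eq_integral => r; rewrite inE/= in_itv/= => /andP[r0 r1].
  rewrite EFinM integral_inv_seg_len ?r0//.
  have mcl := measurable_cut_left_at r.
  have mcr : measurable_fun [set: R] (fun h => cut_right h r).
    by apply: (measurableT_comp mcl); exact: measurable_funB.
  have mun : measurable_fun [set: R] (fun h => uncut h r).
    apply: measurable_funM => //.
    apply: measurable_funM; apply: measurable_natr_bool; apply: measurable_fun_ler => //.
    exact: measurable_funD.
  have mcb : measurable_fun [set: R] (fun h => cut_both h r).
    by apply: measurable_funM; [apply: measurable_funM => //|]; apply: measurable_natr_bool; exact: measurable_fun_ler.
  have mE (f : R -> R) : measurable_fun [set: R] f -> measurable_fun (`]0, 1[%classic : set R) (fun h => (f h)%:E).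
    by move=> mf; apply/measurable_EFinP; exact: measurable_funTS.
  have un0 h : 0 <= uncut h r by rewrite mulr_ge0// invr_ge0 mulr_ge0// ltW.
  have cb0 h : 0 <= cut_both h r by rewrite !mulr_ge0.
  have -> : (\int[leb]_(h in `]0%R, 1%R[) ((seg_len h r)^-1)%:E =
    \int[leb]_(h in `]0%R, 1%R[) (cut_left h r)%:E + \int[leb]_(h in `]0%R, 1%R[) (cut_left h r)%:E
    + (((1 - 2 * r) / (2 * r) * (r < 2^-1)%R%:R)%:E + ((2 * r - 1) * (2^-1 < r)%R%:R)%:E))%E.
    rewrite -{2}integral_cut_right// -integral_uncut// -integral_cut_both//.
    transitivity (\int[leb]_(h in `]0%R, 1%R[)
      (((cut_left h r)%:E + (cut_right h r)%:E) + ((uncut h r)%:E + (cut_both h r)%:E)))%E.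
      apply: eq_integral => h; rewrite inE/= in_itv/= => h01.
      by rewrite -!EFinD inv_seg_len// r0.
    rewrite ge0_integralD//=; last 4 first.
    - by move=> h _; rewrite -EFinD lee_fin addr_ge0// cut_left_ge0.
    - by apply: emeasurable_funD; exact: mE.
    - by move=> h _; rewrite -EFinD lee_fin addr_ge0.
    - by apply: emeasurable_funD; exact: mE.
    rewrite ge0_integralD//=; last 4 first.
    - by move=> h _; rewrite lee_fin cut_left_ge0.
    - exact: mE.
    - by move=> h _; rewrite lee_fin cut_left_ge0.
    - exact: mE.
    rewrite ge0_integralD//=.
    - by move=> h _; rewrite lee_fin.
    - exact: mE.
    - by move=> h _; rewrite lee_fin.
    - exact: mE.
  rewrite /u /v /L.
  have I0 : (0 <= \int[leb]_(h in `]0%R, 1%R[) (cut_left h r)%:E)%E.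
    by apply: integral_ge0 => h _; rewrite lee_fin cut_left_ge0.
  have w0 : 0 <= (1 - 2 * r) / (2 * r) * (r < 2^-1)%R%:R.
    case: (ltP r 2^-1) => r2; last by rewrite mulr0.
    by rewrite mulr1n mulr1 divr_ge0//; lra.
  have z0 : 0 <= (2 * r - 1) * (2^-1 < r)%R%:R.
    case: (ltP 2^-1 r) => r2; last by rewrite mulr0.
    by rewrite mulr1n mulr1; lra.
  set W := _ * (r < 2^-1)%R%:R in w0 *; set Z := _ * (2^-1 < r)%R%:R in z0 *.
  set I := (\int[leb]_(h in _) _)%E in I0 *; set p := pkern a r.
  have W0 : (0 <= W%:E)%E by rewrite lee_fin.
  have Z0 : (0 <= Z%:E)%E by rewrite lee_fin.
  clearbody I W Z p.
  by rewrite (EFinM p W) (EFinM p Z) ge0_muleDr ?adde_ge0// !ge0_muleDr.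
rewrite /ong_mean JE powR1 ge0_integralD//=; last 4 first.
- by move=> r Dr; apply: adde_ge0; exact: L0.
- exact: emeasurable_funD.
- by move=> r Dr; apply: adde_ge0; [exact: u0'|rewrite lee_fin].
- exact: emeasurable_funD.
rewrite ge0_integralD//= ge0_integralD//=; last by move=> r _; rewrite lee_fin.
rewrite integral_pkern_cut_left// integral_pkern_uncut// integral_pkern_cut_both//=.
have n0 : a != 0 by rewrite gt_eqF.
have n1 : a + 1 != 0 by rewrite gt_eqF// addr_gt0.
have n2 : a - 1 != 0 by rewrite gt_eqF// subr_gt0.
by set x := 2 `^ (- a); field; rewrite n0 n1 n2.
Qed.

End dimension_one.

(** * The theorem *)

Theorem theorem2p1 (R : realType) (d : nat) (hd : (2 <= d)%N) :
  (forall alpha : R, 0 < alpha -> alpha < d%:R ->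
    forall disp (T : measurableType disp) (P : probability T R)
      (X : R -> T -> {fset d.-tuple R}),
      (forall n, 0 < n -> is_poisson_process P n (X n)) ->
      cvg_L1 P
        (fun n w => n `^ (alpha / d%:R - 1) * mdst_weight alpha (X n w))
        (2 `^ (alpha / d%:R) * Gamma (1 + alpha / d%:R)
          * unit_ball_volume R d `^ (- (alpha / d%:R)))) /\
  (forall alpha : R, d%:R <= alpha ->
    exists mu' : R, 0 < mu' /\
      (forall disp (T : measurableType disp) (P : probability T R)
        (X : R -> T -> {fset d.-tuple R}),
        (forall n, 0 < n -> is_poisson_process P n (X n)) ->
        ('E_P[fun w => mdst_weight alpha (X n w)])%E @[n --> +oo] --> mu'%:E) /\
      exists mu : R, 0 < mu /\
        is_ong_limit d.-1 alpha mu /\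
        mu' = mu + (if alpha == d%:R then 2 * (unit_ball_volume R d)^-1
                    else 0)) /\
  (forall alpha : R, 2 <= alpha ->
    is_ong_limit 1 alpha
      (2 / (alpha * (alpha + 1)) * (1 + 2 `^ (- alpha) / (alpha - 1)))).
Proof.
case: d hd => [|k] // hk; have k0 : (0 < k)%N by [].
split=> [alpha alpha0 alphad disp T P X hX|].
  by rewrite unit_ball_volumeE; exact: mdst_weight_cvg_L1.
split=> [alpha da|alpha alpha2]; last first.
  rewrite -ong_mean1E//; apply: ong_limit_mean => //.
  by rewrite (lt_le_trans _ alpha2)// ltr1n.
have ka : k%:R < alpha by rewrite (lt_le_trans _ da)// ltr_nat.
have K1 : 1 <= k.+1%:R :> R by rewrite ler1n.
have kK : k%:R <= k.+1%:R :> R by rewrite ler_nat.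
have mean0 := ong_mean_gt0 k0 kK K1 ka.
rewrite unit_ball_volumeE.
exists (ong_mean k alpha k.+1%:R + (if alpha == k.+1%:R then 2 / ball_vol R k.+1 else 0)).
split; first by rewrite ltr_wpDr//; case: ifP => // _; rewrite divr_ge0// ltW// ball_vol_gt0.
split; first by move=> disp T P X hX; exact: expected_mdst_limit.
by exists (ong_mean k alpha k.+1%:R); split=> //; split=> //; exact: ong_limit_mean.
Qed.
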